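(* Let $p$ be a prime and let $G$ be a finitely presented pro-$p$ group. The following are equivalent: (i) $\delta(H)-1=[G:H](\delta(G)-1)$ for every open subgroup $H$ of $G$. (ii) $cd_p(G)\leq 2$.
   Context: Presentations are taken in the category of pro-$p$ groups: a finitely presented pro-$p$ group is one of the form $\langle X\mid R\rangle=F/N$ with $F$ the free pro-$p$ group on a finite set $X$ and $N$ the closed normal subgroup of $F$ generated by a finite set $R\subset F$. For a finitely presented pro-$p$ group $G$, $\delta(G)$ denotes the maximum of $|X|-|R|$ over all finite pro-$p$ presentations $\langle X\mid R\rangle$ of $G$. $cd_p(G)$ denotes the cohomological $p$-dimension of the profinite group $G$. *)

(* Defs.v *)
From HB Require Import structures.
From mathcomp Require Import all_boot all_algebra finmap.
From mathcomp Require Import all_classical topology.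

Set Implicit Arguments.
Unset Strict Implicit.
Unset Printing Implicit Defensive.

Local Open Scope classical_set_scope.
Local Open Scope group_scope.

HB.mixin Record isTopologicalGroup G & Topological G & Group G := {
  mulg_continuous : continuous (fun x : G * G => x.1 * x.2) ;
  invg_continuous : continuous (fun x : G => x^-1)
}.

#[short(type="topGroupType")]
HB.structure Definition TopologicalGroup :=
  {G of Topological G & Group G & isTopologicalGroup G}.

Definition subgroup_set (G : groupType) (H : set G) : Prop :=
  [/\ H 1, forall x y, H x -> H y -> H (x * y) & forall x, H x -> H x^-1].

Definition normal_set (G : groupType) (N : set G) : Prop :=
  subgroup_set N /\ forall g x, N x -> N (x ^ g).

(* A subgroup as a topological group in its own right, for the induced
   topology; the proof argument is there to make the instances inferable. *)
Definition subgroup_type (G : groupType) (H : set G) (sH : subgroup_set H) :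
  Type := set_type H.

Section SubgroupType.
Variables (G : topGroupType) (H : set G) (sH : subgroup_set H).
Local Notation T := (subgroup_type sH).

HB.instance Definition _ := SubChoice.copy T (set_type H).
HB.instance Definition _ := Topological.copy T (set_type H).

Fact subgroup_type_closed : group_closed (fun x : G => x \in H).
Proof.
case: sH => H1 HM HV; split; first exact/mem_set.
move=> x y xH yH; apply/mem_set; apply: HM; first exact/set_mem.
by apply: HV; exact/set_mem.
Qed.

HB.instance Definition _ :=
  SubChoice_isSubGroup.Build G (fun x : G => x \in H) T subgroup_type_closed.

Fact subgroup_type_mul_continuous : continuous (fun x : T * T => x.1 * x.2).
Proof.
apply: (@continuous_comp_initial _ _ _ (set_val : set_type H -> G)) => x.
have valc : continuous (fun y : T => val y : G).
  exact: (@initial_continuous (set_type H) G set_val).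
apply: (@cvg_trans _ ((fun z : T * T => val z.1 * val z.2) @ x)) => //.
apply: (@continuous_comp _ _ _ (fun z : T * T => (val z.1, val z.2))
          (fun z : G * G => z.1 * z.2)); last exact: mulg_continuous.
apply: cvg_pair.
  by apply: (continuous_comp (@cvg_fst _ _ _ _ _)); exact: valc.
by apply: (continuous_comp (@cvg_snd _ _ _ _ _)); exact: valc.
Qed.

Fact subgroup_type_inv_continuous : continuous (fun x : T => x^-1).
Proof.
apply: (@continuous_comp_initial _ _ _ (set_val : set_type H -> G)) => x.
have valc : continuous (fun y : T => val y : G).
  exact: (@initial_continuous (set_type H) G set_val).
apply: (@cvg_trans _ ((fun z : T => (val z)^-1) @ x)) => //.
apply: (@continuous_comp _ _ _ (fun z : T => val z : G) (fun z : G => z^-1)).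
  exact: valc.
exact: invg_continuous.
Qed.

HB.instance Definition _ := isTopologicalGroup.Build T
  subgroup_type_mul_continuous subgroup_type_inv_continuous.

End SubgroupType.

(* Number of left cosets; 0 if there are infinitely many. *)
Definition group_index (G : groupType) (H : set G) : nat :=
  #|` fset_set [set [set g * h | h in H] | g in [set: G]] |.

Definition pro_p (p : nat) (G : topGroupType) : Prop :=
  [/\ compact [set: G], hausdorff_space G, totally_disconnected [set: G] &
      forall N : set G, open N -> normal_set N ->
        exists n, group_index N = (p ^ n)%N].

Definition is_hom (G H : groupType) (phi : G -> H) : Prop :=
  {morph phi : x y / x * y}.

Definition free_pro_p (p : nat) (F : topGroupType) (X : finType)
    (iota : X -> F) : Prop :=
  pro_p p F /\
  forall (P : topGroupType) (f : X -> P), pro_p p P ->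
    exists! phi : F -> P,
      [/\ is_hom phi, continuous phi & forall x, phi (iota x) = f x].

Definition closed_normal_closure (F : topGroupType) (R : set F) : set F :=
  smallest (fun N : set F => closed N /\ normal_set N) R.

(* An isomorphism of topological groups F/N ~ G is given as a surjective
   homomorphism phi with kernel N for which G carries the quotient topology. *)
Definition presentation (p : nat) (G F : topGroupType) (X : finType)
    (iota : X -> F) (R : {fset F}) : Prop :=
  free_pro_p p iota /\
  exists phi : F -> G,
    [/\ is_hom phi, forall g, exists x, phi x = g,
        forall U : set G, open U <-> open (phi @^-1` U) &
        phi @^-1` [set 1] = closed_normal_closure [set` R]].

Definition finitely_presented_pro_p (p : nat) (G : topGroupType) : Prop :=
  exists (F : topGroupType) (X : finType) (iota : X -> F) (R : {fset F}),
    presentation p G iota R.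

Definition presentation_deficiencies (p : nat) (G : topGroupType) : set int :=
  [set z | exists (F : topGroupType) (X : finType) (iota : X -> F)
             (R : {fset F}),
             presentation p G iota R /\ z = (#|X|%:Z - #|` R|%:Z)%R].

(* The maximum of presentation_deficiencies; the default value 0 is returned
   only if there is no maximum. *)
Definition deficiency (p : nat) (G : topGroupType) : int :=
  xget 0%R [set z | presentation_deficiencies p G z /\
                    ubound (presentation_deficiencies p G) z].

Section Cohomology.
Variables (G : topGroupType) (A : zmodType) (act : G -> A -> A).

Definition discrete_module : Prop :=
  [/\ forall a, act 1 a = a,
      forall g h a, act (g * h) a = act g (act h a),
      forall g a b, act g (a + b)%R = (act g a + act g b)%R &
      continuous (fun x : G * discrete_topology A =>
                    act x.1 x.2 : discrete_topology A)].

(* Homogeneous continuous cochains: a q-cochain is a G-equivariant continuous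
   map G^(q+1) -> A. *)
Definition cochain (q : nat) (f : ('I_q.+1 -> G) -> A) : Prop :=
  continuous (f : {ptws 'I_q.+1 -> G} -> discrete_topology A) /\
  forall g x, f (fun i => g * x i) = act g (f x).

Definition codiff (q : nat) (f : ('I_q.+1 -> G) -> A) (x : 'I_q.+2 -> G) : A :=
  (\sum_(i < q.+2) f (fun j => x (lift i j)) *~ (-1) ^+ i)%R.

Definition cocycle (q : nat) (f : ('I_q.+1 -> G) -> A) : Prop :=
  cochain f /\ forall x, codiff f x = 0%R.

Definition coboundary (q : nat) : (('I_q.+1 -> G) -> A) -> Prop :=
  match q with
  | 0 => fun f => forall x, f x = 0%R
  | q'.+1 => fun f => exists2 h : ('I_q'.+1 -> G) -> A,
               cochain h & forall x, f x = codiff h x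
  end.

(* The p-primary component of H^q(G, A) vanishes. *)
Definition primary_cohomology_trivial (p q : nat) : Prop :=
  forall f : ('I_q.+1 -> G) -> A, cocycle f ->
    (exists k, coboundary (fun x => f x *+ (p ^ k)%N)%R) -> coboundary f.

End Cohomology.

(* cd_p(G) <= n, where cd_p(G) is the least n (or infinity) such that
   H^q(G, A)(p) = 0 for all q > n and all discrete torsion G-modules A. *)
Definition cdp_le (p : nat) (G : topGroupType) (n : nat) : Prop :=
  forall (A : zmodType) (act : G -> A -> A),
    discrete_module act ->
    (forall a : A, exists2 m, (0 < m)%N & (a *+ m = 0)%R) ->
    forall q, (n < q)%N -> primary_cohomology_trivial act p q.

(* Main.v *)
(* Fix a presentation [f : F -> G] with kernel [N] whose relators [R] are minimal;
   by comparison with any other presentation, the deficiency of [G] is then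
   [#|X| - #|R|].  Both conditions are equivalent to the freeness of the relation
   module [N / N^p[N,N]] over [F_p[[G]]] on the classes of [R].

   For an open subgroup [H], the preimage of [H] is free by Schreier's theorem, and
   the conjugates of [R] by a transversal present [H].  The Euler identity for [H]
   says exactly that these relators are again minimal; for all open normal [H]
   together this is the freeness of the relation module.

   If the relation module is free, H^3(G, A) = 0 for every A killed by p: shift a
   3-cocycle to degree 2 and pull it back to [F], where it becomes a coboundary, then
   correct the cochain by a homomorphism on [N] with prescribed values on the
   conjugates of [R].  Further shifts and devissage of the torsion give cd_p(G) <= 2.

   Conversely, let S be the set of restrictions to the conjugates of [R], modulo an
   open normal subgroup, of homomorphisms [N -> 'F_p].  If S were not everything, a
   p-group argument would give a function outside S which is fixed modulo S.  It
   defines a class in H^1(G, Hom(N, 'F_p)), whose image in H^3(G, 'F_p) under the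
   transgression vanishes; since [F] has no H^2, the class itself is trivial, and
   the function yields an invariant one, which lies in S by minimality of [R]. *)

From HB Require Import structures.
Require Import Defs.
From mathcomp Require Import all_boot all_order all_fingroup all_algebra all_solvable.
From mathcomp Require Import finmap.
From mathcomp Require Import all_classical topology.
Import GRing.Theory.

Set Implicit Arguments.
Unset Strict Implicit.
Unset Printing Implicit Defensive.

Local Open Scope classical_set_scope.
Local Open Scope group_scope.

(** * Abelian group identities *)

(** Freeness is given only by a universal property among pro-$p$ groups, so there are no reduced
    words to argue with. Facts about $F$ come from building an auxiliary pro-$p$ group (a twisted
    product to lift cochains, a wreath product for Schreier's theorem, a closed subgroup for
    generation), mapping $F$ into it, and recognising the composite with a projection or inclusion
    as the identity by uniqueness. Proving these groups pro-$p$ is why the index condition is first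
    traded for one on $p$-power exponents. The relation module is never formed either: only its dual
    occurs, as functions on $F$ that are additive and continuous on $N$. Minimality and freeness
    become the possibility of prescribing values, and dimensions are compared by counting functions
    into $F_p$. Freeness enters cohomology as projectivity. A shifted cocycle lives in $C(G,A)/A$,
    and its splitting over $F$ restricts to an equivariant map from $N$ to that quotient.
    Projectivity lifts this map to $C(G,A)$, and the lift, evaluated at $1$, is the correcting
    homomorphism on $N$. *)

Section ZmodNormalization.
Local Open Scope ring_scope.

(** Syntax for a reflexive procedure in abelian groups: expressions with equal integer coefficients
    agree in every group, and the coefficients are compared by computation. The resulting tactic
    [zmod] closes the cocycle identities below. *)
Inductive zexpr := ZVar of nat | ZZero | ZAdd of zexpr & zexpr | ZOpp of zexpr.

Fixpoint zeval (A : zmodType) (env : seq A) (e : zexpr) : A :=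
  match e with
  | ZVar n => env`_n
  | ZZero => 0
  | ZAdd e1 e2 => zeval env e1 + zeval env e2
  | ZOpp e1 => - zeval env e1
  end.

Fixpoint zcoef (e : zexpr) (i : nat) : int :=
  match e with
  | ZVar n => if n == i then 1 else 0
  | ZZero => 0
  | ZAdd e1 e2 => zcoef e1 i + zcoef e2 i
  | ZOpp e1 => - zcoef e1 i
  end.

Lemma zevalE (A : zmodType) (env : seq A) (e : zexpr) :
  zeval env e = \sum_(i < size env) env`_i *~ zcoef e i.
Proof.
elim: e => [n||e1 IH1 e2 IH2|e1 IH] /=.
- have [ltn|gen] := ltnP n (size env).
    rewrite (bigD1 (Ordinal ltn))//= eqxx mulr1z big1 ?addr0// => i ni.
    have -> : (n == i) = false by apply/eqP => e; case/eqP: ni; exact/val_inj.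
    by rewrite mulr0z.
  rewrite nth_default// big1// => i _.
  have -> : (n == i) = false; last by rewrite mulr0z.
  by apply/eqP => ni; move: gen; rewrite ni leqNgt ltn_ord.
- by rewrite big1// => i _; rewrite mulr0z.
- by rewrite IH1 IH2 -big_split; apply: eq_bigr => i _; rewrite mulrzDr.
- by rewrite IH -sumrN; apply: eq_bigr => i _; rewrite mulrNz.
Qed.

Lemma zeval_eq (A : zmodType) (env : seq A) (e1 e2 : zexpr) :
  all (fun i => zcoef e1 i == zcoef e2 i) (iota 0 (size env)) ->
  zeval env e1 = zeval env e2.
Proof.
move=> /allP e12; rewrite !zevalE; apply: eq_bigr => i _; congr (_ *~ _).
by apply/eqP/e12; rewrite mem_iota add0n ltn_ord.
Qed.

End ZmodNormalization.

Ltac zindex env x :=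
  lazymatch env with
  | nil => fail
  | cons ?y ?r =>
    (* The dummy [match] runs the tactic [unify] while a term is being computed; its failure selects
       the next branch. Atoms are thus identified up to unification, not syntactically. *)
    match constr:(Set) with
    | _ => let _ := match constr:(Set) with _ => unify x y end in constr:(O)
    | _ => let n := zindex r x in constr:(S n)
    end
  end.

Ltac zatoms A env t :=
  lazymatch t with
  | @Algebra.add _ ?x ?y => let e := zatoms A env x in zatoms A e y
  | @Algebra.opp _ ?x => zatoms A env x
  | @Algebra.zero _ => env
  | _ => match constr:(Set) with
         | _ => let _ := zindex env t in env
         | _ => constr:(@cons A t env)
         end
  end.

Ltac zreify env t :=
  lazymatch t with
  | @Algebra.add _ ?x ?y =>
    let e1 := zreify env x in let e2 := zreify env y in constr:(ZAdd e1 e2)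
  | @Algebra.opp _ ?x => let e1 := zreify env x in constr:(ZOpp e1)
  | @Algebra.zero _ => constr:(ZZero)
  | _ => let n := zindex env t in constr:(ZVar n)
  end.

Ltac zmod :=
  lazymatch goal with
  | |- @eq ?T ?l ?r =>
    let env := zatoms T (@nil T) l in
    let env := zatoms T env r in
    let e1 := zreify env l in
    let e2 := zreify env r in
    refine (@zeval_eq _ env e1 e2 _); vm_compute; reflexivity
  end.

(** * Profinite and pro-p groups *)

Section ZeroDimensional.
Variable T : topologicalType.
Hypotheses (cT : compact [set: T]) (hT : hausdorff_space T).

Let quasi (x : T) : set T := [set z | forall D, clopen D -> D x -> D z].

Let quasi_sep (x : T) (K : set T) : closed K -> K `&` quasi x = set0 ->
  exists D, [/\ clopen D, D x & D `&` K = set0].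
Proof.
move=> cK KQ.
pose P := fun D : set T => clopen D /\ D x.
(* Families containing all small enough clopen neighbourhoods of [x] form a filter; the
   near-covering form of compactness along it replaces a finite subcover of [K] by complements of
   clopen sets. *)
pose G := filter_from P (fun D => [set D' | P D' /\ D' `<=` D]).
have FG : ProperFilter G.
  apply: filter_from_proper; last by move=> D PD; exists D; split.
  apply: filter_from_filter; first by exists setT; split=> //; exact: clopenT.
  move=> A B [cA Ax] [cB Bx]; exists (A `&` B).
    by split; [exact: clopenI|].
  by move=> D [PD DAB]; split; split=> // z /DAB[].
have cptK : compact K by apply: (subclosed_compact cK cT).
have [|D [cD Dx] DK] := (iffLR (compact_near_coveringP K) cptK)
    (set T) G (fun D y => ~ D y) _.
  move=> y Ky.
  have : ~ quasi x y by move=> Qy; have : (K `&` quasi x) y by []; rewrite KQ.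
  move=> /existsNP[D /not_implyP[cD /not_implyP[Dx nDy]]].
  exists (~` D, [set D' | P D' /\ D' `<=` D]).
    split => /=; last by exists D.
    by apply: open_nbhs_nbhs; split=> //; apply: closed_openC; case: cD.
  by move=> [z D'] /= [nDz [_ D'D]] /D'D.
exists D; split=> //; rewrite -subset0 => y [Dy Ky].
exact: (DK D (conj (conj cD Dx) (@subset_refl _ D)) y Ky Dy).
Qed.

(** In a compact Hausdorff space the quasi-component of a point, the intersection of its clopen
    neighbourhoods, is connected. Normality separates the two parts of a splitting by a set [V]; a
    clopen neighbourhood of the point avoiding the boundary of [V] cuts out of [V] a clopen set,
    which decides the splitting. *)
Lemma totally_disconnected_zero_dimensional :
  totally_disconnected [set: T] -> zero_dimensional T.
Proof.
move=> tdT x y /eqP xy; apply: contrapT => nU.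
have Qy : quasi x y.
  by move=> D cD Dx; apply: contrapT => nDy; apply: nU; exists D.
suff cQ : connected (quasi x).
  have : connected_component [set: T] x y by exists (quasi x) => //; split=> // D.
  by rewrite tdT// => yx; exact: xy.
move=> B [b Bb] [O oO BO] [C cC BC].
pose B2 := quasi x `&` ~` O.
have cQ : closed (quasi x).
  rewrite (_ : quasi x = \bigcap_(D in [set D | clopen D /\ D x]) D).
    by apply: closed_bigI => D [[]].
  apply/seteqP; split=> [z Qz D [cD Dx]|z Qz D cD Dx]; first exact: Qz.
  by apply: Qz.
have cB : closed B by rewrite BC; exact: closedI.
have cB2 : closed B2 by apply: closedI => //; exact: open_closedC.
have B2C : B `<=` ~` B2 by move=> z; rewrite {1}BO => -[Qz Oz] [_].
have [V BV VB2] : filter_from (set_nbhs B) closure (~` B2).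
  apply: (compact_normal hT cT cB).
  move=> z Bz; apply: open_nbhs_nbhs; split; first exact: closed_openC.
  exact: B2C.
have BVo : B `<=` V° by move=> z Bz; exact: BV.
have VcV : V° `<=` closure V.
  by apply: subset_trans (@subset_closure _ _); exact: interior_subset.
have [D [cD Dx DK]] : exists D, [/\ clopen D, D x &
    D `&` (closure V `&` ~` V°) = set0].
  apply: quasi_sep.
    by apply: closedI; [exact: closed_closure|exact/open_closedC/open_interior].
  rewrite -subset0 => z [[cVz nVz] Qz].
  have : ~ B2 z by exact: VB2.
  apply; split=> // Oz; apply: nVz; apply: BVo; rewrite BO; split=> //.
have DV z : D z -> closure V z -> V° z.
  move=> Dz cVz; apply: contrapT => nVz.
  by have : (D `&` (closure V `&` ~` V°)) z by []; rewrite DK.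
have cDV : clopen (D `&` V°).
  case: cD => oD cD; split; first by apply: openI => //; exact: open_interior.
  rewrite (_ : D `&` V° = D `&` closure V).
    by apply: closedI => //; exact: closed_closure.
  by apply/seteqP; split=> z [Dz Vz]; split=> //; [exact: VcV|exact: DV].
have [Ox|nOx] := pselect (O x).
  rewrite BO; apply/seteqP; split=> z; first by case.
  move=> Qz; split=> //; apply: contrapT => nOz.
  have [|_ /VcV Vz] := Qz (D `&` V°) cDV.
    by split=> //; apply: BVo; rewrite BO; split.
  by apply: (VB2 z Vz); split.
have cDV2 : clopen (D `&` ~` (D `&` V°)).
  by apply: clopenI => //; exact: clopenC.
have Qb : quasi x b by move: Bb; rewrite BO => -[].
have [|Db nDVb] := Qb _ cDV2.
  by split=> // -[_ /VcV Vx]; apply: (VB2 x Vx); split=> // D'.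
by case: nDVb; split=> //; apply: BVo.
Qed.

End ZeroDimensional.

(** Continuity into a discrete space without a topology on the target: [A] may be any type, and
    postcomposition with any map is harmless. *)
Definition locally_constant (T : topologicalType) (A : Type) (f : T -> A) :=
  forall x, \forall y \near x, f y = f x.

Section LocallyConstant.
Implicit Types T U : topologicalType.

Lemma lcP T (A : choiceType) (f : T -> A) :
  locally_constant f <-> continuous (f : T -> discrete_topology A).
Proof.
split=> fc x; last exact: (fc x [set f x] (@discrete_set1 (discrete_topology A) _)).
by apply/(@discrete_cvg (discrete_topology A)); exact: fc.
Qed.

Lemma lc_comp T U A (f : U -> A) (g : T -> U) :
  locally_constant f -> continuous g -> locally_constant (f \o g).
Proof. by move=> fc gc x; exact: (gc x _ (fc (g x))). Qed.

Lemma lc_post T A B (f : T -> A) (h : A -> B) :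
  locally_constant f -> locally_constant (h \o f).
Proof. by move=> fc x; apply: filterS (fc x) => y /= ->. Qed.

Lemma lc_post2 T A B C (f : T -> A) (g : T -> B) (h : A -> B -> C) :
  locally_constant f -> locally_constant g ->
  locally_constant (fun x => h (f x) (g x)).
Proof.
by move=> fc gc x; apply: filterS (filterI (fc x) (gc x)) => y [-> ->].
Qed.

Lemma lc_cst T A (a : A) : locally_constant (fun _ : T => a).
Proof. by move=> x; exact: nearW. Qed.

Lemma lc_open T A (f : T -> A) (a : set A) :
  locally_constant f -> open (f @^-1` a).
Proof.
by move=> fc; rewrite openE => x ax; apply: filterS (fc x) => y /= ->.
Qed.

Lemma lc_closed T A (f : T -> A) (a : set A) :
  locally_constant f -> closed (f @^-1` a).
Proof. by move=> fc; rewrite -openC; exact: (@lc_open _ _ f (~` a)). Qed.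

(** The tube lemma along a filter. Most later uses of compactness go through it. *)
Lemma compact_forall_near T (I : Type) (F : set_system I) (P : I -> T -> Prop) :
  Filter F -> compact [set: T] ->
  (forall x : T, \forall x' \near x & i \near F, P i x') ->
  \forall i \near F, forall x, P i x.
Proof.
move=> FF cT PF.
have : \forall i \near F, [set: T] `<=` P i.
  exact: (iffLR (compact_near_coveringP _) cT I F P FF (fun x _ => PF x)).
by apply: filterS => i Pi x; exact: Pi.
Qed.

Lemma lc_finite T A (f : T -> A) :
  compact [set: T] -> locally_constant f -> finite_set (range f).
Proof.
move=> cT fc.
(* Finite sets ordered by inclusion: near each point the value lies in all large enough finite sets,
   so by compactness one finite set contains every value. *)
pose F := filter_from (fun D : set A => finite_set D)
  (fun D => [set D' | finite_set D' /\ D `<=` D']).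
have FF : Filter F.
  apply: filter_from_filter; first by exists set0.
  move=> D D' fD fD'; exists (D `|` D'); first by rewrite /= finite_setU.
  by move=> E [fE]; rewrite subUset => -[DE D'E]; split; split.
have [|D fD DP] := @compact_forall_near T (set A) F (fun D x => D (f x)) FF cT.
  move=> x; exists ([set y | f y = f x], [set D' | finite_set D' /\ [set f x] `<=` D']).
    split=> /=; first exact: fc.
    by exists [set f x].
  by case=> y E /= [-> [_ fE]]; exact: fE.
have /= fD2 := DP D (conj fD (@subset_refl _ D)).
by apply: sub_finite_set fD => _ [x _ <-]; exact: fD2.
Qed.

(** Turns a function of two variables into a locally constant map to a space of functions; this
    makes modules of functions on a compact group smooth. *)
Lemma lc_uncurry T U A (f : T -> U -> A) : compact [set: U] ->
  locally_constant (fun x : T * U => f x.1 x.2) -> locally_constant f.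
Proof.
move=> cU fc x.
have : \forall x' \near x, forall u, f x' u = f x u.
  apply: compact_forall_near => // u.
  have [[V W] /= [Vx Wu] VW] := fc (x, u).
  exists (W, V) => // -[u' x'] /= [Wu' Vx'].
  rewrite (VW (x', u')) //= -(VW (x, u')) //=.
  by split=> //=; exact: nbhs_singleton.
by apply: filterS => x' e; apply/funext.
Qed.

End LocallyConstant.

Section TopGroup.
Variable G : topGroupType.

Lemma mul_continuous (T : topologicalType) (f g : T -> G) :
  continuous f -> continuous g -> continuous (fun x => f x * g x).
Proof.
move=> fc gc x.
apply: (@continuous_comp _ _ _ (fun z => (f z, g z)) (fun z : G * G => z.1 * z.2)).
  by apply: cvg_pair; [exact: fc|exact: gc].
exact: mulg_continuous.
Qed.

Lemma inv_continuous (T : topologicalType) (f : T -> G) :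
  continuous f -> continuous (fun x => (f x)^-1).
Proof.
by move=> fc x; apply: (@continuous_comp _ _ _ f (fun z : G => z^-1));
  [exact: fc|exact: invg_continuous].
Qed.

Lemma mull_continuous (a : G) : continuous (fun x => a * x).
Proof. by apply: mul_continuous => x; [exact: cvg_cst|exact: cvg_id]. Qed.

Lemma mulr_continuous (a : G) : continuous (fun x => x * a).
Proof. by apply: mul_continuous => x; [exact: cvg_id|exact: cvg_cst]. Qed.

Lemma nbhs_mull (a : G) (O : set G) : nbhs a O -> \forall u \near (1 : G), O (a * u).
Proof. by move=> Oa; apply: (@mull_continuous a 1 O); rewrite /= mulg1. Qed.

Lemma nbhs_mulr (a : G) (O : set G) : nbhs a O -> \forall u \near (1 : G), O (u * a).
Proof. by move=> Oa; apply: (@mulr_continuous a 1 O); rewrite /= mul1g. Qed.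

Lemma near_mull (a : G) (P : set G) : (\forall u \near (1 : G), P u) ->
  \forall x \near a, P (a^-1 * x).
Proof.
by move=> P1; apply: (@mull_continuous a^-1 a P); rewrite /= mulVg.
Qed.

Lemma near_mulr (a : G) (P : set G) : (\forall u \near (1 : G), P u) ->
  \forall x \near a, P (x * a^-1).
Proof.
by move=> P1; apply: (@mulr_continuous a^-1 a P); rewrite /= mulgV.
Qed.

Lemma subgroup_open (H : set G) : subgroup_set H -> nbhs 1 H -> open H.
Proof.
move=> [H1 HM HV] nH; rewrite openE => x Hx.
by apply: filterS (near_mull x nH) => y Hy; rewrite -(mulVKg x y); exact: HM.
Qed.

Lemma open_subgroup_nbhs (H : set G) : subgroup_set H -> open H -> nbhs 1 H.
Proof. by move=> [H1 _ _] oH; exact: open_nbhs_nbhs. Qed.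

Lemma open_subgroup_lc (H : set G) : subgroup_set H -> open H ->
  locally_constant H.
Proof.
move=> sH oH x; apply: filterS (near_mull x (open_subgroup_nbhs sH oH)).
case: sH => H1 HM HV y Hy; apply/propext; split=> [Hy'|Hx].
  by rewrite -(mulVKg y x); apply: HM => //; rewrite -[_ * _]invgK invMg invgK;
    exact: HV.
by rewrite -(mulVKg x y); exact: HM.
Qed.

Lemma open_subgroup_closed (H : set G) : subgroup_set H -> open H -> closed H.
Proof.
move=> sH oH; have := @lc_closed _ _ H [set True] (open_subgroup_lc sH oH).
rewrite (_ : H @^-1` _ = H)//; apply/seteqP; split=> x /=; first by move=> ->.
by move=> Hx; apply/propext.
Qed.

(** The intersection of all conjugates works; the tube lemma over the conjugating element shows that
    it is open. *)
Lemma normal_open_core (H : set G) : compact [set: G] ->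
  subgroup_set H -> open H -> exists N : set G, [/\ open N, normal_set N & N `<=` H].
Proof.
move=> cG sH oH; pose N := [set x : G | forall g, H (x ^ g)].
have sN : subgroup_set N.
  case: sH => H1 HM HV; split=> [g|x y Nx Ny g|x Nx g].
  - by rewrite conj1g.
  - by rewrite conjMg; exact: HM.
  - by rewrite conjVg; exact: HV.
exists N; split.
- apply: subgroup_open => //.
  apply: compact_forall_near => // g.
  have cc : continuous (fun z : G * G => z.2 ^ z.1).
    move=> z; apply: mul_continuous => {}z.
      by apply: inv_continuous => {}z; exact: cvg_fst.
    by apply: mul_continuous => {}z; [exact: cvg_snd|exact: cvg_fst].
  apply: (cc (g, 1)) => /=; rewrite conj1g.
  exact: open_subgroup_nbhs.
- by split=> // g x Nx h; rewrite -conjgM; exact: Nx.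
- by move=> x /(_ 1); rewrite conjg1.
Qed.

Lemma open_subgroup_basis (O : set G) : compact [set: G] -> hausdorff_space G ->
  zero_dimensional G -> nbhs 1 O ->
  exists N : set G, [/\ open N, normal_set N & N `<=` O].
Proof.
move=> cG hG zG nO.
have [D [D1 [oD cD]] DO] := zero_dimensional_cvg hG zG cG nO.
(* The stabilizer of the clopen set [D] under right translation. It lies in [D] because [1] does,
   and the tube lemma makes it open. *)
pose H := [set x : G | forall y, D y <-> D (y * x)].
have sH : subgroup_set H.
  split=> [y|x x' Hx Hx' y|x Hx y].
  - by rewrite mulg1.
  - by rewrite mulgA -Hx'.
  - by have [] := Hx (y * x^-1); rewrite mulgVK; split.
have lD : locally_constant D.
  move=> x; have [Dx|nDx] := pselect (D x).
    have : \forall y \near x, D y by exact: open_nbhs_nbhs.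
    by apply: filterS => y Dy; apply/propext.
  have : \forall y \near x, (~` D) y.
    by apply: open_nbhs_nbhs; split=> //; exact: closed_openC.
  by apply: filterS => y nDy; apply/propext; split.
have oH : open H.
  apply: subgroup_open => //; apply: compact_forall_near => // y.
  have cm : continuous (fun z : G * G => z.1 * z.2) by exact: mulg_continuous.
  have [[V W] /= [Vy W1] VW] := cm (y, 1) _ (lD (y * 1)).
  exists (V `&` [set z | D z = D y], W).
    by split=> //=; apply: filterI => //; exact: lD.
  move=> [a b] /= [[Va Da] Wb]; rewrite Da.
  by have /= -> := VW (a, b) (conj Va Wb); rewrite mulg1.
have [N [oN nN NH]] := normal_open_core cG sH oH.
by exists N; split=> // x /NH Hx; apply: DO; rewrite -(mul1g x) -Hx.
Qed.

End TopGroup.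

Section Cosets.
Variables (G : topGroupType) (H : set G).
Hypotheses (cG : compact [set: G]) (sH : subgroup_set H) (oH : open H).

Let H1 : H 1. Proof. by case: sH. Qed.
Let HM x y : H x -> H y -> H (x * y). Proof. by case: sH => _ + _; apply. Qed.
Let HV x : H x -> H x^-1. Proof. by case: sH => _ _; apply. Qed.

Lemma subgroup_coset_sym x y : H (x^-1 * y) -> H (y^-1 * x).
Proof. by move=> /HV; rewrite invMg invgK. Qed.

Lemma subgroup_coset_trans y x z : H (x^-1 * y) -> H (y^-1 * z) -> H (x^-1 * z).
Proof. by move=> xy yz; have := HM xy yz; rewrite mulgA mulgK. Qed.

Let rep (x : G) : G := xget 1 [set y | H (x^-1 * y)].

Let repP x : H (x^-1 * rep x).
Proof. by apply: (@xgetPex _ 1 [set y | H (x^-1 * y)]); exists x; rewrite /= mulVg. Qed.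

Let rep_eq x y : rep x = rep y <-> H (x^-1 * y).
Proof.
split=> [e|xy].
  by apply: (subgroup_coset_trans (repP x)); rewrite e; apply/subgroup_coset_sym/repP.
rewrite /rep; congr (xget 1 _); apply/seteqP; split=> z /= xz.
  exact: subgroup_coset_trans (subgroup_coset_sym xy) xz.
exact: subgroup_coset_trans xy xz.
Qed.

Let rep_lc : locally_constant rep.
Proof.
move=> x; apply: filterS (near_mull x (open_subgroup_nbhs sH oH)) => y xy.
by apply/rep_eq/subgroup_coset_sym.
Qed.

Let rep_finite : finite_set (range rep). Proof. exact: lc_finite. Qed.

Let index_rep : group_index H = #|` fset_set (range rep)|.
Proof.
pose co x := [set x * h | h in H].
have coE x : co (rep x) = co x.
  apply/seteqP; split=> _ [h Hh <-].
    by exists (x^-1 * rep x * h); [apply: HM => //; exact: repP|rewrite !mulgA mulgV mul1g].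
  exists ((rep x)^-1 * x * h).
    by apply: HM => //; apply: subgroup_coset_sym; exact: repP.
  by rewrite !mulgA mulgV mul1g.
rewrite /group_index (_ : [set _ | _ in _] = co @` range rep); last first.
  apply/seteqP; split=> [_ [x _ <-]|_ [_ [x _ <-] <-]].
    by exists (rep x); [exists x|exact: coE].
  by exists (rep x).
rewrite fset_set_image// card_in_imfset//= => x y.
rewrite !in_fset_set// !inE => -[x' _ <-] [y' _ <-] e; apply/rep_eq.
have : co (rep y') y'.
  by exists ((rep y')^-1 * y'); [exact/subgroup_coset_sym/repP|rewrite mulgA mulgV mul1g].
rewrite -e coE => -[h Hh <-]; by rewrite mulKg.
Qed.

(** A numbering of the left cosets by ordinals. Later arguments about [group_index] use this map
    instead of the set of sets in its definition. *)
Lemma coset_space : exists c : G -> 'I_(group_index H),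
  (forall i, exists x, c x = i) /\ forall x y, c x = c y <-> H (x^-1 * y).
Proof.
rewrite index_rep; set A := fset_set _.
have repA x : rep x \in A by rewrite in_fset_set// inE; exists x.
have cA : #|{: A}| = #|` A| by rewrite cardfE.
exists (fun x => cast_ord cA (enum_rank [` repA x]%fset)); split=> [i|x y].
  have := valP (enum_val (cast_ord (esym cA) i)).
  rewrite in_fset_set// inE => -[x _ e]; exists x.
  apply: (@cast_ord_inj _ _ (esym cA)); rewrite cast_ordK.
  by rewrite -[RHS]enum_valK; congr enum_rank; apply: val_inj.
rewrite -rep_eq; split=> [/cast_ord_inj/enum_rank_inj[]//|e].
by congr (cast_ord _ (enum_rank _)); apply: val_inj.
Qed.

End Cosets.

Section FiniteQuotient.
Variables (p : nat) (G : topGroupType) (N : set G).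
Hypotheses (p_prime : prime p) (cG : compact [set: G]).
Hypotheses (oN : open N) (nN : normal_set N).

(** The quotient is replaced by its regular representation: the right translations of the cosets
    form a permutation group whose order is exactly the index. Lagrange and Cauchy then relate the
    orders of its elements to the index. *)
Lemma index_p_powerP :
  (forall x, exists k, N (x ^+ (p ^ k)%N)) <-> (exists n, group_index N = (p ^ n)%N).
Proof.
have [sN NJ] := nN.
have [c [c_surj cE]] := coset_space cG sN oN.
move: (group_index N) c c_surj cE => m c c_surj cE.
pose s i := xget 1 [set x | c x = i].
have cs i : c (s i) = i by apply: (@xgetPex _ 1 [set x | c x = i]); exact: c_surj.
have cMr x y g : c x = c y -> c (x * g) = c (y * g).
  by move=> /cE xy; apply/cE; have := NJ g _ xy; rewrite conjgE invMg !mulgA.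
have cMrI x y g : c (x * g) = c (y * g) -> c x = c y.
  by move=> /(cMr _ _ g^-1); rewrite !mulgK.
pose r0 (g : G) i := c (s i * g).
have r0_inj g : injective (r0 g) by move=> i j /cMrI; rewrite !cs.
pose r (g : G) : 'S_m := perm (@r0_inj g).
have rE g x : r g (c x) = c (x * g) by rewrite permE; apply: cMr; exact: cs.
have r_eq g h : c g = c h -> r g = r h.
  move=> gh; apply/permP => i; have [x <-] := c_surj i; rewrite !rE; apply/cE.
  by rewrite invMg -mulgA mulKg; exact/cE.
have rM g h : r (g * h) = r g * r h.
  by apply/permP => i; have [x <-] := c_surj i; rewrite permM !rE mulgA.
have r1 : r 1 = 1 by apply/permP => i; have [x <-] := c_surj i; rewrite perm1 rE mulg1.
have rX g k : r (g ^+ k) = r g ^+ k.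
  by elim: k => [|k IH]; [rewrite !expg0|rewrite !expgS rM IH].
have rN g : r g = 1 <-> N g.
  split=> [e|Ng].
    have : c 1 = c g by rewrite -[in RHS](mul1g g) -rE e perm1.
    by move=> /cE; rewrite invg1 mul1g.
  by rewrite -r1; apply/esym/r_eq/cE; rewrite invg1 mul1g.
pose R : {set 'S_m} := [set x | `[< exists g : G, r g = x >]]%SET.
have gR : group_set R.
  apply/group_setP; split; first by rewrite inE; apply/asboolP; exists (1 : G).
  move=> x y; rewrite !inE => -[g <-] [h <-].
  by exists (g * h).
have cR : #|Group gR| = m.
  rewrite -[RHS]card_ord -cardsT.
  have -> : [set: 'I_m]%SET = ((fun x : 'S_m => x (c 1)) @: R)%SET.
    apply/setP => i; rewrite inE; apply/esym/imsetP; have [g <-] := c_surj i.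
    exists (r g); first by rewrite !inE; exists g.
    by rewrite rE mul1g.
  rewrite card_in_imset// => x y; rewrite !inE => -[g <-] [h <-].
  by rewrite !rE !mul1g; exact: r_eq.
split=> [Np|[n mE] x]; last first.
  exists n; apply/rN; rewrite rX.
  have rR : r x \in Group gR by rewrite !inE; exists x.
  apply/eqP; rewrite -order_dvdn -mE.
  by apply: (dvdn_trans (order_dvdG rR)); rewrite cR.
have : p.-nat m.
  apply/pnatP => [|q q_prime qm]; first by rewrite -cR cardG_gt0.
  have [|x xR xq] := @Cauchy _ q (Group gR) q_prime; first by rewrite cR.
  move: xR; rewrite !inE => -[g gx]; have [k /rN] := Np g.
  rewrite rX gx => /eqP; rewrite -order_dvdn xq Euclid_dvdX// => /andP[qp _].
  by move: qp; rewrite (dvdn_prime2 q_prime p_prime).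
by move=> /p_natP[n ->]; exists n.
Qed.

End FiniteQuotient.

Lemma pro_p_zero_dim p (G : topGroupType) : pro_p p G -> zero_dimensional G.
Proof. by case=> cG hG tG _; exact: totally_disconnected_zero_dimensional. Qed.

Lemma pro_p_basis p (G : topGroupType) (O : set G) : pro_p p G -> nbhs 1 O ->
  exists N : set G, [/\ open N, normal_set N & N `<=` O].
Proof.
move=> Gp; have zG := pro_p_zero_dim Gp; case: Gp => cG hG _ _.
exact: open_subgroup_basis.
Qed.

(** A form that passes to closed subgroups and extensions without counting cosets: exponents replace
    indices, and separation by clopen sets replaces the two separation axioms. *)
Lemma pro_pP p (G : topGroupType) : prime p -> pro_p p G <->
  [/\ compact [set: G], zero_dimensional G & forall (N : set G) x,
    open N -> normal_set N -> exists k, N (x ^+ (p ^ k)%N)].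
Proof.
move=> p_prime; split=> [Gp|[cG zG Gp]].
  have zG := pro_p_zero_dim Gp; case: Gp => cG hG _ Gp.
  by split=> // N x oN nN; move: x; apply/index_p_powerP => //; exact: Gp.
split=> //; last by move=> N oN nN; apply/index_p_powerP => // x; exact: Gp.
  rewrite open_hausdorff => x y /zG[U [[oU cU] Ux Uy]].
  exists (U, ~` U); rewrite !inE //=; split=> //; first exact: closed_openC.
  by rewrite -subset0 => z [].
exact: zero_dimension_totally_disconnected.
Qed.

Section Homs.
Variables (G H : groupType) (f : G -> H).
Hypothesis fM : is_hom f.

Lemma hom1 : f 1 = 1.
Proof. by apply: (mulgI (f 1)); rewrite -fM !mulg1. Qed.

Lemma homV x : f x^-1 = (f x)^-1.
Proof. by apply: (mulgI (f x)); rewrite -fM !mulgV hom1. Qed.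

Lemma homX x n : f (x ^+ n) = f x ^+ n.
Proof. by elim: n => [|n IH]; rewrite ?expg0 ?hom1// !expgS fM IH. Qed.

Lemma homJ x y : f (x ^ y) = f x ^ f y.
Proof. by rewrite !conjgE !fM homV. Qed.

End Homs.

Lemma normal_coset_expg (G : groupType) (N : set G) (x n : G) k :
  normal_set N -> N n -> N ((x ^+ k)^-1 * (x * n) ^+ k).
Proof.
move=> [[N1 NM NV] NJ] Nn; elim: k => [|k IH]; first by rewrite !expg0 invg1 mulg1.
rewrite !expgSr invMg.
have := NM _ _ (NJ x _ IH) Nn; congr (N _).
by rewrite conjgE !mulgA.
Qed.

Lemma normal_preimage (G H : groupType) (f : G -> H) (N : set H) :
  is_hom f -> normal_set N -> normal_set (f @^-1` N).
Proof.
move=> fM [[N1 NM NV] NJ]; split; first split=> [|x y Nx Ny|x Nx] /=.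
- by rewrite (hom1 fM).
- by rewrite fM; exact: NM.
- by rewrite (homV fM); exact: NV.
- by move=> g x Nx /=; rewrite (homJ fM); exact: NJ.
Qed.

Lemma pro_p_expg_nbhs p (G : topGroupType) (O : set G) (x : G) : prime p ->
  pro_p p G -> nbhs 1 O -> exists k, O (x ^+ (p ^ k)%N).
Proof.
move=> p_prime Gp /(pro_p_basis Gp)[N [oN nN NO]].
by case/(pro_pP _ p_prime): Gp => _ _ /(_ N x oN nN)[k Nk]; exists k; exact: NO.
Qed.

(** Some $p$-power of [w] has its image in the image of [N], so modulo [N] it is an element of the
    kernel, and a further $p$-power falls into [N]. This serves the twisted and the wreath products
    below. *)
Lemma pro_p_extension p (W F : topGroupType) (f : W -> F) :
  prime p -> compact [set: W] -> zero_dimensional W -> pro_p p F -> is_hom f ->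
  (forall N : set W, open N -> normal_set N -> nbhs 1 (f @` N)) ->
  (forall (N : set W) w, open N -> normal_set N -> f w = 1 ->
     exists k, N (w ^+ (p ^ k)%N)) ->
  pro_p p W.
Proof.
move=> p_prime cW zW Fp fM fN kN; apply/(pro_pP _ p_prime); split=> // N w oN nN.
have [k [n Nn fn]] := pro_p_expg_nbhs (f w) p_prime Fp (fN N oN nN).
pose w' := w ^+ (p ^ k)%N.
have [j Nj] : exists j, N ((w' * n^-1) ^+ (p ^ j)%N).
  by apply: kN => //; rewrite fM (homX fM) (homV fM) fn mulgV.
exists (k + j)%N; rewrite expnD expgnA -/w'.
have := normal_coset_expg (w' * n^-1) (p ^ j)%N nN Nn.
case: nN => -[N1 NM NV] NJ; rewrite mulgVK => Nn'.
by rewrite -(mulVKg ((w' * n^-1) ^+ (p ^ j)) (w' ^+ (p ^ j))); exact: NM.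
Qed.

Lemma zero_dimensional_setX (T U : topologicalType) :
  zero_dimensional T -> zero_dimensional U -> zero_dimensional (T * U)%type.
Proof.
move=> zT zU [x y] [x' y'] /eqP xy.
have [exx|/eqP nxx] := pselect (x = x').
  have /eqP nyy : y <> y' by move=> eyy; apply: xy; rewrite exx eyy.
  have [U0 [clU Uy nUy]] := zU _ _ nyy; exists (snd @^-1` U0); split=> //.
  by apply: preimage_clopen => // z; exact: cvg_snd.
have [U0 [clU Uy nUy]] := zT _ _ nxx; exists (fst @^-1` U0); split=> //.
by apply: preimage_clopen => // z; exact: cvg_fst.
Qed.

Section SubgroupType.
Variables (G : topGroupType) (H : set G) (sH : subgroup_set H).
Local Notation T := (subgroup_type sH).

Definition subgroup_val (x : T) : G := val x.

Lemma subgroup_val_hom : is_hom subgroup_val. Proof. by move=> x y. Qed.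

Lemma subgroup_val_inj : injective subgroup_val. Proof. exact: val_inj. Qed.

Lemma subgroup_valP (x : T) : H (subgroup_val x). Proof. exact: set_valP. Qed.

Definition subgroup_mk (x : G) (Hx : H x) : T := SigSub (mem_set Hx).

Lemma subgroup_mkK (x : G) (Hx : H x) : subgroup_val (subgroup_mk Hx) = x.
Proof. by []. Qed.

Lemma subgroup_val_continuous : continuous subgroup_val.
Proof. exact: (@initial_continuous (set_type H) G set_val). Qed.

Lemma subgroup_nbhs (x : T) (A : set T) :
  nbhs x A <-> exists2 O, nbhs (subgroup_val x) O & subgroup_val @^-1` O `<=` A.
Proof.
split=> [[_ [[O oO <-] /= Ox OA]]|[O Ox OA]].
  by exists O => //; exact: open_nbhs_nbhs.
exact: (filterS OA (subgroup_val_continuous Ox)).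
Qed.

Lemma subgroup_to_continuous (U : topologicalType) (f : U -> T) :
  continuous (subgroup_val \o f) -> continuous f.
Proof.
move=> fc u A /subgroup_nbhs[O fO OA]; have fO' := fc u O fO.
have OfA : (subgroup_val \o f) @^-1` O `<=` f @^-1` A by move=> v Ov; exact: OA.
exact: (filterS OfA fO').
Qed.

Lemma subgroup_compact : compact H -> compact [set: T].
Proof.
move=> cH; apply/compact_near_coveringP => I F P FF cov.
pose P' i x := forall Hx : H x, P i (subgroup_mk Hx).
have : \forall i \near F, H `<=` P' i.
  apply: (iffLR (compact_near_coveringP _) cH I F P' FF) => x Hx.
  have [[A B] /= [/subgroup_nbhs[O Ox OA] FB] AB] := cov (subgroup_mk Hx) Logic.I.
  exists (O, B) => // -[x' i] /= [Ox' Bi] Hx'.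
  by apply: (AB (subgroup_mk Hx', i)); split=> //; exact: OA.
apply: filterS => i Pi x _; have := Pi _ (subgroup_valP x) (subgroup_valP x).
by congr (P i _); exact: val_inj.
Qed.

Lemma subgroup_zero_dim : zero_dimensional G -> zero_dimensional T.
Proof.
move=> zG x y xy; have /zG[U [cU Ux Uy]] : subgroup_val x != subgroup_val y.
  by apply: contra xy => /eqP/subgroup_val_inj ->.
exists (subgroup_val @^-1` U); split=> //.
by apply: preimage_clopen => //; exact: subgroup_val_continuous.
Qed.

Lemma subgroup_pro_p p : prime p -> closed H -> pro_p p G -> pro_p p T.
Proof.
move=> p_prime cH Gp; have zG := pro_p_zero_dim Gp.
apply/(pro_pP _ p_prime); split.
- have cG : compact [set: G] by case: Gp.
  exact/subgroup_compact/(subclosed_compact cH cG).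
- exact: subgroup_zero_dim.
- move=> N x oN [[N1 NM NV] NJ].
  have [O O1 ON] : exists2 O, nbhs (subgroup_val 1) O & subgroup_val @^-1` O `<=` N.
    by apply/subgroup_nbhs; exact: open_nbhs_nbhs.
  have [k Ok] := pro_p_expg_nbhs (subgroup_val x) p_prime Gp O1.
  by exists k; apply: ON; rewrite /= (homX subgroup_val_hom).
Qed.

End SubgroupType.

(** Group laws and continuity in one proof, so that a topological group can be declared on a given
    space inside an argument. The right unit and inverse laws are derived from the left ones. *)
Definition topgroup_axioms (T : topologicalType) (mul : T -> T -> T) (one : T)
    (inv : T -> T) : Prop :=
  [/\ associative mul, left_id one mul, left_inverse one inv mul,
      continuous (fun x : T * T => mul x.1 x.2) & continuous inv].

Definition topgroup_of (T : topologicalType) (mul : T -> T -> T) (one : T)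
  (inv : T -> T) (ax : topgroup_axioms mul one inv) : Type := T.

Section TopgroupOf.
Variables (T : topologicalType) (mul : T -> T -> T) (one : T) (inv : T -> T).
Hypothesis ax : topgroup_axioms mul one inv.
Local Notation W := (topgroup_of ax).

HB.instance Definition _ := Topological.copy W T.

Let WA : associative mul. Proof. by case: ax. Qed.
Let W1l : left_id one mul. Proof. by case: ax. Qed.
Let WVl : left_inverse one inv mul. Proof. by case: ax. Qed.
Let WVr : right_inverse one inv mul.
Proof.
move=> x; rewrite -[LHS]W1l -{1}(WVl (inv x)) -WA (WA (inv x) x) WVl W1l.
exact: WVl.
Qed.
Let W1r : right_id one mul.
Proof. by move=> x; rewrite -(WVl x) WA WVr W1l. Qed.

HB.instance Definition _ := isGroup.Build W WA W1l W1r WVl WVr.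

Let Wmul : continuous (fun x : W * W => x.1 * x.2). Proof. by case: ax. Qed.
Let Winv : continuous (fun x : W => x^-1). Proof. by case: ax. Qed.

HB.instance Definition _ := isTopologicalGroup.Build W Wmul Winv.

End TopgroupOf.

Lemma free_pro_p_hom_unique p (F : topGroupType) (X : finType) (iota : X -> F)
    (P : topGroupType) (f g : F -> P) :
  free_pro_p p iota -> pro_p p P -> is_hom f -> is_hom g ->
  continuous f -> continuous g -> (forall x, f (iota x) = g (iota x)) -> f = g.
Proof.
move=> [_ /(_ P (fun x => f (iota x)))U] Pp fM gM fc gc fg.
have [h [_ hU]] := U Pp.
by transitivity h; [apply/esym|]; apply: hU; split.
Qed.

(** Induction over generators: [K] is itself pro-$p$, so the generators define a map from [F] to
    [K], whose composite with the inclusion is the identity by uniqueness. *)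
Lemma free_pro_p_generated p (F : topGroupType) (X : finType) (iota : X -> F)
    (K : set F) :
  prime p -> free_pro_p p iota -> subgroup_set K -> closed K ->
  (forall x, K (iota x)) -> forall x, K x.
Proof.
move=> p_prime Ff sK cK Ki x.
have [Fp U] := Ff.
have [h [[hM hc hi] _]] :=
  U _ (fun x => subgroup_mk sK (Ki x)) (subgroup_pro_p sK p_prime cK Fp).
suff e : (fun y => subgroup_val (h y)) = id.
  by have <- : subgroup_val (h x) = x := congr1 (@^~ x) e; exact: subgroup_valP.
apply: (free_pro_p_hom_unique Ff) => //.
- by move=> a b; rewrite hM.
- move=> a; apply: (@continuous_comp _ _ _ h (@subgroup_val _ _ sK)).
    exact: hc.
  exact: subgroup_val_continuous.
- by move=> a; exact: cvg_id.
- by move=> i; rewrite hi.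
Qed.

(** * Cohomology of free pro-p groups *)

Section SmoothModule.
Local Open Scope ring_scope.
Variables (G : topGroupType) (A : zmodType) (act : G -> A -> A).

(** [discrete_module] with joint continuity replaced by local constancy of the orbit maps, which is
    easier to check for modules of functions. *)
Definition smooth_module : Prop :=
  [/\ forall a, act 1%g a = a,
      forall g h a, act (g * h)%g a = act g (act h a),
      forall g a b, act g (a + b) = act g a + act g b &
      forall a, locally_constant (act^~ a)].

Hypothesis sA : smooth_module.

Lemma smod1 a : act 1%g a = a. Proof. by case: sA. Qed.
Lemma smodM g h a : act (g * h)%g a = act g (act h a). Proof. by case: sA. Qed.
Lemma smodD g a b : act g (a + b) = act g a + act g b. Proof. by case: sA. Qed.
Lemma smod_lc a : locally_constant (act^~ a). Proof. by case: sA. Qed.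
Lemma smod0 g : act g 0 = 0.
Proof. by apply: (addrI (act g 0)); rewrite -smodD !addr0. Qed.
Lemma smodN g a : act g (- a) = - act g a.
Proof. by apply: (addrI (act g a)); rewrite -smodD !subrr smod0. Qed.
Lemma smodB g a b : act g (a - b) = act g a - act g b.
Proof. by rewrite smodD smodN. Qed.
Lemma smodMn g a n : act g (a *+ n) = act g a *+ n.
Proof. by elim: n => [|n IH]; rewrite ?mulr0n ?smod0// !mulrS smodD IH. Qed.
Lemma smodMz g a n : act g (a *~ n) = act g a *~ n.
Proof. by case: n => n; rewrite ?NegzE ?mulrNz -?pmulrn ?smodN smodMn. Qed.
Lemma smod_sum I (r : seq I) (P : pred I) (E : I -> A) g :
  act g (\sum_(i <- r | P i) E i) = \sum_(i <- r | P i) act g (E i).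
Proof.
by apply: (big_morph (act g)); [exact: smodD|exact: smod0].
Qed.
Lemma smodK g : cancel (act g) (act g^-1%g).
Proof. by move=> a; rewrite -smodM mulVg smod1. Qed.
Lemma lc_act (T : topologicalType) (g : T -> G) (a : T -> A) :
  continuous g -> locally_constant a -> locally_constant (fun t => act (g t) (a t)).
Proof.
move=> gc ac t; apply: filterS (filterI (ac t) (gc t _ (smod_lc (a t) (g t)))).
by move=> s [-> ->].
Qed.

End SmoothModule.

Lemma discrete_moduleP (G : topGroupType) (A : zmodType) (act : G -> A -> A) :
  discrete_module act <-> smooth_module act.
Proof.
split=> -[h1 hM hD hc]; split=> //.
  move=> a g.
  have [[V W] /= [Vg Wa] VW] :=
    hc (g, a) [set act g a] (@discrete_set1 (discrete_topology A) (act g a)).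
  apply: filterS Vg => h Vh; apply: (VW (h, a)); split=> //=.
  exact: (@nbhs_singleton (discrete_topology A)).
have sA : smooth_module act by [].
pose T : topologicalType := (G * discrete_topology A)%type.
have c1 : continuous (fst : T -> G) by move=> x; exact: cvg_fst.
have c2 : locally_constant (snd : T -> A).
  by apply/(@lcP T A) => x; exact: cvg_snd.
by have /(@lcP T A) := lc_act sA c1 c2.
Qed.

(** Orbits are finite by compactness, and since $p$ kills [A], the combinations of finitely many
    elements with coefficients below $p$ already form a subgroup. *)
Lemma finite_smooth_submodule (p : nat) (G : topGroupType) (A : zmodType)
    (act : G -> A -> A) (S : set A) :
  prime p -> compact [set: G] -> smooth_module act -> (forall a : A, a *+ p = 0)%R ->
  finite_set S -> exists B : set A,
  [/\ finite_set B, S `<=` B, B 0%R, forall a b, B a -> B b -> B (a - b)%R &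
      forall g a, B a -> B (act g a)].
Proof.
move=> p_prime cG sA pA fS; pose S' := \bigcup_(a in S) range (act^~ a).
have fS' : finite_set S'.
  by apply: bigcup_finite => // a _; apply: lc_finite => //; exact: smod_lc.
have [s sE] : exists s : seq A, S' = [set` s].
  by case/finite_seqP: fS' => s ->; exists s.
pose comb (n : {ffun 'I_(size s) -> 'I_p}) : A := (\sum_(i < size s) s`_i *+ n i)%R.
have p0 : (0 < p)%N := prime_gt0 p_prime.
have modE (a : A) m : (a *+ (m %% p) = a *+ m)%R.
  by rewrite [in RHS](divn_eq m p) mulrnDr mulnC mulrnA pA mul0rn add0r.
pose B := range comb.
have B0 : B 0%R.
  by exists [ffun _ => Ordinal p0] => //; rewrite /comb big1// => i _; rewrite ffunE.
have BD a b : B a -> B b -> B (a + b)%R.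
  move=> [m _ <-] [n _ <-].
  exists [ffun i => Ordinal (ltn_pmod (m i + n i) p0)] => //.
  by rewrite /comb -big_split; apply: eq_bigr => i _; rewrite ffunE modE mulrnDr.
have BMn a n : B a -> B (a *+ n)%R.
  by move=> Ba; elim: n => [|n IH]; rewrite ?mulr0n// mulrS; exact: BD.
have BN a : B a -> B (- a)%R.
  move=> Ba; suff -> : (- a = a *+ p.-1)%R by exact: BMn.
  by apply/eqP; rewrite -subr_eq0 -opprD oppr_eq0 -mulrS prednK// pA.
have Bs a : a \in s -> B a.
  move=> /[dup] /(nth_index 0%R) sa; rewrite -index_mem => si.
  exists [ffun i => if i == Ordinal si then Ordinal (prime_gt1 p_prime) else Ordinal p0] => //.
  rewrite /comb (bigD1 (Ordinal si))//= ffunE eqxx sa big1 ?addr0//.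
  by move=> i /negbTE ni; rewrite ffunE ni.
exists B; split=> //.
- exact: finite_image.
- move=> a Sa; apply: Bs; have : S' a.
    by exists a => //; exists 1%g => //; exact: smod1.
  by rewrite sE.
- by move=> a b Ba Bb; apply: BD => //; exact: BN.
- move=> g _ [n _ <-]; rewrite (smod_sum sA).
  apply: big_ind => // i _; rewrite (smodMn sA); apply: BMn; apply: Bs.
  have : S' (s`_i)%R by rewrite sE /=; apply: mem_nth.
  case=> a Sa [h _ <-].
  suff : S' (act g (act h a)) by rewrite sE.
  by exists a => //; exists (g * h)%g => //; exact: smodM.
Qed.

Section TwistedProduct.
Local Open Scope ring_scope.
Variables (F : topGroupType) (B : zmodType) (act : F -> B -> B) (z : F -> F -> B).
Hypotheses (sB : smooth_module act).
Hypothesis zc : locally_constant (fun x : F * F => z x.1 x.2).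
Hypothesis zP : forall x y w,
  act x (z y w) - z (x * y)%g w + z x (y * w)%g - z x y = 0.

Let T : topologicalType := (discrete_topology B * F)%type.
(** The extension of [F] by [B] with cocycle [-z]: the sign makes $x\mapsto(c(x),x)$ a homomorphism
    exactly when $c(xy)=c(x)+x\,c(y)-z(x,y)$. The cocycle is not normalized, whence the unit
    [(z 1 1, 1)]. *)
Let mul (a b : T) : T := (a.1 + act a.2 b.1 - z a.2 b.2 : B, (a.2 * b.2)%g).
Let one : T := (z 1%g 1%g : B, 1%g).
Let inv (a : T) : T :=
  (z 1%g 1%g - act a.2^-1%g a.1 + z a.2^-1%g a.2 : B, a.2^-1%g).

Lemma cocycle1l x : z 1%g x = z 1%g 1%g.
Proof.
by have /eqP := zP 1%g 1%g x; rewrite !mul1g (smod1 sB) subrr add0r subr_eq0 => /eqP.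
Qed.

Lemma cocycle1r x : z x 1%g = act x (z 1%g 1%g).
Proof.
have /eqP := zP x 1%g 1%g; rewrite !mulg1 addrNK subr_eq0 => /eqP->.
by [].
Qed.

Let lc_fst (U : topologicalType) (f : U -> T) :
  continuous f -> locally_constant (fun u => (f u).1 : B).
Proof.
have c1 : continuous (fst : T -> discrete_topology B) by move=> x; exact: cvg_fst.
move=> fc; apply/(@lcP U B) => u.
exact: (@continuous_comp _ _ _ f (fst : T -> discrete_topology B) u (fc u) (c1 (f u))).
Qed.

Let continuous_snd (U : topologicalType) (f : U -> T) :
  continuous f -> continuous (fun u => (f u).2 : F).
Proof.
have c2 : continuous (snd : T -> F) by move=> x; exact: cvg_snd.
move=> fc u.
exact: (@continuous_comp _ _ _ f (snd : T -> F) u (fc u) (c2 (f u))).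
Qed.

Let to_continuous (U : topologicalType) (f : U -> B) (g : U -> F) :
  locally_constant f -> continuous g -> continuous (fun u => (f u, g u) : T).
Proof.
move=> fc gc u.
have fc' : continuous (f : U -> discrete_topology B) by exact/lcP.
exact: (cvg_pair (fc' u) (gc u)).
Qed.

Lemma twisted_product_axioms : topgroup_axioms mul one inv.
Proof.
split.
- move=> [a x] [b y] [c w]; rewrite /mul /= mulgA; congr (_, _).
  rewrite (smodB sB) (smodD sB) (smodM sB).
  by apply/esym/subr0_eq; rewrite -[RHS](zP x y w); zmod.
- move=> [a x]; rewrite /mul /one /= mul1g (smod1 sB) cocycle1l.
  by congr (_, _); zmod.
- move=> [a x]; rewrite /mul /inv /one /= mulVg; congr (_, _).
  by zmod.
- have c1 : continuous (fst : T * T -> T) by move=> u; exact: cvg_fst.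
  have c2 : continuous (snd : T * T -> T) by move=> u; exact: cvg_snd.
  apply: to_continuous.
    apply: lc_post2.
      apply: lc_post2; first exact: lc_fst.
      by apply: (lc_act sB); [exact: continuous_snd|exact: lc_fst].
    apply: (@lc_post _ _ _ _ -%R).
    apply: (@lc_comp _ _ _ _ (fun u : T * T => (u.1.2, u.2.2)) zc) => u.
    by apply: cvg_pair; exact: continuous_snd.
  by apply: mul_continuous; exact: continuous_snd.
- have ci : continuous (fun x : T => x) by move=> x; exact: cvg_id.
  have cV : continuous (fun x : T => x.2^-1%g : F).
    by apply: inv_continuous; exact: continuous_snd.
  apply: to_continuous => //.
  apply: lc_post2.
    apply: lc_post2; first exact: lc_cst.
    apply: (@lc_post _ _ _ _ -%R).
    by apply: (lc_act sB) => //; exact: lc_fst.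
  apply: (@lc_comp _ _ _ _ (fun u : T => (u.2^-1%g, u.2)) zc) => u.
  by apply: cvg_pair; [exact: cV|exact: continuous_snd].
Qed.

Definition twisted_product : topGroupType := topgroup_of twisted_product_axioms.

End TwistedProduct.

Lemma compact_setXT (T U : topologicalType) :
  compact [set: T] -> compact [set: U] -> compact [set: T * U].
Proof. by move=> cT cU; rewrite -setXTT; exact: compact_setX. Qed.

(* [c] is read off the lift of [v] to the extension of [F] by a finite submodule of
   [B] with cocycle [z]. *)
Lemma free_cochain_lift p (F : topGroupType) (X : finType) (iota : X -> F)
    (B : zmodType) (act : F -> B -> B) (z : F -> F -> B) (v : X -> B) :
  prime p -> free_pro_p p iota -> smooth_module act -> (forall b : B, b *+ p = 0)%R ->
  locally_constant (fun x : F * F => z x.1 x.2) ->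
  (forall x y w, act x (z y w) - z (x * y)%g w + z x (y * w)%g - z x y = 0)%R ->
  exists c : F -> B, [/\ locally_constant c,
    forall x y, (c (x * y)%g = c x + act x (c y) - z x y)%R &
    forall i, c (iota i) = v i].
Proof.
move=> p_prime Ff sB pB zc zP; have [Fp U] := Ff.
have cF : compact [set: F] by case: Fp.
(* The extension is compact only for finite coefficients. As [z] and [v] take finitely many values,
   a finite submodule carries all the data. *)
pose S := range (fun x : F * F => z x.1 x.2) `|` range v.
have fS : finite_set S.
  rewrite finite_setU; split; last exact: finite_image.
  by apply: lc_finite zc; exact: compact_setXT.
have [B0 [fB0 SB0 B00 BB Bact]] := finite_smooth_submodule p_prime cF sB pB fS.
have BN b : B0 b -> B0 (- b)%R by move=> Bb; rewrite -sub0r; exact: BB.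
have BD b b' : B0 b -> B0 b' -> B0 (b + b')%R.
  by move=> Bb Bb'; rewrite -[b']opprK; apply: BB => //; exact: BN.
have Bz x y : B0 (z x y) by apply: SB0; left; exists (x, y).
pose E := twisted_product sB zc zP.
pose H : set E := [set e | B0 e.1].
have sH : subgroup_set H.
  split=> [|[a x] [b y] Ha Hb|[a x] Ha]; rewrite /H /=.
  - exact: Bz.
  - by apply: BB => //; apply: BD => //; exact: Bact.
  - by apply: BD => //; apply: BB => //; exact: Bact.
pose f (t : subgroup_type sH) : F := (subgroup_val t).2.
have fM : is_hom f by [].
have Tp : pro_p p (subgroup_type sH).
  apply: (pro_p_extension p_prime _ _ Fp fM).
  - apply: subgroup_compact.
    have : compact ((B0 : set (discrete_topology B)) `*` [set: F]).
      by apply: compact_setX => //; exact: finite_compact.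
    rewrite (_ : _ `*` _ = H)//.
    by apply/seteqP; split=> -[a x] //= [].
  - apply: subgroup_zero_dim.
    have : zero_dimensional (discrete_topology B * F)%type.
      apply: zero_dimensional_setX; first exact: discrete_zero_dimension.
      exact: pro_p_zero_dim Fp.
    exact.
  - move=> N oN [[N1 _ _] _].
    have /subgroup_nbhs[O [[V W] /= [Vz W1] VW] ON] : nbhs 1 N by exact: open_nbhs_nbhs.
    apply: filterS W1 => w Ww.
    have Hw : H ((z 1 1, w) : E) by exact: Bz.
    exists (subgroup_mk sH Hw) => //; apply: ON; apply: VW; split=> //=.
    exact: (@nbhs_singleton (discrete_topology B)).
  - move=> N t oN [[N1 _ _] _] ft; exists 1%N.
    suff -> : t ^+ (p ^ 1)%N = 1 by [].
    apply: subgroup_val_inj; rewrite (homX (@subgroup_val_hom _ _ sH)).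
    move: ft; rewrite /f; case: (subgroup_val t) => b x /= ->.
    (* At exponent $p$ the first coordinate is $-(p-1)z(1,1)=z(1,1)$, which gives the unit. *)
    have bX n : ((b, 1) : E) ^+ n.+1 = ((b *+ n.+1 - z 1%g 1%g *+ n)%R, 1) :> E.
      elim: n => [|n IH]; first by rewrite expg1 mulr1n mulr0n subr0.
      rewrite expgS IH; congr (_, _); last exact: mulg1.
      rewrite /= (smod1 sB) (mulrS (b : B) n.+1) (mulrS (z 1 1) n); zmod.
    rewrite expn1 -(prednK (prime_gt0 p_prime)) bX prednK ?prime_gt0//.
    rewrite pB; congr (_, _).
    rewrite sub0r; apply/esym/eqP.
    by rewrite -addr_eq0 -mulrS prednK ?prime_gt0// pB.
have Hv i : H ((v i, iota i) : E) by apply: SB0; right; exists i.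
have [h [[hM hc hi] _]] := U _ (fun i => subgroup_mk sH (Hv i)) Tp.
(* The second coordinate of the lift fixes the generators, hence is the identity; the first
   coordinate is then the required cochain. *)
have fh x : f (h x) = x.
  suff e : (fun y => f (h y)) = id by exact: (congr1 (@^~ x) e).
  have c2 : continuous (snd : discrete_topology B * F -> F) by move=> y; exact: cvg_snd.
  apply: (free_pro_p_hom_unique Ff Fp) => //.
  - by move=> a b; rewrite hM.
  - move=> a; apply: (@continuous_comp _ _ _ h f); first exact: hc.
    apply: (@continuous_comp _ _ _ (@subgroup_val _ _ sH) (snd : E -> F)).
      exact: subgroup_val_continuous.
    exact: c2.
  - by move=> a; exact: cvg_id.
  - by move=> i; rewrite hi.
exists (fun x => (subgroup_val (h x)).1); split.
- have c1 : continuous (fst : discrete_topology B * F -> discrete_topology B).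
    by move=> y; exact: cvg_fst.
  apply/(@lcP F B) => x.
  apply: (@continuous_comp _ _ _ h (fun t => (subgroup_val t).1 : discrete_topology B)).
    exact: hc.
  apply: (@continuous_comp _ _ _ (@subgroup_val _ _ sH) (fst : E -> discrete_topology B)).
    exact: subgroup_val_continuous.
  exact: c1.
- move=> x y; rewrite hM.
  by rewrite -[X in act X _](fh x) -[X in z X _](fh x) -[X in z _ X](fh y).
- by move=> i; rewrite hi.
Qed.

Lemma free_cocycle_eq p (F : topGroupType) (X : finType) (iota : X -> F)
    (B : zmodType) (act : F -> B -> B) (c : F -> B) :
  prime p -> free_pro_p p iota -> smooth_module act ->
  locally_constant c -> (forall x y, c (x * y)%g = c x + act x (c y))%R ->
  (forall i, c (iota i) = 0)%R -> forall x, c x = 0%R.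
Proof.
move=> p_prime Ff sB lc cM ci.
have c1 : c 1 = 0%R.
  by have /eqP := cM 1 1; rewrite mulg1 (smod1 sB) -subr_eq0 opprD addNKr oppr_eq0 => /eqP.
apply: (free_pro_p_generated p_prime Ff (K := [set x | c x = 0%R])) => //.
  split=> //= [x y cx cy|x cx]; first by rewrite cM cx cy (smod0 sB) addr0.
  by have := cM x^-1 x; rewrite mulVg c1 cx (smod0 sB) addr0.
exact: (@lc_closed _ _ c [set 0%R]).
Qed.

(** * Open subgroups of free pro-p groups *)

Lemma ptws_cvg (Q : choiceType) (P : topologicalType) (F : set_system (Q -> P))
    (f : Q -> P) : Filter F -> (forall q, (fun g : Q -> P => g q) @ F --> f q) ->
  {ptws, F --> f}.
Proof.
move=> FF Ff; apply/cvg_sup => q; apply/cvg_image.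
  by rewrite eqEsubset; split=> // x _; exists (fun=> x).
move=> O Oq; exists ((fun g : Q -> P => g q) @^-1` O); first exact: Ff.
apply/seteqP; split=> [_ [g Og <-]//|x Ox].
by exists (fun=> x).
Qed.

Lemma ptws_continuous (U : topologicalType) (Q : choiceType) (P : topologicalType)
    (f : U -> Q -> P) :
  (forall q, continuous (fun u => f u q)) -> continuous (f : U -> {ptws Q -> P}).
Proof. by move=> fc u; apply: ptws_cvg => q; exact: fc. Qed.

Lemma closed_eq (T U : topologicalType) (f g : T -> U) : zero_dimensional U ->
  continuous f -> continuous g -> closed [set x | f x = g x].
Proof.
move=> zU fc gc; rewrite -openC openE => x /= /eqP/zU[V [[oV cV] fV gV]].
have nf : \forall y \near x, V (f y) by apply: (fc x V); exact: open_nbhs_nbhs.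
have ng : \forall y \near x, ~ V (g y).
  by apply: (gc x (~` V)); apply: open_nbhs_nbhs; split=> //; exact: closed_openC.
by apply: filterS (filterI nf ng) => y /= [Vf nVg] e; apply: nVg; rewrite -e.
Qed.

Lemma ptws_eval_continuous (Q : choiceType) (P : topologicalType) (q : Q) :
  continuous (fun f : {ptws Q -> P} => f q).
Proof. exact: (@proj_continuous Q (fun=> P) q). Qed.

Lemma continuous_locally_equal (U V : topologicalType) (I : Type) (g : U -> I)
    (f : I -> U -> V) :
  locally_constant g -> (forall i, continuous (f i)) ->
  continuous (fun u => f (g u) u).
Proof.
move=> gc fc u O Ou; apply: filterS (filterI (gc u) (fc (g u) u O Ou)).
by move=> u' [/= ->].
Qed.

Section Wreath.
Variables (Q : finType) (F P : topGroupType) (act : Q -> F -> Q).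
Hypotheses (act1 : forall q, act q 1 = q)
  (actM : forall q g h, act q (g * h) = act (act q g) h)
  (act_lc : forall q, locally_constant (act q)).

Let T : topologicalType := ({ptws Q -> P} * F)%type.
(** The permutational wreath product of [P] by [F]: a homomorphism from [F] lying over the identity
    of [F] is a family of crossed maps indexed by [Q]. *)
Let mul (a b : T) : T := (fun q => a.1 q * b.1 (act q a.2), a.2 * b.2).
Let one : T := (fun=> 1, 1).
Let inv (a : T) : T := (fun q => (a.1 (act q a.2^-1))^-1, a.2^-1).

Let continuous_fst (U : topologicalType) (f : U -> T) q :
  continuous f -> continuous (fun u => (f u).1 q).
Proof.
have c1 : continuous (fun x : T => x.1 q).
  move=> x; apply: (@continuous_comp _ _ _ (fst : T -> {ptws Q -> P}) (fun f => f q)).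
    exact: cvg_fst.
  exact: ptws_eval_continuous.
by move=> fc u; apply: (@continuous_comp _ _ _ f (fun x : T => x.1 q)); [exact: fc|exact: c1].
Qed.

Let continuous_snd (U : topologicalType) (f : U -> T) :
  continuous f -> continuous (fun u => (f u).2 : F).
Proof.
have c2 : continuous (snd : T -> F) by move=> x; exact: cvg_snd.
move=> fc u.
exact: (@continuous_comp _ _ _ f (snd : T -> F) u (fc u) (c2 (f u))).
Qed.

Let to_continuous (U : topologicalType) (f : U -> Q -> P) (g : U -> F) :
  (forall q, continuous (fun u => f u q)) -> continuous g ->
  continuous (fun u => (f u, g u) : T).
Proof.
by move=> /ptws_continuous fc gc u; exact: (cvg_pair (fc u) (gc u)).
Qed.

Lemma wreath_product_axioms : topgroup_axioms mul one inv.
Proof.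
split.
- move=> [a x] [b y] [c w]; rewrite /mul /= mulgA; congr (_, _).
  by apply/funext => q; rewrite actM mulgA.
- move=> [a x]; rewrite /mul /one /= mul1g; congr (_, _).
  by apply/funext => q; rewrite act1 mul1g.
- move=> [a x]; rewrite /mul /inv /one /= mulVg; congr (_, _).
  by apply/funext => q; rewrite mulVg.
- have c1 : continuous (fst : T * T -> T) by move=> u; exact: cvg_fst.
  have c2 : continuous (snd : T * T -> T) by move=> u; exact: cvg_snd.
  apply: to_continuous; last by apply: mul_continuous; exact: continuous_snd.
  move=> q; apply: mul_continuous; first exact: continuous_fst.
  apply: (@continuous_locally_equal _ _ _ (fun u : T * T => act q u.1.2)
    (fun q' (u : T * T) => u.2.1 q')).
    by apply: lc_comp; [exact: act_lc|exact: continuous_snd].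
  by move=> q'; exact: continuous_fst.
- have ci : continuous (fun x : T => x) by move=> x; exact: cvg_id.
  have cV : continuous (fun x : T => x.2^-1 : F).
    by apply: inv_continuous; exact: continuous_snd.
  apply: to_continuous => // q; apply: inv_continuous.
  apply: (@continuous_locally_equal _ _ _ (fun u : T => act q u.2^-1)
    (fun q' (u : T) => u.1 q')).
    exact: (lc_comp (act_lc q) cV).
  by move=> q'; exact: continuous_fst.
Qed.

Definition wreath_product : topGroupType := topgroup_of wreath_product_axioms.
Local Notation W := wreath_product.

(** An element of the kernel is a tuple in [P], whose $p$-powers converge to $1$ in each coordinate,
    hence in the product topology. *)
Lemma wreath_product_pro_p p : prime p -> pro_p p F -> pro_p p P -> pro_p p W.
Proof.
move=> p_prime Fp Pp.
pose f (w : W) : F := w.2.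
have fM : is_hom f by [].
apply: (pro_p_extension p_prime _ _ Fp fM).
- suff : compact [set: T] by [].
  apply: compact_setXT; last by case: Fp.
  have cP : compact [set: P] by case: Pp.
  have := @tychonoff Q (fun=> P) (fun=> setT) (fun=> cP).
  by rewrite (_ : [set f | _] = setT)//; apply/seteqP; split.
- suff : zero_dimensional T by [].
  apply: zero_dimensional_setX; last exact: pro_p_zero_dim Fp.
  by apply: zero_dimension_prod => q; exact: pro_p_zero_dim Pp.
- move=> N oN [[N1 _ _] _]; apply: open_nbhs_nbhs; split; last by exists 1.
  exact: (@snd_open {ptws Q -> P} F N).
- move=> N w oN [[N1 _ _] _] fw.
  have wE n : w ^+ n = ((fun q => w.1 q ^+ n), 1) :> W.
    elim: n => [//|n IH]; rewrite expgS IH; congr (_, _).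
      by apply/funext => q; rewrite expgS -/(f w) fw act1.
    by rewrite -/(f w) fw; exact: mulg1.
  have : {ptws, ((fun k (q : Q) => w.1 q ^+ (p ^ k)%N) @ \oo) --> (fun _ : Q => 1 : P)}.
    apply: ptws_cvg => q O O1.
    have [M [oM [[M1 MM MV] MJ] MO]] := pro_p_basis Pp O1.
    have [k Mk] := pro_p_expg_nbhs (w.1 q) p_prime Pp
      (open_nbhs_nbhs (conj oM M1)).
    exists k => // j /= kj; apply: MO.
    rewrite -(subnK kj) addnC expnD expgnA.
    by elim: (p ^ (j - k))%N => [|n IH]; rewrite ?expg0// expgS; exact: MM.
  have [[O V] /= [O1 V1] OV] : nbhs (1 : W) N by exact: open_nbhs_nbhs.
  move=> /(_ O O1)[k _ kO]; exists k; rewrite wE.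
  apply: OV; split=> /=; last exact: nbhs_singleton.
  exact: (kO k (leqnn k)).
Qed.

End Wreath.

(* Crossed homomorphisms out of a free pro-p group are freely determined by
   their values on the generators: apply the universal property to the wreath
   product of the coefficient group. *)
Lemma free_cocycle_lift p (F P : topGroupType) (X : finType) (iota : X -> F)
    (Q : finType) (act : Q -> F -> Q) (v : Q -> X -> P) :
  prime p -> free_pro_p p iota -> pro_p p P -> (forall q, act q 1 = q) ->
  (forall q g h, act q (g * h) = act (act q g) h) ->
  (forall q, locally_constant (act q)) ->
  exists C : Q -> F -> P, [/\ forall q, continuous (C q),
    forall q g h, C q (g * h) = C q g * C (act q g) h &
    forall q i, C q (iota i) = v q i].
Proof.
move=> p_prime Ff Pp a1 aM alc; have [Fp U] := Ff.
pose W := wreath_product P a1 aM alc.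
have Wp : pro_p p W by exact: wreath_product_pro_p.
have [h [[hM hc hi] _]] := U W (fun i => (v^~ i, iota i)) Wp.
have h2 x : (h x).2 = x.
  suff e : (fun y => (h y).2) = id by exact: (congr1 (@^~ x) e).
  have c2 : continuous (snd : {ptws Q -> P} * F -> F) by move=> y; exact: cvg_snd.
  apply: (free_pro_p_hom_unique Ff Fp) => //.
  - by move=> a b; rewrite hM.
  - move=> a; apply: (@continuous_comp _ _ _ h (snd : W -> F)); first exact: hc.
    exact: c2.
  - by move=> a; exact: cvg_id.
  - by move=> i; rewrite hi.
exists (fun q x => (h x).1 q); split=> [q|q x y|q i].
- have c1 : continuous (fst : {ptws Q -> P} * F -> {ptws Q -> P}).
    by move=> y; exact: cvg_fst.
  move=> x; apply: (@continuous_comp _ _ _ (fun x => (h x).1 : {ptws Q -> P})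
    (fun f => f q)); last exact: ptws_eval_continuous.
  by apply: (@continuous_comp _ _ _ h (fst : W -> {ptws Q -> P}));
    [exact: hc|exact: c1].
- by rewrite hM -[X in act q X](h2 x).
- by rewrite hi.
Qed.

(** The crossed rule moves the index, so only equality for all [q] at once defines a subgroup; this
    subgroup is closed and contains the generators. *)
Lemma free_cocycle_unique p (F P : topGroupType) (X : finType) (iota : X -> F)
    (Q : finType) (act : Q -> F -> Q) (C C' : Q -> F -> P) :
  prime p -> free_pro_p p iota -> zero_dimensional P -> (forall q, act q 1 = q) ->
  (forall q g h, act q (g * h) = act (act q g) h) ->
  (forall q, continuous (C q)) -> (forall q, continuous (C' q)) ->
  (forall q g h, C q (g * h) = C q g * C (act q g) h) ->
  (forall q g h, C' q (g * h) = C' q g * C' (act q g) h) ->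
  (forall q i, C q (iota i) = C' q (iota i)) -> forall q g, C q g = C' q g.
Proof.
move=> p_prime Ff hP a1 aM Cc C'c CM C'M CC' q g; move: q.
apply: (free_pro_p_generated p_prime Ff
  (K := [set g | forall q, C q g = C' q g])) => //.
  have C1 D : (forall q g h, D q (g * h) = D q g * D (act q g) h) ->
      forall q, D q 1 = 1 :> P.
    by move=> DM q; apply: (mulgI (D q 1)); rewrite -{2}(a1 q) -DM !mulg1.
  have CV D : (forall q g h, D q (g * h) = D q g * D (act q g) h) ->
      forall q g, D q g^-1 = (D (act q g^-1) g)^-1 :> P.
    by move=> DM q h; apply: (mulIg (D (act q h^-1) h)); rewrite -DM !mulVg C1.
  split=> /= [q|a b Ka Kb q|a Ka q]; first by rewrite !C1.
    by rewrite CM C'M Ka Kb.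
  by rewrite (CV C)// (CV C')// Ka.
  rewrite (_ : [set _ | _] = \bigcap_q [set h | C q h = C' q h]).
    by apply: closed_bigI => q _; exact: closed_eq.
  by apply/seteqP; split=> h /= Kh q; [move=> _|]; exact: Kh.
by move=> i q; exact: CC'.
Qed.

(* Since each generator permutes the finite set [Q], a spanning tree rooted at
   [q0] can be chosen with all edges directed away from the root. *)
Lemma forward_spanning_tree (Q X : finType) (step : Q * X -> Q) (q0 : Q) :
  (forall q, exists w : seq X, foldl (fun q x => step (q, x)) q0 w = q) ->
  exists (E : {set Q * X}) (d : Q -> nat), [/\ #|E|.+1 = #|Q|,
    forall q, q != q0 -> exists2 e, e \in E & step e = q,
    {in E &, injective step} &
    {in E, forall e, step e != q0 /\ (d e.1 < d (step e))%N}].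
Proof.
set walk := foldl _ => reach.
have ex_n q : exists n, `[< exists w, size w = n /\ walk q0 w = q >].
  by have [w wq] := reach q; exists (size w); apply/asboolP; exists w.
(* Length of a shortest positive word from [q0] to [q]; removing its last letter gives the parent,
   which is strictly closer to the root. *)
pose d q := ex_minn (ex_n q).
have dP q : exists w, size w = d q /\ walk q0 w = q.
  by rewrite /d; case: ex_minnP => n /asboolP.
have dm w : (d (walk q0 w) <= size w)%N.
  by rewrite /d; case: ex_minnP => n _; apply; apply/asboolP; exists w.
have par_ex q : exists o : option (Q * X), if o is Some e
    then [/\ q != q0, step e = q & (d e.1 < d q)%N] else q = q0.
  have [->|nq] := eqVneq q q0; first by exists None.
  have [w [ws wq]] := dP q.
  case/lastP: w ws wq nq => [_ /= <-|w x ws wq nq]; first by rewrite /walk /= eqxx.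
  exists (Some (walk q0 w, x)); split=> //.
    by rewrite -wq /walk -cats1 foldl_cat.
  by rewrite -ws size_rcons ltnS; exact: dm.
have {par_ex}[par parP] := choice par_ex.
pose E : {set Q * X} := [set e | par (step e) == Some e]%SET.
have EP e : e \in E -> step e != q0 /\ (d e.1 < d (step e))%N.
  by rewrite inE => /eqP pe; have := parP (step e); rewrite pe => -[].
have Es : {in E &, injective step}.
  by move=> e e'; rewrite !inE => /eqP pe /eqP pe' ee; move: pe'; rewrite -ee pe => -[].
have Eq q : q != q0 -> exists2 e, e \in E & step e = q.
  move=> nq; have := parP q; case pq: (par q) => [e|]; last by move=> qq; rewrite qq eqxx in nq.
  by move=> [_ eq _]; exists e => //; rewrite inE eq pq.
exists E, d; split=> //.
rewrite -(card_in_imset Es) (_ : (step @: E)%SET = [set~ q0]%SET).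
  by rewrite cardsC1 prednK//; apply/card_gt0P; exists q0.
apply/setP => q; rewrite !inE; apply/imsetP/idP => [[e /EP[se _] ->]//|/Eq[e eE <-]].
by exists e.
Qed.

(** Products of labels along tree paths, by recursion with fuel; as [d] drops towards the root, the
    fuel [(d q).+1] suffices. *)
Lemma tree_transport (M : groupType) (Q X : finType) (step : Q * X -> Q) (q0 : Q)
    (iota : X -> M) (E : {set Q * X}) (d : Q -> nat) :
  {in E &, injective step} ->
  {in E, forall e, step e != q0 /\ (d e.1 < d (step e))%N} ->
  exists t : Q -> M, t q0 = 1 /\ {in E, forall e, t (step e) = t e.1 * iota e.2}.
Proof.
move=> Es EP.
pose par q := [pick e in E | step e == q].
pose tt := fix tt n q := if n is m.+1 then
  (if par q is Some e then tt m e.1 * iota e.2 else 1) else 1.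
have ttS n q : tt n.+1 q = if par q is Some e then tt n e.1 * iota e.2 else 1 by [].
have tt_stable n m q : (d q < n)%N -> (d q < m)%N -> tt n q = tt m q.
  elim: n m q => // n IH [|m] q // qn qm; rewrite !ttS.
  rewrite /par; case: pickP => // e /andP[/EP[_ de] /eqP eq]; congr (_ * _).
  by rewrite eq in de; apply: IH; exact: leq_trans de _.
exists (fun q => tt (d q).+1 q); split=> [|e eE]; rewrite ttS /par.
  by case: pickP => // e /andP[/EP[+ _] /eqP eq]; rewrite eq eqxx.
case: pickP => [e' /andP[e'E /eqP/(Es _ _ e'E eE) ->]|/(_ e)]; last by rewrite eE eqxx.
by congr (_ * _); apply: tt_stable; [case: (EP _ eE)|].
Qed.

Section Schreier.
Variables (p : nat) (F : topGroupType) (X : finType) (iota : X -> F) (K : set F).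
Hypotheses (p_prime : prime p) (Ff : free_pro_p p iota).
Hypotheses (sK : subgroup_set K) (oK : open K).

(** The generators are the edges of the Schreier graph outside a spanning tree. Values on them are
    extended by $1$ to the tree edges and lifted to a crossed family over the cosets, whose
    component at [q0] is a homomorphism on the stabilizer [K]. A tree has one edge fewer than
    vertices; this gives the count, written without subtraction. *)
Lemma schreier_free : exists (Y : finType) (j : Y -> subgroup_type sK),
  free_pro_p p j /\ (#|Y| + group_index K)%N = (group_index K * #|X|).+1.
Proof.
have [Fp U] := Ff.
have cF : compact [set: F] by case: Fp.
have K1 : K 1 by case: sK.
have [c [c_surj cE]] := coset_space cF sK oK.
move: (group_index K) c c_surj cE => m c c_surj cE.
(* [coset_space] numbers left cosets; inversion turns them into the right cosets, on which [F] acts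
   from the right. *)
pose r x := c x^-1.
have rE x y : r x = r y <-> K (x * y^-1) by rewrite /r cE invgK.
have r_surj q : exists x, r x = q.
  by have [x <-] := c_surj q; exists x^-1; rewrite /r invgK.
have [s rs] := choice r_surj.
pose act q g := r (s q * g).
have actE x g : act (r x) g = r (x * g).
  apply/rE; rewrite invMg mulgA mulgK.
  by apply/rE; rewrite rs.
pose q0 := r 1.
have act_q0 g : act q0 g = r g by rewrite actE mul1g.
have a1 q : act q 1 = q by rewrite -(rs q) actE mulg1.
have aM q g h : act q (g * h) = act (act q g) h.
  by rewrite -(rs q) !actE mulgA.
have r_lc : locally_constant r.
  move=> x; apply: filterS (near_mulr x (open_subgroup_nbhs sK oK)) => y Ky.
  exact/rE.
have act_lc q : locally_constant (act q).
  exact: (lc_comp r_lc (@mull_continuous F (s q))).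
have stab k : K k -> act q0 k = q0.
  by move=> Kk; rewrite act_q0; apply/rE; rewrite invg1 mulg1.
pose step (e : 'I_m * X) := act e.1 (iota e.2).
(* Positive words suffice: each generator maps the set [S] of reached cosets into itself, hence onto
   itself by finiteness, and preserving [S] is a closed subgroup condition. *)
have reach q : exists w : seq X, foldl (fun q x => step (q, x)) q0 w = q.
  pose S := [set q | `[< exists w : seq X, foldl (fun q x => step (q, x)) q0 w = q >]]%SET.
  suff HS g : (act q0 g \in S).
    by have := HS (s q); rewrite act_q0 rs inE => /asboolP.
  suff : forall q, (act q g \in S) = (q \in S).
    by move=> ->; rewrite inE; apply/asboolP; exists [::].
  apply: (free_pro_p_generated p_prime Ff
    (K := [set g | forall q, (act q g \in S) = (q \in S)])).
  - split=> /= [q'|x y Kx Ky q'|x Kx q']; first by rewrite a1.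
      by rewrite aM Ky Kx.
    by rewrite -(Kx (act q' x^-1)) -aM mulVg a1.
  - rewrite (_ : [set _ | _] = \bigcap_q [set g | (act q g \in S) = (q \in S)]).
      apply: closed_bigI => q' _.
      exact: (@lc_closed _ _ _ [set q' \in S] (lc_post (fun q => q \in S) (act_lc q'))).
    by apply/seteqP; split=> h /= Kh q'; [move=> _|]; exact: Kh.
  - move=> x /= q'.
    have ainj : injective (fun q => act q (iota x)).
      by move=> a b /(congr1 (act^~ (iota x)^-1)); rewrite -!aM mulgV !a1.
    have S_sub : ((fun q => act q (iota x)) @: S \subset S)%SET.
      apply/fintype.subsetP => _ /imsetP[q'' + ->]; rewrite !inE => -[w wq].
      by exists (rcons w x); rewrite -cats1 foldl_cat wq.
    have SE : ((fun q => act q (iota x)) @: S = S)%SET.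
      by apply/eqP; rewrite eqEcard S_sub card_imset ?leqnn.
    by rewrite -[in LHS]SE mem_imset.
have [E [d [cardE Eq Es EP]]] := forward_spanning_tree reach.
have [t [t0 tE]] := tree_transport iota Es EP.
have rt q : r (t q) = q.
  elim: (d q).+1 {-2}q (ltnSn (d q)) => // n IH {}q dq.
  have [->|/Eq[e eE eq]] := eqVneq q q0; first by rewrite t0.
  rewrite -eq tE// -actE IH//.
  by have [_ de] := EP _ eE; rewrite eq in de; exact: leq_trans de dq.
have KG q g : K (t q * g * (t (act q g))^-1) by apply/rE; rewrite rt -actE rt.
pose gen q g : subgroup_type sK := subgroup_mk sK (KG q g).
pose Y := {e : 'I_m * X | e \notin E}.
pose j (y : Y) := gen (val y).1 (iota (val y).2).
exists Y, j; split; last first.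
  rewrite card_sig -[X in (_ + X)%N](card_ord m) -cardE addnS; congr _.+1.
  have := cardsC E; rewrite card_prod card_ord => <-.
  by rewrite addnC; congr (_ + _)%N; apply: eq_card => e; rewrite !inE.
have cK : closed K by exact: open_subgroup_closed.
split; first exact: subgroup_pro_p.
move=> P f Pp.
(* The value $1$ on tree edges makes the lifted family trivial on the transversal [t]. *)
pose v q x := if insub (q, x) is Some y then f y else 1.
have [C [Cc CM Cv]] := free_cocycle_lift v p_prime Ff Pp a1 aM act_lc.
have vE e : e \in E -> v e.1 e.2 = 1.
  by case: e => q x eE; rewrite /v insubN//= negbK.
have vY (y : Y) : v (val y).1 (val y).2 = f y.
  by rewrite /v -surjective_pairing valK.
have Ct q : C q0 (t q) = 1.
  elim: (d q).+1 {-2}q (ltnSn (d q)) => // n IH {}q dq.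
  have [->|/Eq[e eE eq]] := eqVneq q q0.
    by rewrite t0; apply: (mulgI (C q0 1)); rewrite -{2}(a1 q0) -CM !mulg1.
  have [_ de] := EP _ eE; rewrite eq in de.
  rewrite -eq tE// CM IH ?mul1g; last exact: leq_trans de dq.
  by rewrite act_q0 rt Cv vE.
exists (fun k => C q0 (subgroup_val k)); split; first split.
- by move=> x y; rewrite CM stab//; exact: subgroup_valP.
- move=> x; apply: (@continuous_comp _ _ _ (@subgroup_val _ _ sK) (C q0)).
    exact: subgroup_val_continuous.
  exact: Cc.
- move=> y; set e := val y; pose b := t (step e).
  have Ke := KG e.1 (iota e.2).
  have := CM q0 (t e.1 * iota e.2 * b^-1) b.
  rewrite mulgVK CM Ct mul1g act_q0 rt Cv stab// Ct mulg1 => <-.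
  exact: vY.
- move=> h [hM hc hj].
  (* A competitor [h] spreads through [gen] to a crossed family on all of [F] with the same values
     on the generators, so uniqueness of crossed families applies. *)
  pose C' q g := h (gen q g).
  have C'M q x y : C' q (x * y) = C' q x * C' (act q x) y.
    rewrite /C' -hM; congr h; apply: subgroup_val_inj.
    by rewrite [RHS]subgroup_val_hom !subgroup_mkK !mulgA mulgVK aM.
  have C'c q : continuous (C' q).
    move=> x; apply: (@continuous_comp _ _ _ (gen q) h); last exact: hc.
    apply: subgroup_to_continuous => {}x.
    apply: mul_continuous => {}x; first exact: mull_continuous.
    apply: inv_continuous => {}x.
    apply: (@continuous_locally_equal _ _ _ (act q) (fun q' _ => t q')) => //.
    by move=> q'; exact: cst_continuous.
  have C'v q i : C q (iota i) = C' q (iota i).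
    rewrite Cv /v; case: insubP => [y _ yE|]; first by rewrite -hj /j yE.
    rewrite negbK => eE; rewrite -(hom1 hM) /C'; congr h; apply: subgroup_val_inj.
    by rewrite subgroup_mkK -(tE (q, i))// mulgV.
  apply/funext => k.
  rewrite (free_cocycle_unique p_prime Ff (pro_p_zero_dim Pp) a1 aM Cc C'c CM C'M C'v).
  rewrite /C'; congr h; apply: subgroup_val_inj.
  by rewrite subgroup_mkK stab ?t0 ?invg1 ?mulg1 ?mul1g//; exact: subgroup_valP.
Qed.

End Schreier.

(** * Minimal relators and the deficiency *)

Section FixedCoset.
Local Close Scope classical_set_scope.

(** The number of fixed cosets is congruent modulo $p$ to the index of [S], a nontrivial power of
    $p$; [S] itself is fixed, so another coset is too. *)
Lemma pgroup_fixed_coset (p : nat) (gT : finGroupType) (A : {group {perm gT}})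
    (S : {group gT}) :
  prime p -> p.-group A -> p.-group [set: gT]%SET ->
  (forall a : {perm gT}, a \in A -> {morph a : x y / x * y}) ->
  (forall a : {perm gT}, a \in A -> forall x, x \in S -> a x \in S) ->
  S != [set: gT]%SET :> {set gT} ->
  exists u, u \notin S /\ forall a : {perm gT}, a \in A -> u^-1 * a u \in S.
Proof.
move=> p_prime pA pT aM aS ST.
pose D := lcosets S [set: gT]%SET.
have aC (a : {perm gT}) u : a \in A -> ('P^*%act (u *: S) a = a u *: S)%g.
  move=> Aa; apply/setP => x; rewrite /= /setact mem_lcoset.
  apply/imsetP/idP => [[y] + ->|xS].
    rewrite mem_lcoset => yS; rewrite /= /aperm -(mulKVg u y) aM// mulKg.
    exact: aS.
  exists (a^-1 x); last by rewrite /= /aperm permKV.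
  rewrite mem_lcoset -(mulKVg (a u) x) aM ?groupV// permK mulKg.
  by apply: aS; rewrite ?groupV.
have Dfix a C : a \in A -> C \in D -> 'P^*%act C a \in D.
  by move=> Aa /lcosetsP[u _ ->]; apply/lcosetsP; exists (a u); rewrite ?aC.
have actsD : [acts A, on D | 'P^*%act].
  apply/actsP => a Aa C; apply/idP/idP; last exact: Dfix.
  by rewrite -[X in _ -> X \in D](actK 'P^*%act a C); apply: Dfix; rewrite groupV.
have SD : (S : {set gT}) \in 'Fix_(D | 'P^*%act)(A).
  rewrite inE; apply/andP; split.
    by apply/lcosetsP; exists 1; rewrite ?lcoset1.
  apply/afixP => a Aa; have := aC a 1 Aa.
  rewrite lcoset1 => ->.
  have -> : a 1 = 1 by apply: (mulgI (a 1)); rewrite -aM// !mulg1.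
  exact: lcoset1.
have pD : p %| #|D|.
  rewrite card_lcosets; have := pnat_dvd (dvdn_indexg [set: gT]%G S) pT.
  move=> /p_natP[[|k] e]; last by rewrite e expnS dvdn_mulr.
  move/eqP: e; rewrite indexg_eq1 => TS; case/eqP: ST.
  by apply/eqP; rewrite finset.eqEsubset finset.subsetT.
have := pgroup_fix_mod pA actsD; rewrite (eqP pD) => /esym pF.
have [C CF CS] : exists2 C, C \in 'Fix_(D | 'P^*%act)(A) & C != (S : {set gT}).
  apply/exists_inP; apply: contraLR (prime_gt1 p_prime) => /exists_inPn noC.
  rewrite -leqNgt; apply: dvdn_leq => //; rewrite -(cards1 (S : {set gT})).
  suff <- : 'Fix_(D | 'P^*%act)(A) = [set (S : {set gT})]%SET by rewrite /dvdn pF.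
  apply/setP => C; rewrite [RHS]inE; apply/idP/eqP => [/noC/negPn/eqP//|->//].
move: CF; rewrite inE => /andP[/lcosetsP[u _ Cu] /afixP Cfix].
exists u; split.
  by apply: contra CS => uS; rewrite Cu lcoset_id.
move=> a Aa; rewrite -mem_lcoset -Cu -(Cfix a Aa) Cu aC// lcoset_refl//.
Qed.

End FixedCoset.

Lemma pgroup_of_p_elements (p : nat) (gT : finGroupType) (A : {group gT}) :
  prime p -> (forall a, a \in A -> exists k, a ^+ (p ^ k)%N = 1) -> p.-group A.
Proof.
move=> p_prime Ap; apply/pgroupP => q q_prime qA.
have [a aA aq] := Cauchy q_prime qA; have [k /eqP] := Ap a aA.
rewrite -order_dvdn aq Euclid_dvdX// => /andP[qp _].
by move: qp; rewrite (dvdn_prime2 q_prime p_prime).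
Qed.

Lemma fixed_mod_subspace (p : nat) (Q : finType) (A : {group {perm Q}})
    (S : set (Q -> 'F_p)) (u0 : Q -> 'F_p) :
  prime p -> p.-group A -> S (fun=> 0%R) ->
  (forall u v, S u -> S v -> S (fun q => u q - v q)%R) ->
  (forall (a : {perm Q}) u, a \in A -> S u -> S (fun q => u (a q))) ->
  ~ S u0 ->
  exists u, ~ S u /\ forall a : {perm Q}, a \in A -> S (fun q => u (a q) - u q)%R.
Proof.
move=> p_prime pA S0 SB SA Su0.
pose V : finZmodType := FinRing.Zmodule.clone 'rV['F_p]_#|Q| _.
pose gT : finGroupType := V.
pose tof (v : gT) : Q -> 'F_p := fun q => (v : 'rV['F_p]_#|Q|) ord0 (enum_rank q).
pose ofu (u : Q -> 'F_p) : gT := (\row_i u (enum_val i))%R.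
have tofK u : tof (ofu u) = u by apply/funext => q; rewrite /tof mxE enum_rankK.
have tof_inj : injective tof.
  move=> v w e; apply/rowP => i.
  by have := congr1 (@^~ (enum_val i)) e; rewrite /tof enum_valK.
have tofM v w : tof (v * w) = (fun q => tof v q + tof w q)%R.
  by apply/funext => q; rewrite /tof FinRing.zmodMgE mxE.
have tofV v : tof v^-1 = (fun q => - tof v q)%R.
  by apply/funext => q; rewrite /tof FinRing.zmodVgE mxE.
(* The inverse makes [r] a morphism, since a product of permutations applies its left factor
   first. *)
pose r0 (a : {perm Q}) (v : gT) : gT := ofu (fun q => tof v (a^-1 q)).
have r0_inj a : injective (r0 a).
  move=> v w /(congr1 tof); rewrite !tofK => e; apply: tof_inj; apply/funext => q.
  by have := congr1 (@^~ (a q)) e; rewrite permK.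
pose r a : {perm gT} := perm (@r0_inj a).
have rE a v q : tof (r a v) q = tof v (a^-1 q) by rewrite permE tofK.
have rM : {in A &, {morph r : a b / a * b}}.
  move=> a b _ _; apply/permP => v; apply: tof_inj; apply/funext => q.
  by rewrite permM !rE invMg permM.
pose rm := Morphism rM.
pose S' : {set gT} := [set v | `[< S (tof v) >]]%SET.
have gS : group_set S'.
  have SN u : S u -> S (fun q => - u q)%R.
    move=> Su; have := SB _ _ S0 Su; congr S; apply/funext => q; exact: sub0r.
  apply/group_setP; split.
    by rewrite !inE; move: S0; congr S; apply/funext => q; rewrite /tof FinRing.zmod1gE mxE.
  move=> v w; rewrite !inE => Sv Sw; rewrite tofM.
  have := SB _ _ Sv (SN _ Sw); congr S; apply/funext => q; by rewrite opprK.
have pT : p.-group [set: gT]%SET.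
  apply: (@pgroup_of_p_elements p gT [set: gT]%G) => // v _; exists 1%N.
  rewrite expn1 FinRing.zmodXgE; apply/rowP => i; rewrite mulmxnE mxE.
  by rewrite -mulr_natr pchar_Fp_0// mulr0.
have [||||u [uS uA]] := @pgroup_fixed_coset p gT (rm @* A)%G (Group gS) p_prime _ pT.
- exact: morphim_pgroup.
- move=> _ /morphimP[a _ _ ->] v w; apply: tof_inj; apply/funext => q.
  by rewrite tofM !rE tofM.
- move=> _ /morphimP[a _ Aa ->] v; rewrite !inE => Sv.
  have := SA a^-1 _ (groupVr Aa) Sv; congr S; apply/funext => q.
  by rewrite rE.
- apply/eqP => e; have : ofu u0 \in [set: gT]%SET by rewrite inE.
  by rewrite -e !inE tofK.
exists (tof u); split.
  by move=> Su; case/negP: uS; rewrite !inE.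
move=> a Aa; have := uA (r a^-1); rewrite !inE tofM tofV => H.
have : S (fun q => - tof u q + tof (r a^-1%g u) q)%R.
  by apply: H; apply: mem_morphim => //; rewrite groupV.
by congr S; apply/funext => q; rewrite rE invgK addrC.
Qed.

(** A continuous homomorphism from [N] to the discrete group [A], kept as a function on all of [F]
    to avoid subtypes; for an additive map, vanishing near $1$ is continuity. *)
Definition hom_on (F : topGroupType) (N : set F) (A : zmodType) (f : F -> A) :=
  (forall x y, N x -> N y -> f (x * y)%g = f x + f y)%R /\
  (\forall u \near (1 : F), N u -> f u = 0%R).

Definition conj_invariant (F : topGroupType) (N : set F) (A : zmodType)
  (f : F -> A) := forall g x, N x -> f (x ^ g) = f x.

Section HomOn.
Local Open Scope ring_scope.
Variables (F : topGroupType) (N : set F) (A : zmodType).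
Hypothesis sN : subgroup_set N.
Implicit Types f g : F -> A.

Let N1 : N 1%g. Proof. by case: sN. Qed.
Let NM x y : N x -> N y -> N (x * y)%g. Proof. by case: sN => _ + _; apply. Qed.
Let NV x : N x -> N x^-1%g. Proof. by case: sN => _ _; apply. Qed.

Lemma hom_onM f x y : hom_on N f -> N x -> N y -> f (x * y)%g = f x + f y.
Proof. by case=> + _; apply. Qed.

Lemma hom_on1 f : hom_on N f -> f 1%g = 0.
Proof. by move=> fN; apply: (addrI (f 1%g)); rewrite -hom_onM// mulg1 addr0. Qed.

Lemma hom_onV f x : hom_on N f -> N x -> f x^-1%g = - f x.
Proof.
move=> fN Nx; apply: (addrI (f x)); rewrite -hom_onM//; last exact: NV.
by rewrite mulgV hom_on1// subrr.
Qed.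

Lemma hom_onB f g : hom_on N f -> hom_on N g -> hom_on N (fun x => f x - g x).
Proof.
move=> [fM fc] [gM gc]; split=> [x y Nx Ny|]; first by rewrite fM// gM//; zmod.
by apply: filterS2 fc gc => u fu gu Nu; rewrite fu// gu// subrr.
Qed.

Lemma hom_onD f g : hom_on N f -> hom_on N g -> hom_on N (fun x => f x + g x).
Proof.
move=> [fM fc] [gM gc]; split=> [x y Nx Ny|]; first by rewrite fM// gM//; zmod.
by apply: filterS2 fc gc => u fu gu Nu; rewrite fu// gu// addr0.
Qed.

Lemma hom_on_near f x : hom_on N f -> N x ->
  \forall y \near x, N y -> f y = f x.
Proof.
move=> fN Nx; case: (fN) => _ /(near_mull x); apply: filterS => y fy Ny.
rewrite -(mulKVg x y) hom_onM//; last by apply: NM => //; exact: NV.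
by rewrite fy ?addr0//; apply: NM => //; exact: NV.
Qed.

End HomOn.

Section NormalGeneration.
Variables (p : nat) (F : topGroupType).

Lemma normal_conj_set (N : set F) g x : normal_set N -> N (x ^ g) <-> N x.
Proof.
move=> [_ NJ]; split=> [/(NJ g^-1)|]; last exact: NJ.
by rewrite -conjgM mulgV conjg1.
Qed.

Lemma closed_normal_closureP (R : set F) :
  [/\ closed (closed_normal_closure R), normal_set (closed_normal_closure R) &
      R `<=` closed_normal_closure R].
Proof.
split.
- by apply: closed_bigI => N [[]].
- split; first split=> [N [[cN [[N1 NM NV] NJ]] RN]//|x y Nx Ny N NR|x Nx N NR].
  + by have [[cN [[N1 NM NV] NJ]] RN] := NR; apply: NM; [exact: Nx|exact: Ny].
  + by have [[cN [[N1 NM NV] NJ]] RN] := NR; apply: NV; exact: Nx.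
  + move=> g x Nx N NR; have [[cN [[N1 NM NV] NJ]] RN] := NR.
    by apply: NJ; exact: Nx.
- by move=> x Rx N [_]; apply.
Qed.

Lemma closed_normal_closure_sub (R N : set F) :
  closed N -> normal_set N -> R `<=` N -> closed_normal_closure R `<=` N.
Proof. by move=> cN nN RN x; apply; split. Qed.

(** The kernel of [f] may fail to be normal in [F], so the closed normal subgroup compared with [N]
    consists of the elements all of whose conjugates [f] kills. *)
Lemma hom_on_closure_eq0 (A : zmodType) (R : set F) (f : F -> A) :
  hom_on (closed_normal_closure R) f ->
  (forall g r, R r -> f (r ^ g) = 0%R) ->
  forall x, closed_normal_closure R x -> f x = 0%R.
Proof.
set N := closed_normal_closure R => fN fR.
have [cN nN RN] := closed_normal_closureP R; have sN := nN.1.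
pose K := [set x | N x /\ forall g, f (x ^ g) = 0%R].
suff NK : N `<=` K by move=> x /NK[_ /(_ 1)]; rewrite conjg1.
apply: closed_normal_closure_sub.
- rewrite -openC openE => x /= nKx; have [Nx|nNx] := pselect (N x); last first.
    have : nbhs x (~` N) by apply: open_nbhs_nbhs; split=> //; exact: closed_openC.
    by apply: filterS => y nNy [Ny _].
  have [g fg] : exists g, f (x ^ g) <> 0%R.
    by apply: contrapT => nex; apply: nKx; split=> // g; apply: contrapT => fg;
      apply: nex; exists g.
  have Nxg : N (x ^ g) by apply/normal_conj_set.
  have cg : continuous (fun y : F => y ^ g).
    have -> : (fun y : F => y ^ g) = (fun y => g^-1 * (y * g)) by [].
    move=> y; apply: (@continuous_comp _ _ _ (fun y => y * g) (fun y => g^-1 * y)).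
      exact: mulr_continuous.
    exact: mull_continuous.
  have fg' : \forall y \near x, N (y ^ g) -> f (y ^ g) = f (x ^ g).
    exact: (cg x _ (hom_on_near sN fN Nxg)).
  apply: filterS fg' => y /= fy [Ny Ky].
  by apply: fg; rewrite -fy ?Ky//; apply/normal_conj_set.
- case: nN => -[N1 NM NV] NJ; split; first split=> [|x y [Nx Kx] [Ny Ky]|x [Nx Kx]].
  + by split=> // g; rewrite conj1g (hom_on1 sN).
  + split=> [|g]; first exact: NM.
    by rewrite conjMg (hom_onM fN) ?Kx ?Ky ?addr0//; exact: NJ.
  + split=> [|g]; first exact: NV.
    by rewrite conjVg (hom_onV sN)// ?Kx ?oppr0//; exact: NJ.
  + move=> g x [Nx Kx]; split; first exact: NJ.
    by move=> h; rewrite -conjgM.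
- by move=> r Rr; split; [exact: RN|move=> g; exact: fR].
Qed.

(** Take an open normal [M] containing [N'] but not [n0], and among functions on its cosets let [S]
    be those constant on [N]. A function outside [S] fixed modulo [S] by the maps $x\mapsto
    gxh^{-1}$, with $g\equiv h$ modulo [N], is on [N] the required homomorphism up to a constant. *)
Lemma invariant_hom_separates (N N' : set F) (n0 : F) :
  prime p -> pro_p p F -> normal_set N -> closed N' -> normal_set N' ->
  N n0 -> ~ N' n0 ->
  exists f : F -> 'F_p, [/\ hom_on N f, conj_invariant N f,
    forall x, N x -> N' x -> f x = 0%R & exists2 n, N n & f n <> 0%R].
Proof.
move=> p_prime Fp nN cN' nN' Nn0 N'n0.
have [W [oW nW Wn0]] : exists W : set F, [/\ open W, normal_set W &
    forall w, W w -> ~ N' (n0 * w)].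
  have /(nbhs_mull)/(pro_p_basis Fp)[W [oW nW Ww]] : nbhs n0 (~` N').
    by apply: open_nbhs_nbhs; split=> //; exact: closed_openC.
  by exists W.
pose M := [set x : F | exists2 n, N' n & W (n^-1 * x)].
have [[N'1 N'M N'V] N'J] := nN'; have [[W1 WM WV] WJ] := nW.
have [[N1 NM NV] NJ] := nN.
have M1 : M 1 by exists 1; rewrite ?invg1 ?mul1g.
have N'M' n : N' n -> M n by move=> N'n; exists n; rewrite ?mulVg.
have WM' w : W w -> M w by move=> Ww; exists 1; rewrite ?invg1 ?mul1g.
have MM x y : M x -> M y -> M (x * y).
  move=> [n N'n Wx] [n' N'n' Wy]; exists (n * n'); first exact: N'M.
  have := WM _ _ (WJ n' _ Wx) Wy; congr W.
  by rewrite conjgE invMg !mulgA mulgK.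
have MV x : M x -> M x^-1.
  move=> [n N'n Wx]; exists (n^-1); first exact: N'V.
  have := WJ n^-1 _ (WV _ Wx); congr W.
  by rewrite conjgE !invMg !invgK !mulgA mulgK.
have MJ g x : M x -> M (x ^ g).
  move=> [n N'n Wx]; exists (n ^ g); first exact: N'J.
  by rewrite -conjVg -conjMg; exact: WJ.
have sM : subgroup_set M by [].
have oM : open M.
  apply: subgroup_open => //; have : nbhs 1 W by exact: open_nbhs_nbhs.
  by apply: filterS => w; exact: WM'.
have Mn0 : ~ M n0.
  move=> [n N'n Wn]; apply: (Wn0 ((n^-1 * n0)^-1)); first exact: WV.
  by rewrite invMg invgK mulgA mulgV mul1g.
have cF : compact [set: F] by case: Fp.
have [c [c_surj cE]] := coset_space cF sM oM.
have [s cs] := choice c_surj.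
have c_gh g h x y : c x = c y -> c (g * x * h^-1) = c (g * y * h^-1).
  move=> /cE xy; apply/cE; have := MJ h^-1 _ xy; congr M.
  by rewrite conjgE !invMg invgK !mulgA mulgVK.
pose r0 g h q := c (g * s q * h^-1).
have r0E g h x : r0 g h (c x) = c (g * x * h^-1) by apply: c_gh; exact: cs.
have r0_inj g h : injective (r0 g h).
  move=> q q' /(congr1 (r0 g^-1 h^-1)); rewrite /r0 => e.
  have e' : c (g^-1 * (g * s q * h^-1) * h^-1^-1) =
            c (g^-1 * (g * s q' * h^-1) * h^-1^-1).
    by apply: (etrans (esym (r0E _ _ _))); apply: (etrans e); exact: r0E.
  by move: e'; rewrite !mulgA !mulVg !mul1g !mulgK !cs.
pose r g h := perm (@r0_inj g h).
have rE g h x : r g h (c x) = c (g * x * h^-1) by rewrite permE r0E.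
(* Pairs congruent modulo [N] are those whose two-sided translation preserves [N]; conjugations and
   translations by [N] are among them. *)
pose A : {set {perm 'I_(group_index M)}} :=
  [set a | `[< exists gh, N (gh.1^-1 * gh.2) /\ r gh.1 gh.2 = a >]]%SET.
have gA : group_set A.
  apply/group_setP; split.
    rewrite inE; apply/asboolP; exists (1, 1) => /=; rewrite invg1 mulg1; split=> //.
    by apply/permP => q; have [x <-] := c_surj q; rewrite rE perm1 invg1 mulg1 mul1g.
  move=> a b; rewrite !inE => -[[g h] /= [Ngh <-]] [[g' h'] /= [Ngh' <-]].
  exists (g' * g, h' * h) => /=; split.
    have := NM _ _ (NJ g _ Ngh') Ngh; congr N.
    by rewrite conjgE invMg !mulgA mulgK.
  apply/permP => q; have [x <-] := c_surj q.
  by rewrite permM !rE invMg !mulgA.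
have pA : p.-group (Group gA).
  apply: pgroup_of_p_elements => // a; rewrite !inE => -[[g h] /= [_ <-]].
  have rX n : r g h ^+ n = r (g ^+ n) (h ^+ n).
    elim: n => [|n IH].
      apply/permP => q; have [x <-] := c_surj q.
      by rewrite !expg0 rE perm1 invg1 mulg1 mul1g.
    rewrite expgS IH; apply/permP => q; have [x <-] := c_surj q.
    by rewrite permM !rE (expgSr g) (expgSr h) invMg !mulgA.
  have W1n : nbhs 1 W by exact: open_nbhs_nbhs.
  have WX x n : W x -> W (x ^+ n).
    by move=> Wx; elim: n => [|n IH]; rewrite ?expg0// expgS; exact: WM.
  have [k Wk] := pro_p_expg_nbhs g p_prime Fp W1n.
  have [l Wl] := pro_p_expg_nbhs h p_prime Fp W1n.
  exists (k + l)%N; rewrite rX; apply/permP => q; have [x <-] := c_surj q.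
  rewrite perm1 rE; apply/cE; apply: WM'.
  have Wg : W (g ^+ (p ^ (k + l))%N) by rewrite expnD expgnA; exact: WX.
  have Wh : W (h ^+ (p ^ (k + l))%N) by rewrite addnC expnD expgnA; exact: WX.
  have := WM _ _ Wh (WJ x _ (WV _ Wg)); congr W.
  by rewrite conjgE !invMg invgK !mulgA.
pose S := [set u : 'I_(group_index M) -> 'F_p | forall n, N n -> u (c n) = u (c 1)].
have N_gh g h n : N (g^-1 * h) -> N n -> N (g * n * h^-1).
  move=> Ngh Nn; have := NM _ _ (NJ g^-1 _ Nn) (NJ g^-1 _ (NV _ Ngh)); congr N.
  by rewrite !conjgE invMg !invgK !mulgA mulgVK mulgK.
have [||||u [Su uA]] := @fixed_mod_subspace p _ (Group gA) S
    (fun q => if q == c 1 then 1%R else 0%R) p_prime pA.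
- by [].
- by move=> u v Su Sv n Nn; rewrite Su// Sv.
- move=> a u; rewrite !inE => -[[g h] /= [Ngh <-]] Su n Nn; rewrite !rE.
  by rewrite (Su (g * n * h^-1)) ?(Su (g * 1 * h^-1))//; exact: N_gh.
- move=> /(_ n0 Nn0); rewrite eqxx; case: eqP => [/esym/cE|_ /eqP].
    by rewrite invg1 mul1g => /Mn0.
  by rewrite eq_sym oner_eq0.
have uE g h n : N (g^-1 * h) -> N n ->
    (u (c (g * n * h^-1)%g) - u (c n) = u (c (g * h^-1)%g) - u (c 1%g))%R.
  move=> Ngh Nn; have HA : r g h \in Group gA by rewrite !inE; exists (g, h).
  by have := uA _ HA n Nn; rewrite !rE mulg1.
(* In [uE], the pair [(x, 1)] yields additivity and the pair [(g^-1, g^-1)] invariance. *)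
exists (fun x => u (c x) - u (c 1%g))%R; split.
- split=> [x y Nx Ny|].
    have := uE x 1 y; rewrite invg1 !mulg1 => /(_ (NV _ Nx) Ny) /eqP.
    by rewrite -subr_eq0 => /eqP e; apply/subr0_eq; rewrite -[RHS]e; zmod.
  have : nbhs 1 W by exact: open_nbhs_nbhs.
  apply: filterS => w Ww _; apply/eqP; rewrite subr_eq0; apply/eqP; congr u.
  by apply/cE; rewrite mulg1; apply/MV/WM'.
- move=> g x Nx; have := uE g^-1 g^-1 x; rewrite !invgK mulgV mulVg subrr => /(_ N1 Nx)/subr0_eq.
  by rewrite conjgE mulgA => ->.
- move=> x _ N'x; apply/eqP; rewrite subr_eq0; apply/eqP; congr u.
  by apply/cE; rewrite mulg1; apply/MV/N'M'.
- apply: contrapT => nex; apply: Su => n Nn; apply/subr0_eq.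
  by apply: contrapT => un; apply: nex; exists n.
Qed.
End NormalGeneration.

(** Linear independence of the relators in $N/N^p[N,F]$, stated dually; it expresses the minimality
    of [R]. *)
Definition independent_relators (p : nat) (F : topGroupType) (R : {fset F}) :=
  forall b : F -> 'F_p, exists f : F -> 'F_p,
    [/\ hom_on (closed_normal_closure [set` R]) f,
        conj_invariant (closed_normal_closure [set` R]) f &
        {in R, f =1 b}].

(** Take [R] of least size with the given closure. Dropping [r] shrinks the closure, so some
    invariant homomorphism kills the other relators but not all of [N], and therefore not [r].
    Suitably scaled, these homomorphisms form a dual basis. *)
Lemma independent_subset (p : nat) (F : topGroupType) (R0 : {fset F}) :
  prime p -> pro_p p F -> exists R : {fset F}, [/\ (R `<=` R0)%fset,
    closed_normal_closure [set` R] = closed_normal_closure [set` R0] &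
    independent_relators p R].
Proof.
move=> p_prime Fp.
pose P n := `[< exists R : {fset F}, [/\ (R `<=` R0)%fset, #|` R| = n &
  closed_normal_closure [set` R] = closed_normal_closure [set` R0]] >].
have exP : exists n, P n by exists #|` R0|; apply/asboolP; exists R0.
case: (ex_minnP exP) => n /asboolP[R [RR0 cR NR]] n_min.
exists R; split=> //; rewrite /independent_relators; set N := closed_normal_closure _.
have [cN nN RN] := closed_normal_closureP [set` R].
have dual (r : F) : exists f : F -> 'F_p, r \in R -> [/\ hom_on N f, conj_invariant N f,
    {in R, forall s, s != r -> f s = 0%R} & f r != 0%R].
  have [rR|rR] := boolP (r \in R); last by exists (fun=> 0%R).
  pose R' := (R `\ r)%fset; pose N' := closed_normal_closure [set` R'].
  have [cN' nN' RN'] := closed_normal_closureP [set` R'].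
  have [n0 [Nn0 N'n0]] : exists n0, N n0 /\ ~ N' n0.
    apply: contrapT => nex.
    have NN' : N `<=` N' by move=> x Nx; apply: contrapT => N'x; apply: nex; exists x.
    have N'N : N' `<=` N.
      apply: closed_normal_closure_sub => // x /= xR'; apply: RN => /=.
      by move: xR'; rewrite in_fsetD1 => /andP[].
    have : (n <= #|` R'|)%N.
      apply: n_min; apply/asboolP; exists R'; split=> //.
        by apply: fsubset_trans RR0; exact: fsubD1set.
      by rewrite -NR; apply/seteqP.
    by rewrite -cR (cardfsD1 r R) rR ltnn.
  have [f [fN fJ fN' [m Nm fm]]] :=
    invariant_hom_separates p_prime Fp nN cN' nN' Nn0 N'n0.
  have fs : {in R, forall s, s != r -> f s = 0%R}.
    by move=> s sR sr; apply: fN'; [exact: RN|apply: RN'; rewrite /= in_fsetD1 sr].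
  exists f => _; split=> //; apply/eqP => fr; apply: fm.
  apply: (hom_on_closure_eq0 fN) => // g s /= sR; rewrite fJ; last exact: RN.
  by have [->//|sr] := eqVneq s r; exact: fs.
have [f fP] := choice dual; move=> b.
pose h x := (\sum_(r <- R) (b r / f r r) * f r x)%R.
exists h; split.
- split=> [x y Nx Ny|].
    rewrite /h -big_split /= big_seq [RHS]big_seq; apply: eq_bigr => r rR.
    by have [fN _ _ _] := fP r rR; rewrite (hom_onM fN)// mulrDr.
  have nR : \forall u \near (1 : F), forall r, r \in (R : seq F) -> N u -> f r u = 0%R.
    have : forall r, r \in (R : seq F) -> \forall u \near (1 : F), N u -> f r u = 0%R.
      by move=> r rR; have [[_ fc]] := fP r rR.
    elim: (R : seq F) => [_|r s IH rs]; first exact: nearW.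
    have rs1 : \forall u \near (1 : F), N u -> f r u = 0%R by apply: rs; exact: mem_head.
    have rs2 : \forall u \near (1 : F), forall r', r' \in s -> N u -> f r' u = 0%R.
      by apply: IH => r' r's; apply: rs; rewrite inE r's orbT.
    apply: filterS2 rs1 rs2 => u ru su r'.
    by rewrite inE => /orP[/eqP ->//|]; exact: su.
  apply: filterS nR => u fu Nu; rewrite /h big_seq big1// => r rR.
  by rewrite fu// mulr0.
- move=> g x Nx; rewrite /h big_seq [RHS]big_seq; apply: eq_bigr => r rR.
  by have [_ fJ _ _] := fP r rR; rewrite fJ.
- move=> s sR; rewrite /h (bigD1_seq s)//=.
  have [_ _ _ fs] := fP s sR; rewrite divfK// big_seq_cond big1 ?addr0// => r.
  move=> /andP[rR rs]; have [_ _ fr _] := fP r rR.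
  by rewrite (fr s sR) ?mulr0// eq_sym.
Qed.

Lemma trivial_smooth (F : topGroupType) (A : zmodType) :
  smooth_module (fun (_ : F) (a : A) => a).
Proof. by split=> // a; exact: lc_cst. Qed.

Lemma Fp_mulrn (p : nat) (a : 'F_p) : prime p -> (a *+ p = 0)%R.
Proof. by move=> p_prime; rewrite -mulr_natr pchar_Fp_0// mulr0. Qed.

Lemma free_hom_lift (p : nat) (F : topGroupType) (X : finType) (iota : X -> F)
    (v : X -> 'F_p) : prime p -> free_pro_p p iota ->
  exists f : F -> 'F_p, [/\ locally_constant f,
    forall x y, (f (x * y)%g = f x + f y)%R & forall i, f (iota i) = v i].
Proof.
move=> p_prime Ff.
have [||||c [cl cM cv]] := @free_cochain_lift p F X iota 'F_p (fun _ a => a)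
  (fun _ _ => 0%R) v p_prime Ff.
- exact: trivial_smooth.
- by move=> b; exact: Fp_mulrn.
- exact: lc_cst.
- by move=> *; zmod.
by exists c; split=> // x y; rewrite cM subr0.
Qed.

Lemma free_hom_over (p : nat) (F F' G : topGroupType) (X : finType)
    (iota : X -> F) (f : F -> G) (f' : F' -> G) :
  free_pro_p p iota -> pro_p p F' -> pro_p p G -> is_hom f -> is_hom f' ->
  continuous f -> continuous f' -> (forall g, exists x, f' x = g) ->
  exists a : F -> F', [/\ is_hom a, continuous a & forall x, f' (a x) = f x].
Proof.
move=> Ff F'p Gp fM f'M fc f'c f's.
have [s sP] := choice (fun i => f's (f (iota i))).
have [a [[aM ac ai] _]] := Ff.2 F' s F'p.
exists a; split=> // x.
suff e : (fun y => f' (a y)) = f by exact: (congr1 (@^~ x) e).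
apply: (free_pro_p_hom_unique Ff Gp) => //.
- by move=> y z; rewrite aM f'M.
- by move=> y; apply: (@continuous_comp _ _ _ a f'); [exact: ac|exact: f'c].
- by move=> i; rewrite ai sP.
Qed.

(* For homomorphisms [a : F -> F'] and [b : F' -> F] over [G], an additive character
   [c] of [F] and an invariant homomorphism [t] on [N'] are together determined by
   [x |-> c (b x) + t (x^-1 * a (b x))] on [F'] and [c + t \o a] on [N]: this gives
   an injection between finite spaces, hence the inequality. *)
Lemma presentation_compare (p : nat) (G F F' : topGroupType) (X X' : finType)
    (iota : X -> F) (iota' : X' -> F') (R : {fset F}) (R' : {fset F'}) :
  prime p -> pro_p p G -> presentation p G iota R -> presentation p G iota' R' ->
  independent_relators p R' -> (#|X| + #|` R'| <= #|X'| + #|` R|)%N.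
Proof.
move=> p_prime Gp [Ff [f [fM fs fq fK]]] [F'f [f' [f'M f's f'q f'K]]] indR'.
set N := closed_normal_closure _ in fK; set N' := closed_normal_closure _ in f'K.
have NE x : N x <-> f x = 1 by rewrite -fK.
have N'E x : N' x <-> f' x = 1 by rewrite -f'K.
have [cN nN RN] := closed_normal_closureP [set` R].
have [cN' nN' RN'] := closed_normal_closureP [set` R'].
have fc : continuous f by apply/continuousP => U /fq.
have f'c : continuous f' by apply/continuousP => U /f'q.
have [Fp _] := Ff; have [F'p _] := F'f.
have [a [aM ac fa]] := free_hom_over Ff F'p Gp fM f'M fc f'c f's.
have [b [bM bc fb]] := free_hom_over F'f Fp Gp f'M fM f'c fc fs.
have aN x : N x -> N' (a x) by move=> /NE fx; apply/N'E; rewrite fa.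
have bN x : N' x -> N (b x) by move=> /N'E fx; apply/NE; rewrite fb.
have abN x : N' (x^-1 * a (b x)).
  by apply/N'E; rewrite f'M (homV f'M) fa fb mulVg.
have baN x : N (x^-1 * b (a x)).
  by apply/NE; rewrite fM (homV fM) fb fa mulVg.
have injective_data (c : F -> 'F_p) (t : F' -> 'F_p) : locally_constant c ->
    (forall x y, c (x * y)%g = c x + c y)%R -> hom_on N' t -> conj_invariant N' t ->
    (forall i, c (b (iota' i)) + t ((iota' i)^-1 * a (b (iota' i)))%g = 0)%R ->
    (forall r, r \in R -> c r + t (a r) = 0)%R ->
    (forall x, c x = 0%R) /\ forall x, N' x -> t x = 0%R.
  move=> cl cM tN tJ ct0 ctR0.
  (* Invariance of [t] makes this expression an additive character of [F'], so it vanishes because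
     it does on the generators. *)
  have ct x : (c (b x) + t (x^-1 * a (b x))%g = 0)%R.
    apply: (free_cocycle_eq (c := fun x => (c (b x) + t (x^-1 * a (b x))%g)%R)
      p_prime F'f (trivial_smooth F' 'F_p)) => //.
      apply: lc_post2; first exact: (lc_comp cl bc).
      move=> y; set h := fun y => y^-1 * a (b y).
      have hc : continuous h.
        apply: mul_continuous; first by apply: inv_continuous => z; exact: cvg_id.
        by move=> z; apply: (@continuous_comp _ _ _ b a); [exact: bc|exact: ac].
      have nh : \forall z \near y, N' (h z) -> t (h z) = t (h y).
        exact: (hc y _ (hom_on_near nN'.1 tN (abN y))).
      by apply: filterS nh => z; apply; exact: abN.
    move=> y z; rewrite bM cM aM.
    have -> : (y * z)^-1 * (a (b y) * a (b z)) =
        (y^-1 * a (b y)) ^ z * (z^-1 * a (b z)).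
      by rewrite conjgE invMg !mulgA mulgK.
    rewrite (hom_onM tN)//; last by apply/normal_conj_set.
    by rewrite tJ//; zmod.
  have psi0 x : N x -> (c x + t (a x) = 0)%R.
    have c1 : c 1 = 0%R by apply: (addrI (c 1)); rewrite -cM mulg1 addr0.
    have cV y : c y^-1 = (- c y)%R.
      by apply: (addrI (c y)); rewrite -cM mulgV subrr.
    have psi_hom : hom_on N (fun x => c x + t (a x))%R.
      split=> [y z Ny Nz|].
        by rewrite cM aM (hom_onM tN (aN _ Ny) (aN _ Nz)); zmod.
      have n1 : \forall u \near (1 : F), N' (a u) -> t (a u) = 0%R.
        have t1 : nbhs (a 1) (fun u => N' u -> t u = 0%R).
          by rewrite (hom1 aM); case: tN.
        exact: (ac 1 _ t1).
      have n2 : \forall u \near (1 : F), c u = c 1 by exact: cl.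
      apply: filterS2 n2 n1 => u -> tu Nu.
      by rewrite c1 add0r tu//; exact: aN.
    apply: (hom_on_closure_eq0 psi_hom) => g r /= rR.
    rewrite conjgE !cM cV (homJ aM); have := tJ (a g) (a r) (aN _ (RN _ rR)).
    by rewrite conjgE => ->; rewrite -[RHS](ctR0 r rR); zmod.
  (* Subtracting [psi0] at [x^-1 * b (a x)] from [ct] at [a x] cancels the terms in [t] and leaves
     $c(x)$. *)
  have c0 x : c x = 0%R.
    have e1 := ct (a x); have e2 := psi0 _ (baN x).
    have eq : a (x^-1 * b (a x)) = (a x)^-1 * a (b (a x)) by rewrite aM (homV aM).
    rewrite eq in e2.
    have e3 : c (b (a x)) = (c x + c (x^-1 * b (a x))%g)%R by rewrite -cM mulVKg.
    apply/subr0_eq; rewrite -[RHS](subrr (c (b (a x)) + t ((a x)^-1 * a (b (a x)))%g)%R).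
    rewrite {2}e1 -{2}e2 e3; zmod.
  split=> // x N'x.
  have N'V : N' x^-1 by case: nN' => -[_ _ NV] _; apply: NV.
  have := ct x; rewrite c0 add0r (hom_onM tN N'V (aN _ (bN _ N'x))).
  rewrite (hom_onV nN'.1 tN)// => e.
  have := psi0 _ (bN x N'x); rewrite c0 add0r => e2.
  by move: e; rewrite e2 addr0 => /eqP; rewrite oppr_eq0 => /eqP.
pose T := ({ffun X -> 'F_p} * {ffun R' -> 'F_p})%type.
pose T' := ({ffun X' -> 'F_p} * {ffun R -> 'F_p})%type.
have [c cP] := choice (fun w : {ffun X -> 'F_p} => free_hom_lift w p_prime Ff).
have ext_b (w : {ffun R' -> 'F_p}) : exists t : F' -> 'F_p,
    [/\ hom_on N' t, conj_invariant N' t & forall r : R', t (val r) = w r].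
  have [t [tN tJ tR]] := indR' (fun x => if insub x is Some r then w r else 0%R).
  by exists t; split=> // r; rewrite tR ?valK//; exact: valP.
have [t tP] := choice ext_b.
pose m (u : T) : T' :=
  ([ffun i => c u.1 (b (iota' i)) + t u.2 ((iota' i)^-1 * a (b (iota' i)))%g],
   [ffun r => c u.1 (val r) + t u.2 (a (val r))])%R.
have m_inj : injective m.
  move=> [w1 b1] [w2 b2] [e1 e2].
  have [c1l c1M c1v] := cP w1; have [c2l c2M c2v] := cP w2.
  have [t1N t1J t1v] := tP b1; have [t2N t2J t2v] := tP b2.
  have [|||||| c0 t0] := injective_data (fun x => c w1 x - c w2 x)%R
      (fun x => t b1 x - t b2 x)%R.
  - exact: (lc_post2 (fun a b => (a - b)%R) c1l c2l).
  - by move=> x y; rewrite c1M c2M; zmod.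
  - exact: hom_onB t1N t2N.
  - by move=> g x N'x; rewrite t1J// t2J.
  - move=> i; have /ffunP/(_ i) := e1; rewrite !ffunE /= => /eqP.
    by rewrite -subr_eq0 => /eqP <-; zmod.
  - move=> r rR; have /ffunP/(_ [` rR]%fset) := e2; rewrite !ffunE /= => /eqP.
    by rewrite -subr_eq0 => /eqP <-; zmod.
  congr (_, _); apply/ffunP => i.
    by rewrite -c1v -c2v; apply/subr0_eq/c0.
  rewrite -t1v -t2v; apply/subr0_eq/t0; apply: RN'; exact: valP.
have := leq_card m m_inj; rewrite !card_prod !card_ffun !card_Fp// -!expnD.
by rewrite leq_exp2l ?prime_gt1// !cardfE.
Qed.

(** * The relation module and the Euler identity *)

(* The relation module [N / N^p[N,N]] is a free [F_p[[G]]]-module on the classes of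
   the relators, stated dually: a homomorphism from [N] to ['F_p] can be
   prescribed arbitrarily on the conjugates of the relators. *)
Definition free_relators (p : nat) (G F : topGroupType) (f : F -> G)
    (R : {fset F}) :=
  forall (U : set G) (r0 x0 : F), open U -> normal_set U -> r0 \in R ->
  exists t : F -> 'F_p, hom_on (closed_normal_closure [set` R]) t /\
    forall x r, r \in R ->
      t (r ^ x) = if (r == r0) && `[< U ((f x)^-1 * f x0) >] then 1%R else 0%R.

Lemma Fp_mulrnD (p : nat) (A : zmodType) (a : A) (x y : 'F_p) : prime p ->
  (a *+ p = 0 -> a *+ (x + y)%R = a *+ x + a *+ y)%R.
Proof.
move=> p_prime pA; rewrite -mulrnDr.
have -> : (x + y)%R = ((x + y) %% p)%N :> nat by congr (_ %% _); exact: Fp_cast.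
by rewrite [in RHS](divn_eq (x + y) p) mulrnDr mulnC mulrnA pA mul0rn add0r.
Qed.

Lemma lc_uniform (G : topGroupType) (A : Type) (u : G -> A) : compact [set: G] ->
  locally_constant u -> \forall v \near (1 : G), forall y, u (y * v) = u y.
Proof.
move=> cG lu; apply: compact_forall_near => // y.
have [[V W] /= [Vy W1] VW] := @mulg_continuous G (y, 1) _ (lu (y * 1)).
exists (V `&` [set z | u z = u y], W).
  by split=> //=; apply: filterI => //; exact: lu.
move=> [a b] /= [[Va ua] Wb]; rewrite ua.
by have /= -> := VW (a, b) (conj Va Wb); rewrite mulg1.
Qed.

(** By uniform continuity [u] depends only on the coset of an open normal [U]; the lift is then a
    finite sum over cosets and relators of the dual functions supplied by freeness. Scalars in
    ['F_p] act on [A] through their representatives below $p$. *)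
Lemma free_relators_lift (p : nat) (G F : topGroupType) (f : F -> G) (R : {fset F})
    (A : zmodType) (u : G -> F -> A) :
  prime p -> pro_p p G -> (forall g, exists x, f x = g) -> free_relators p f R ->
  (forall a : A, a *+ p = 0)%R -> locally_constant u ->
  exists t : F -> A, hom_on (closed_normal_closure [set` R]) t /\
    forall x r, r \in R -> t (r ^ x) = u (f x) r.
Proof.
move=> p_prime Gp fs fR pA lu; set N := closed_normal_closure _.
have cG : compact [set: G] by case: Gp.
have [U [oU nU Uu]] := pro_p_basis Gp (lc_uniform cG lu).
have [c [c_surj cE]] := coset_space cG nU.1 oU.
have [s cs] := choice c_surj.
have [s' fs'] := choice (fun i => fs (s i)).
have dual (ri : F * 'I_(group_index U)) : exists t : F -> 'F_p, ri.1 \in R ->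
    hom_on N t /\ forall x r, r \in R ->
      t (r ^ x) = if (r == ri.1) && (c (f x) == ri.2) then 1%R else 0%R.
  have [riR|riR] := boolP (ri.1 \in R); last by exists (fun=> 0%R).
  have [t [tN tR]] := fR U ri.1 (s' ri.2) oU nU riR.
  exists t => _; split=> // x r rR; rewrite tR//; congr (if _ && _ then _ else _).
  rewrite fs'; apply/asboolP/eqP => [/cE ->|e]; first exact: cs.
  by apply/cE; rewrite cs.
have [t tP] := choice dual.
exists (fun n => \sum_(r <- R) \sum_i u (s i) r *+ t (r, i) n)%R; split.
  split=> [x y Nx Ny|].
    rewrite -big_split /= big_seq [RHS]big_seq; apply: eq_bigr => r rR.
    rewrite -big_split; apply: eq_bigr => i _.
    by rewrite (hom_onM (tP (r, i) rR).1)// Fp_mulrnD.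
  have nR : \forall v \near (1 : F), forall r, r \in (R : seq F) ->
      forall i, N v -> t (r, i) v = 0%R.
    have nr r : r \in (R : seq F) -> \forall v \near (1 : F), forall i, N v -> t (r, i) v = 0%R.
      move=> rR; apply: filter_forall => i.
      by have [[]] := tP (r, i) rR.
    elim: (R : seq F) nr => [_|r l IH rs]; first exact: nearW.
    have rs1 : \forall v \near (1 : F), forall i, N v -> t (r, i) v = 0%R.
      by apply: rs; exact: mem_head.
    have rs2 : \forall v \near (1 : F), forall r', r' \in l ->
        forall i, N v -> t (r', i) v = 0%R.
      by apply: IH => r' r's; apply: rs; rewrite inE r's orbT.
    apply: filterS2 rs1 rs2 => v rv lv r'.
    by rewrite inE => /orP[/eqP ->//|]; exact: lv.
  apply: filterS nR => v tv Nv; rewrite big_seq big1// => r rR.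
  by rewrite big1// => i _; rewrite tv.
move=> x r rR; rewrite (bigD1_seq r)//= (bigD1 (c (f x)))//=.
rewrite (tP (r, _) rR).2// !eqxx /= mulr1n big1 => [|i ni]; last first.
  by rewrite (tP (r, _) rR).2//= eq_sym (negbTE ni) andbF.
rewrite big_seq_cond big1 ?addr0 => [|r' /andP[r'R nr]]; last first.
  rewrite big1// => i _.
  by rewrite (tP (r', _) r'R).2//= eq_sym (negbTE nr).
have /cE Usf : c (f x) = c (s (c (f x))) by rewrite cs.
by rewrite -(mulVKg (f x) (s (c (f x)))) Uu.
Qed.

(** Comparison with an arbitrary presentation makes this value an upper bound, so the maximum exists
    and [xget] does not fall back on its default. *)
Lemma deficiency_independent (p : nat) (G F : topGroupType) (X : finType)
    (iota : X -> F) (R : {fset F}) :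
  prime p -> pro_p p G -> presentation p G iota R -> independent_relators p R ->
  deficiency p G = (#|X|%:Z - #|` R|%:Z)%R.
Proof.
move=> p_prime Gp pG indR.
set D := [set z | presentation_deficiencies p G z /\
  ubound (presentation_deficiencies p G) z].
have DR : D (#|X|%:Z - #|` R|%:Z)%R.
  split; first by exists F, X, iota, R.
  move=> _ [F' [X' [iota' [R' [pG' ->]]]]].
  have := presentation_compare p_prime Gp pG' pG indR.
  by rewrite Num.Theory.lerBlDr addrAC Num.Theory.lerBrDr -!PoszD lez_nat.
rewrite /deficiency; apply: xget_unique => // z [Dz Uz].
case: DR => DR UR.
by apply/eqP; rewrite Order.POrderTheory.eq_le UR// Uz.
Qed.

Lemma subgroup_preimage (G F : groupType) (f : F -> G) (H : set G) :
  is_hom f -> subgroup_set H -> subgroup_set (f @^-1` H).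
Proof.
move=> fM [H1 HM HV]; split=> [|x y Hx Hy|x Hx] /=.
- by rewrite (hom1 fM).
- by rewrite fM; exact: HM.
- by rewrite (homV fM); exact: HV.
Qed.

Lemma subgroup_open_image (G : topGroupType) (H : set G) (sH : subgroup_set H)
    (A : set (subgroup_type sH)) : open H -> open A ->
  open ((fun x => subgroup_val x) @` A).
Proof.
move=> oH [O oO <-]; rewrite (_ : _ @` _ = H `&` O); first exact: openI.
apply/seteqP; split=> [_ [x /= Ox <-]|x [Hx Ox]].
  by split=> //; exact: subgroup_valP.
by exists (subgroup_mk sH Hx).
Qed.

Section OpenSubgroup.
Variables (p : nat) (G F : topGroupType) (X : finType) (iota : X -> F)
  (R : {fset F}) (f : F -> G).
Hypotheses (p_prime : prime p) (Gp : pro_p p G) (Ff : free_pro_p p iota)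
  (fM : is_hom f) (f_surj : forall g, exists x, f x = g)
  (fq : forall U : set G, open U <-> open (f @^-1` U))
  (fK : f @^-1` [set 1] = closed_normal_closure [set` R]).
Variables (H : set G) (sH : subgroup_set H) (oH : open H).

Local Notation N := (closed_normal_closure [set` R]).
Local Notation m := (group_index H).
Let K : set F := f @^-1` H.
Let sK : subgroup_set K := subgroup_preimage fM sH.
Let oK : open K. Proof. exact/fq. Qed.
Let NE x : N x <-> f x = 1. Proof. by rewrite -fK. Qed.

Let NK x : N x -> K x.
Proof. by move=> /NE; rewrite /K /= => ->; case: sH. Qed.

Variables (c : G -> 'I_m) (t : 'I_m -> F).
Hypotheses (cE : forall x y, c x = c y <-> H (x^-1 * y)) (ct : forall i, c (f (t i)) = i).

Let relK (r : R) (i : 'I_m) : K (val r ^ t i).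
Proof.
have [cN [sN NJ] RN] := closed_normal_closureP [set` R].
by apply: NK; apply: NJ; apply: RN; exact: fsvalP.
Qed.

(** Writing $x=t_ik$ with $k$ in the preimage [K] of [H] gives $r^x=(r^{t_i})^k$: over [K] these
    conjugates suffice to generate [N]. *)
Definition subgroup_relator (ri : R * 'I_m) : subgroup_type sK :=
  subgroup_mk sK (relK ri.1 ri.2).

(** Being a set, it merges coinciding relators: its size is the number of relators times the index
    exactly when [subgroup_relator] is injective. *)
Definition subgroup_relators : {fset subgroup_type sK} :=
  [fset subgroup_relator ri | ri in {: R * 'I_m}]%fset.

Lemma subgroup_relatorsP y :
  y \in subgroup_relators <-> exists ri, y = subgroup_relator ri.
Proof.
split=> [/imfsetP[ri _ ->]|[ri ->]]; first by exists ri.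
exact: in_imfset.
Qed.

Let card_index : #|{: R * 'I_m}| = (#|` R| * m)%N.
Proof. by rewrite card_prod card_ord -cardfE. Qed.

Lemma card_subgroup_relators_le : (#|` subgroup_relators| <= #|` R| * m)%N.
Proof. by apply: leq_trans (leq_imfset_card _ _ _) _; rewrite -card_index cardE. Qed.

Lemma card_subgroup_relators : injective subgroup_relator ->
  #|` subgroup_relators| = (#|` R| * m)%N.
Proof. by move=> inj; rewrite card_imfset//= -card_index cardE. Qed.

Lemma card_subgroup_relators_inj :
  #|` subgroup_relators| = (#|` R| * m)%N -> injective subgroup_relator.
Proof.
move=> e a b ab; apply: contrapT => /eqP nab.
have : (#|` subgroup_relators| <=
    #|` [fset subgroup_relator ri | ri in predC1 b]%fset|)%N.
  apply: fsubset_leq_card; apply/fsubsetP => _ /imfsetP[ri _ ->].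
  have [->|nb] := eqVneq ri b; first by rewrite -ab in_imfset.
  by rewrite in_imfset.
move=> /leq_trans/(_ (leq_imfset_card _ _ _)).
rewrite e -card_index (cardD1 b) -cardE inE add1n => /leq_trans le_b.
suff /le_b : (#|predC1 b| <= #|[predD1 {: R * 'I_m} & b]|)%N by rewrite ltnn.
by apply: subset_leq_card; apply/fintype.subsetP => x; rewrite !inE andbT.
Qed.

Let cF : compact [set: F]. Proof. by case: Ff => -[]. Qed.

Lemma preimage_group_index : group_index K = m.
Proof.
have [cK [cK_surj cKE]] := coset_space cF sK oK.
have KE x y : cK x = cK y <-> c (f x) = c (f y).
  by rewrite cKE cE /K /= fM (homV fM).
have [s sE] := choice cK_surj.
apply/eqP; rewrite eqn_leq; apply/andP; split.
  rewrite -[X in (X <= _)%N]card_ord -[X in (_ <= X)%N]card_ord.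
  by apply: (@leq_card _ _ (fun i => c (f (s i)))) => i j /KE; rewrite !sE.
rewrite -[X in (X <= _)%N]card_ord -[X in (_ <= X)%N]card_ord.
by apply: (@leq_card _ _ (fun i => cK (t i))) => i j /KE; rewrite !ct.
Qed.

(** For the harder inclusion, the closure formed in [K] has a compact, hence closed, image in [F];
    the elements all of whose conjugates lie in this image form a closed normal subgroup containing
    [R]. *)
Lemma subgroup_closure (x : subgroup_type sK) :
  closed_normal_closure [set` subgroup_relators] x <-> N (subgroup_val x).
Proof.
have [cN nN RN] := closed_normal_closureP [set` R].
have [cNK nNK RNK] := closed_normal_closureP [set` subgroup_relators].
set NK' := closed_normal_closure _ in cNK nNK RNK *.
split.
  apply: (@closed_normal_closure_sub _ _ [set x | N (subgroup_val x)]).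
  - apply: (preimage_closed (f := @subgroup_val _ _ sK)) => //.
    by move=> *; exact: subgroup_val_continuous.
  - exact: (normal_preimage (@subgroup_val_hom _ _ sK) nN).
  - move=> _ /= /subgroup_relatorsP[[r i] ->].
    by apply/normal_conj_set => //; apply: RN; exact: fsvalP.
pose M := (fun y => subgroup_val y) @` NK'.
have cM : closed M.
  apply: compact_closed; first by case: Ff => -[].
  apply: continuous_compact.
    exact/continuous_subspaceT/subgroup_val_continuous.
  have cT : compact [set: subgroup_type sK].
    apply: subgroup_compact.
    exact: (subclosed_compact (open_subgroup_closed sK oK) cF).
  exact: (subclosed_compact cNK cT).
suff NM : N `<=` [set y | forall g, M (y ^ g)].
  by move=> /NM /(_ 1); rewrite conjg1 => -[y NKy /subgroup_val_inj <-].
have sM : subgroup_set M.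
  case: nNK => -[N1 NMu NV] _; split=> [|_ _ [y Ny <-] [z Nz <-]|_ [y Ny <-]].
  - by exists 1.
  - by exists (y * z) => //; exact: NMu.
  - by exists y^-1 => //; exact: NV.
apply: closed_normal_closure_sub.
- rewrite (_ : [set _ | _] = \bigcap_g ((fun y => y ^ g) @^-1` M)); last first.
    by apply/seteqP; split=> h /= Kh q; [move=> _|]; exact: Kh.
  apply: closed_bigI => g _; apply: preimage_closed => //.
  move=> y _; apply: (@continuous_comp _ _ _ (fun y => y * g) (fun y => g^-1 * y)).
    exact: mulr_continuous.
  exact: mull_continuous.
- case: sM => M1 MM MV; split; first split=> [g|y z My Mz g|y My g].
  + by rewrite conj1g.
  + by rewrite conjMg; exact: MM.
  + by rewrite conjVg; exact: MV.
  + by move=> g y My h; rewrite -conjgM.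
- move=> r /= rR g; pose i := c (f g).
  have Kk : K ((t i)^-1 * g) by rewrite /K /= fM (homV fM); apply/cE; rewrite ct.
  exists (subgroup_relator ([` rR]%fset, i) ^ subgroup_mk sK Kk).
    by case: nNK => _; apply; apply: RNK; apply/subgroup_relatorsP; eexists.
  by rewrite (homJ (@subgroup_val_hom _ _ sK)) !subgroup_mkK -conjgM mulVKg.
Qed.

Lemma open_subgroup_presentation : exists (Y : finType) (j : Y -> subgroup_type sK),
  presentation p (subgroup_type sH) j subgroup_relators /\
  (#|Y| + m)%N = (m * #|X|).+1.
Proof.
have [Y [j [Fj cardY]]] := schreier_free p_prime Ff sK oK.
rewrite preimage_group_index in cardY.
exists Y, j; split=> //; split=> //.
have fKH (x : subgroup_type sK) : H (f (subgroup_val x)) by exact: (subgroup_valP x).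
exists (fun x => subgroup_mk sH (fKH x)); split.
- move=> x y; apply: subgroup_val_inj; rewrite [RHS]subgroup_val_hom.
  exact: (fM (subgroup_val x) (subgroup_val y)).
- move=> g; have [x fx] := f_surj (subgroup_val g).
  have Kx : K x by rewrite /K /= fx; exact: subgroup_valP.
  by exists (subgroup_mk sK Kx); apply: subgroup_val_inj; rewrite !subgroup_mkK.
- have fc : continuous f by apply/continuousP => U /fq.
  move=> U; split=> oU.
    move: U oU; apply/continuousP; apply: subgroup_to_continuous => x.
    apply: (@continuous_comp _ _ _ (@subgroup_val _ _ sK) f).
      exact: subgroup_val_continuous.
    exact: fc.
  have oV := subgroup_open_image oK oU.
  rewrite (_ : U = (fun x => subgroup_val x) @^-1` ((fun x => subgroup_val x) @` U)).
    suff : open ((fun x : subgroup_type sH => subgroup_val x) @` U).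
      by move=> ?; apply: open_comp => // x _; exact: (@subgroup_val_continuous _ _ sH x).
    apply/fq; rewrite (_ : _ @^-1` _ = (fun x => subgroup_val x) @`
      ((fun x => subgroup_mk sH (fKH x)) @^-1` U))//.
    apply/seteqP; split=> [x [u Uu /= ux]|_ [x Ux <-]].
      have Kx : K x by rewrite /K /= -ux; exact: subgroup_valP.
      exists (subgroup_mk sK Kx) => //=.
      by rewrite (_ : subgroup_mk sH _ = u)//; apply: subgroup_val_inj.
    by exists (subgroup_mk sH (fKH x)).
  apply/seteqP; split=> [x Ux|x [y Uy /subgroup_val_inj <-]//].
  by exists x.
- apply/seteqP; split=> x.
    move=> /= /(congr1 (fun y => subgroup_val y)); rewrite subgroup_mkK => fx.
    by apply/subgroup_closure/NE.
  by move=> /subgroup_closure/NE fx; apply: subgroup_val_inj.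
Qed.

End OpenSubgroup.

Lemma euler_identity (y m x r : nat) : (y + m = (m * x).+1)%N ->
  (Posz y - Posz (r * m) - 1 = Posz m * (Posz x - Posz r - 1))%R.
Proof.
move=> /(congr1 Posz); rewrite -addn1 !PoszD !PoszM => e.
have -> : (Posz y = Posz m * Posz x + 1 - Posz m)%R by rewrite -e addrK.
by rewrite !mulrBr mulr1 (mulrC (Posz r)); zmod.
Qed.

Section EulerCharacteristic.
Variables (p : nat) (G F : topGroupType) (X : finType) (iota : X -> F)
  (R : {fset F}) (f : F -> G).
Hypotheses (p_prime : prime p) (Gp : pro_p p G) (Ff : free_pro_p p iota)
  (fM : is_hom f) (f_surj : forall g, exists x, f x = g)
  (fq : forall U : set G, open U <-> open (f @^-1` U))
  (fK : f @^-1` [set 1] = closed_normal_closure [set` R])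
  (indR : independent_relators p R).

Local Notation N := (closed_normal_closure [set` R]).

Let presR : presentation p G iota R.
Proof. by split=> //; exists f. Qed.

Let NE x : N x <-> f x = 1. Proof. by rewrite -fK. Qed.

Let deficiencyG : deficiency p G = (#|X|%:Z - #|` R|%:Z)%R.
Proof. exact: (deficiency_independent p_prime Gp presR indR). Qed.

Let cG : compact [set: G]. Proof. by case: Gp. Qed.

(** Freeness realizes any values depending on the relator and the coset of [H]. This makes the
    transversal conjugates distinct and independent, so their presentation computes the deficiency
    of the subgroup. *)
Lemma free_relators_deficiency (H : set G) (sH : subgroup_set H) :
  free_relators p f R -> open H ->
  (deficiency p (subgroup_type sH) - 1 =
     (group_index H)%:Z * (deficiency p G - 1))%R.
Proof.
move=> fR oH.
have [cN nN RN] := closed_normal_closureP [set` R].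
have [c [c_surj cE]] := coset_space cG sH oH.
have [s sE] := choice c_surj.
have [t' t'E] := choice f_surj.
pose t i := t' (s i).
have ct i : c (f (t i)) = i by rewrite /t t'E sE.
have [Y [j [pY cardY]]] :=
  open_subgroup_presentation p_prime Ff fM f_surj fq fK sH oH cE ct.
have lc_c : locally_constant c.
  move=> x; apply: filterS (near_mull x (open_subgroup_nbhs sH oH)) => y xy.
  by apply/esym/cE.
pose rel := subgroup_relator fM fK sH t.
have NrK (r : R) : N (val r) by apply: RN; exact: fsvalP.
have prescribe (b : R * 'I_(group_index H) -> 'F_p) : exists u : F -> 'F_p,
    hom_on N u /\ forall x (r : R), u (val r ^ x) = b (r, c (f x)).
  pose u0 (g : G) (r : F) := if insub r is Some r' then b (r', c g) else 0%R.
  have [|u [uN uR]] := @free_relators_lift p G F f R 'F_p u0 p_prime Gp f_surj fR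
      (fun a => Fp_mulrn a p_prime).
    exact: (lc_post (fun i r => if insub r is Some r' then b (r', i) else 0%R) lc_c).
  by exists u; split=> // x r; rewrite uR /u0 ?valK//; exact: fsvalP.
have rel_inj : injective rel.
  move=> [r i] [r' i'] /(congr1 (fun x => subgroup_val x)).
  rewrite !subgroup_mkK /= => e.
  have [u [uN uR]] := prescribe (fun y => if y == (r, i) then 1%R else 0%R).
  have := uR (t i) r; have := uR (t i') r'; rewrite !ct eqxx e => ->.
  by case: eqP => [->|_ /eqP]//; rewrite eq_sym oner_eq0.
have ind : independent_relators p (subgroup_relators fM fK sH t).
  move=> b; have [u [uN uR]] := prescribe (b \o rel).
  have NKE (x : subgroup_type (subgroup_preimage fM sH)) :=
    subgroup_closure Ff fq fK oH cE ct x.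
  exists (fun x => u (subgroup_val x)); split.
  - split=> [x y /NKE Nx /NKE Ny|]; first by rewrite -(hom_onM uN).
    have n1 : nbhs (subgroup_val (1 : subgroup_type (subgroup_preimage fM sH)))
        (fun v => N v -> u v = 0%R) by case: uN.
    have n2 : \forall x \near (1 : subgroup_type (subgroup_preimage fM sH)),
        N (subgroup_val x) -> u (subgroup_val x) = 0%R.
      exact: (subgroup_val_continuous n1).
    by apply: filterS n2 => x ux /NKE; exact: ux.
  - move=> k x /NKE Nx; set h := subgroup_val k.
    have Kh : H (f h) by exact: (subgroup_valP k).
    rewrite (homJ (@subgroup_val_hom _ _ _)) -/h.
    apply/subr0_eq; move: (subgroup_val x) Nx.
    have NJ y : N y -> N (y ^ h) by case: nN => _; apply.
    (* Right multiplication by [h], which lies over [H], preserves cosets, so the difference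
       vanishes on conjugates of relators and hence on [N]. *)
    have vN : hom_on N (fun y => u (y ^ h)%g - u y)%R.
      apply: hom_onB => //; split=> [y z Ny Nz|].
        by rewrite conjMg (hom_onM uN (NJ _ Ny) (NJ _ Nz)).
      have cc : continuous (fun y => y ^ h).
        move=> y; apply: (@continuous_comp _ _ _ (fun y => y * h) (fun y => h^-1 * y)).
          exact: mulr_continuous.
        exact: mull_continuous.
      have n1 : nbhs (1 ^ h) (fun v => N v -> u v = 0%R).
        by rewrite conj1g; case: uN.
      have n2 : \forall y \near (1 : F), N (y ^ h) -> u (y ^ h) = 0%R.
        exact: (cc 1 _ n1).
      by apply: filterS n2 => y uy Ny; apply: uy; exact: NJ.
    apply: (hom_on_closure_eq0 vN) => g r /= rR.
    rewrite -conjgM (uR (g * h) [` rR]%fset) (uR g [` rR]%fset) fM.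
    suff -> : c (f g * f h) = c (f g) by rewrite subrr.
    by apply/esym/cE; rewrite mulKg.
  - by move=> _ /subgroup_relatorsP[[r i] ->]; rewrite subgroup_mkK uR ct.
have Hp : pro_p p (subgroup_type sH).
  by apply: subgroup_pro_p => //; exact: open_subgroup_closed.
rewrite (deficiency_independent p_prime Hp pY ind) deficiencyG.
by rewrite (card_subgroup_relators rel_inj); exact: euler_identity.
Qed.

(** An independent subset of the transversal relators computes the deficiency of the subgroup; the
    Euler identity forces its size to be the largest possible, so nothing was dropped and no two
    relators coincide. Their independence over the preimage of [U] is the required prescription of
    values. *)
Lemma deficiency_free_relators :
  (forall (H : set G) (sH : subgroup_set H), open H -> normal_set H ->
    (deficiency p (subgroup_type sH) - 1 =
       (group_index H)%:Z * (deficiency p G - 1))%R) ->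
  free_relators p f R.
Proof.
move=> euler U r0 x0 oU nU r0R; have sU := nU.1.
have [cN nN RN] := closed_normal_closureP [set` R].
have [c [c_surj cE]] := coset_space cG sU oU.
have [s sE] := choice c_surj.
have [t' t'E] := choice f_surj.
pose t i := t' (s i).
have ct i : c (f (t i)) = i by rewrite /t t'E sE.
have [Y [j [pY cardY]]] :=
  open_subgroup_presentation p_prime Ff fM f_surj fq fK sU oU cE ct.
pose sK := subgroup_preimage fM sU.
set RK := subgroup_relators fM fK sU t in pY.
have Up : pro_p p (subgroup_type sU).
  by apply: subgroup_pro_p => //; exact: open_subgroup_closed.
have [Fp _] := Ff.
have cK : closed (f @^-1` U).
  by apply: open_subgroup_closed => //; exact/fq.
have Kp : pro_p p (subgroup_type sK) by exact: subgroup_pro_p.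
have [R1 [R1K cR1 ind1]] := independent_subset RK p_prime Kp.
have pR1 : presentation p (subgroup_type sU) j R1.
  by case: pY => Fj [g [gM gs gq gK]]; split=> //; exists g; rewrite cR1.
have := euler U sU oU nU; rewrite (deficiency_independent p_prime Up pR1 ind1) deficiencyG.
rewrite -(euler_identity _ cardY) => /addIr/addrI/oppr_inj[cardR1].
have leRK : (#|` RK| <= #|` R| * group_index U)%N := card_subgroup_relators_le fM fK sU t.
have R1E : R1 = RK by apply/eqP; rewrite eqEfcard R1K cardR1.
rewrite R1E in ind1 cardR1.
have rel_inj := card_subgroup_relators_inj cardR1.
pose rel := subgroup_relator fM fK sU t.
pose i0 := c (f x0).
have [u [uN uJ uR]] := ind1
  (fun y => if y == rel ([` r0R]%fset, i0) then 1%R else 0%R).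
have NKE (x : subgroup_type sK) := subgroup_closure Ff fq fK oU cE ct x.
have NK x : N x -> U (f x) by move=> /NE ->; have [] := sU.
pose ext (x : F) : 'F_p :=
  if pselect (U (f x)) is left Kx then u (subgroup_mk sK Kx) else 0%R.
have extE x (Kx : U (f x)) : ext x = u (subgroup_mk sK Kx).
  rewrite /ext; case: pselect => // Kx'; congr u; exact: subgroup_val_inj.
exists ext; split.
  split=> [x y Nx Ny|].
    have Kx := NK _ Nx; have Ky := NK _ Ny.
    have Nxy : N (x * y) by apply/NE; rewrite fM (iffLR (NE x) Nx) (iffLR (NE y) Ny) mulg1.
    have Kxy := NK _ Nxy.
    rewrite !extE -(hom_onM uN) ?NKE//; congr u; exact: subgroup_val_inj.
  have [_ /subgroup_nbhs[O O1 Ou]] := uN.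
  apply: filterS O1 => v Ov Nv; rewrite extE; first exact: NK.
  by move=> Kv; apply: Ou => //; apply/NKE.
move=> x r rR.
have Kk : U (f ((t (c (f x)))^-1 * x)) by rewrite fM (homV fM); apply/cE; rewrite ct.
have Nrx : N (r ^ x) by apply/normal_conj_set => //; exact: RN.
rewrite (extE _ (NK _ Nrx)).
have -> : subgroup_mk sK (NK _ Nrx) =
    rel ([` rR]%fset, c (f x)) ^ subgroup_mk sK Kk.
  apply: subgroup_val_inj; rewrite (homJ (@subgroup_val_hom _ _ _)) !subgroup_mkK.
  by rewrite -conjgM mulVKg.
have relK : rel ([` rR]%fset, c (f x)) \in RK by apply/subgroup_relatorsP; eexists.
rewrite uJ; last by have [_ _] := closed_normal_closureP [set` RK]; apply.
rewrite uR// (inj_eq rel_inj) xpair_eqE -val_eqE /=; congr (if _ && _ then _ else _).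
apply/eqP/asboolP => [e|/cE ->//].
by apply/cE; rewrite e.
Qed.

End EulerCharacteristic.

(** * Cohomological dimension *)

Section Subzmod.
Local Open Scope ring_scope.

Definition zmod_set (A : zmodType) (S : set A) : Prop :=
  S 0 /\ forall a b, S a -> S b -> S (a - b).

Definition subzmod (A : zmodType) (S : set A) (hS : zmod_set S) : Type :=
  set_type S.

Variables (A : zmodType) (S : set A) (hS : zmod_set S).
Local Notation T := (subzmod hS).
HB.instance Definition _ := SubChoice.copy T (set_type S).

Fact subzmod_closed : zmod_closed (fun a : A => a \in S).
Proof.
case: hS => S0 SB; split=> [|a b aS bS]; first exact/mem_set.
by apply/mem_set/SB; exact/set_mem.
Qed.
HB.instance Definition _ :=
  GRing.SubChoice_isSubZmodule.Build A (fun a : A => a \in S) T subzmod_closed.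

Definition subzmod_val (a : T) : A := val a.
Definition subzmod_mk (a : A) (Sa : S a) : T := SigSub (mem_set Sa).

Lemma subzmod_mkK (a : A) (Sa : S a) : subzmod_val (subzmod_mk Sa) = a.
Proof. by []. Qed.
Lemma subzmod_valP (a : T) : S (subzmod_val a). Proof. exact: set_valP. Qed.
Lemma subzmod_val_inj : injective subzmod_val. Proof. exact: val_inj. Qed.
Lemma subzmod_valD (a b : T) : subzmod_val (a + b) = subzmod_val a + subzmod_val b.
Proof. by []. Qed.
Lemma subzmod_valN (a : T) : subzmod_val (- a) = - subzmod_val a.
Proof. by []. Qed.
Lemma subzmod_val0 : subzmod_val (0 : T) = 0.
Proof. by []. Qed.
Lemma subzmod_valMn (a : T) n : subzmod_val (a *+ n) = subzmod_val a *+ n.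
Proof. by elim: n => [|n IH]; rewrite ?mulr0n// !mulrS subzmod_valD IH. Qed.
Lemma subzmod_valMz (a : T) n : subzmod_val (a *~ n) = subzmod_val a *~ n.
Proof. by case: n => n; rewrite ?NegzE ?mulrNz -?pmulrn ?subzmod_valN subzmod_valMn. Qed.
Lemma subzmod_val_sum I (r : seq I) (P : pred I) (E : I -> T) :
  subzmod_val (\sum_(i <- r | P i) E i) = \sum_(i <- r | P i) subzmod_val (E i).
Proof. exact: (big_morph subzmod_val subzmod_valD subzmod_val0). Qed.

Variables (G : topGroupType) (act : G -> A -> A).
Hypothesis actS : forall g a, S a -> S (act g a).

Definition subzmod_act (g : G) (a : T) : T := subzmod_mk (actS g (subzmod_valP a)).

Lemma subzmod_actE g a : subzmod_val (subzmod_act g a) = act g (subzmod_val a).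
Proof. by []. Qed.

Lemma lc_subzmod (U : topologicalType) (u : U -> T) :
  locally_constant (fun x => subzmod_val (u x)) -> locally_constant u.
Proof. by move=> lu x; apply: filterS (lu x) => y /subzmod_val_inj. Qed.

Lemma subzmod_smooth : smooth_module act -> smooth_module subzmod_act.
Proof.
move=> sA; split=> [a|g h a|g a b|a].
- by apply: subzmod_val_inj; rewrite subzmod_actE (smod1 sA).
- by apply: subzmod_val_inj; rewrite !subzmod_actE (smodM sA).
- by apply: subzmod_val_inj; rewrite subzmod_valD !subzmod_actE -(smodD sA).
- by apply: lc_subzmod; exact: smod_lc.
Qed.

End Subzmod.

(** * Homogeneous cochains and dimension shifting *)

Section Cochains.
Local Open Scope ring_scope.

Definition fcons (T : Type) n (y : T) (x : 'I_n -> T) : 'I_n.+1 -> T :=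
  fun i => if unlift ord0 i is Some j then x j else y.

Lemma fcons0 (T : Type) n (y : T) (x : 'I_n -> T) : fcons y x ord0 = y.
Proof. by rewrite /fcons unlift_none. Qed.

Lemma fconsS (T : Type) n (y : T) (x : 'I_n -> T) j : fcons y x (lift ord0 j) = x j.
Proof. by rewrite /fcons liftK. Qed.

Lemma fcons_eta (T : Type) n (v : 'I_n.+1 -> T) :
  v = fcons (v ord0) (fun j => v (lift ord0 j)).
Proof. by apply/funext => i; case: (unliftP ord0 i) => [j|] ->; rewrite ?fconsS ?fcons0. Qed.

Lemma fcons_lift (T : Type) n (y : T) (x : 'I_n.+1 -> T) i :
  (fun j => fcons y x (lift (lift ord0 i) j)) = fcons y (fun j => x (lift i j)).
Proof.
apply/funext => j; case: (unliftP ord0 j) => [k|] ->.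
  have -> : lift (lift ord0 i) (lift ord0 k) = lift ord0 (lift i k).
    by apply: val_inj; rewrite /= /bump !leq0n !add1n ltnS addnS.
  by rewrite !fconsS.
have -> : lift (lift ord0 i) ord0 = ord0 by exact: val_inj.
by rewrite !fcons0.
Qed.

Lemma fcons_map (T U : Type) n (h : T -> U) (y : T) (x : 'I_n -> T) :
  (fun i => h (fcons y x i)) = fcons (h y) (fun i => h (x i)).
Proof. by apply/funext => i; case: (unliftP ord0 i) => [j|] ->; rewrite ?fconsS ?fcons0. Qed.

Variables (G : topGroupType).
Implicit Types A : zmodType.

(** Peeling off the first argument turns the alternating sum into a recursion, on which the later
    computations with [codiff] rest. *)
Lemma codiff_fcons A q (f : ('I_q.+2 -> G) -> A) y x :
  codiff f (fcons y x) = f x - codiff (fun w => f (fcons y w)) x.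
Proof.
rewrite /codiff big_ord_recl /= expr0; congr (_ + _).
  by rewrite mulr1z; congr f; apply/funext => j; rewrite fconsS.
rewrite -sumrN; apply: eq_bigr => i _.
by rewrite fcons_lift /= /bump leq0n add1n exprS mulN1r mulrNz.
Qed.

Lemma codiffB A q (f g : ('I_q.+1 -> G) -> A) x :
  codiff (fun w => f w - g w) x = codiff f x - codiff g x.
Proof. by rewrite /codiff -sumrB; apply: eq_bigr => i _; rewrite mulrzBl. Qed.

Lemma codiffMn A q (f : ('I_q.+1 -> G) -> A) n x :
  codiff (fun w => f w *+ n) x = codiff f x *+ n.
Proof. by rewrite /codiff -sumrMnl; apply: eq_bigr => i _; rewrite !pmulrn mulrzAC. Qed.

Lemma codiff0E A (f : ('I_1 -> G) -> A) y x :
  codiff f (fcons y x) = f x - f (fun=> y).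
Proof.
rewrite /codiff big_ord_recl big_ord_recl big_ord0 addr0 /=.
rewrite expr0 mulr1z mulrN1z; congr (_ - _).
  by congr f; apply/funext => j; rewrite fconsS.
congr f; apply/funext => j; rewrite (ord1 j).
have -> : lift (lift ord0 ord0) (ord0 : 'I_1) = ord0 :> 'I_2 by exact: val_inj.
by rewrite fcons0.
Qed.

Lemma codiffK A q (f : ('I_q.+1 -> G) -> A) x : codiff (codiff f) x = 0.
Proof.
elim: q f x => [|q IH] f x.
  rewrite (fcons_eta x) codiff_fcons.
  set y := x ord0; set w := fun j => x _.
  rewrite (fcons_eta w) codiff0E.
  have -> : (fun w => codiff f (fcons y w)) = (fun w => f w - f (fun=> y)).
    by apply/funext => v; exact: codiff0E.
  rewrite codiff0E; zmod.
rewrite (fcons_eta x) codiff_fcons.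
set y := x ord0; set w := fun j => x _.
have -> : (fun w => codiff f (fcons y w)) =
    (fun w => f w - codiff (fun w => f (fcons y w)) w).
  by apply/funext => v; exact: codiff_fcons.
by rewrite codiffB IH subr0 subrr.
Qed.

Lemma ptws_compact n : compact [set: G] -> compact [set: {ptws 'I_n -> G}].
Proof.
move=> cG; have := @tychonoff 'I_n (fun=> G) (fun=> setT) (fun=> cG).
by rewrite (_ : [set f | _] = setT)//; apply/seteqP; split.
Qed.

Lemma cochainP A (act : G -> A -> A) q (f : ('I_q.+1 -> G) -> A) :
  cochain act f <-> @locally_constant {ptws 'I_q.+1 -> G} A f /\
    forall g x, f (fun i => g * x i)%g = act g (f x).
Proof. by split=> -[fc fM]; split=> //; exact/(@lcP {ptws 'I_q.+1 -> G} A f). Qed.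

Lemma fcons_continuous (U : topologicalType) n (y : U -> G) (x : U -> 'I_n -> G) :
  continuous y -> (forall i, continuous (fun u => x u i)) ->
  continuous (fun u => fcons (y u) (x u) : {ptws 'I_n.+1 -> G}).
Proof.
move=> yc xc; apply: ptws_continuous => i.
case: (unliftP ord0 i) => [j|] ->.
  have -> : (fun u => fcons (y u) (x u) (lift ord0 j)) = (fun u => x u j).
    by apply/funext => u; rewrite fconsS.
  exact: xc.
have -> : (fun u => fcons (y u) (x u) ord0) = y by apply/funext => u; rewrite fcons0.
exact: yc.
Qed.

End Cochains.

Lemma lc_sum (T : topologicalType) (A : zmodType) n (u : 'I_n -> T -> A) :
  (forall i, locally_constant (u i)) ->
  locally_constant (fun x => \sum_(i < n) u i x)%R.
Proof.
move=> lu x.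
have nx : \forall y \near x, forall i, u i y = u i x.
  by apply: filter_forall => i; exact: lu.
by apply: filterS nx => y uy; apply: eq_bigr => i _.
Qed.

Lemma pair_continuous (T U V : topologicalType) (f : T -> U) (g : T -> V) :
  continuous f -> continuous g -> continuous (fun x => (f x, g x)).
Proof. by move=> fc gc x; exact: (cvg_pair (fc x) (gc x)). Qed.

(* The cokernel [C(G, A) / A] of the coinduced module is realized as the module of
   continuous functions [u] with [u (y, y') + u (y', y'') = u (y, y'')], the class
   of [h] being [(y, y') |-> h y - h y'].  As [C(G, A)] is acyclic, a cocycle with
   values in [A] shifts to one of degree one less with values in this module. *)
Section DimensionShift.
Local Open Scope ring_scope.
Variables (G : topGroupType) (A : zmodType) (act : G -> A -> A).
Hypotheses (cG : compact [set: G]) (sA : smooth_module act).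

Definition difference_function : set (G * G -> A) := [set u |
  locally_constant u /\ forall y y' y'', u (y, y') + u (y', y'') = u (y, y'')].

Lemma difference_function_zmod : zmod_set difference_function.
Proof.
split=> [|u v [lu uD] [lv vD]].
  by split=> [|y y' y'']; [exact: lc_cst|exact: addr0].
split=> [|y y' y'']; first exact: (lc_post2 (fun a b => a - b) lu lv).
change (u (y, y') - v (y, y') + (u (y', y'') - v (y', y'')) = u (y, y'') - v (y, y'')).
by rewrite -(uD y y' y'') -(vD y y' y''); zmod.
Qed.

Definition difference_module : zmodType := subzmod difference_function_zmod.
Local Notation B := difference_module.

Definition difference_raw_act (g : G) (u : G * G -> A) (y : G * G) : A :=
  act g (u (g^-1 * y.1, g^-1 * y.2)%g).

Lemma difference_raw_act_closed g u :
  difference_function u -> difference_function (difference_raw_act g u).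
Proof.
move=> [lu uD]; split=> [|y y' y'']; last by rewrite -(smodD sA) uD.
apply: (lc_act sA); first by move=> y; exact: cvg_cst.
apply: (lc_comp lu) => y; apply: cvg_pair.
  apply: (@continuous_comp _ _ _ fst (fun x => g^-1 * x)%g); first exact: cvg_fst.
  exact: mull_continuous.
apply: (@continuous_comp _ _ _ snd (fun x => g^-1 * x)%g); first exact: cvg_snd.
exact: mull_continuous.
Qed.

Definition difference_act : G -> B -> B :=
  subzmod_act (hS := difference_function_zmod) difference_raw_act_closed.

Definition difference (u : B) (y y' : G) : A := subzmod_val u (y, y').

Lemma difference_actE g u y y' :
  difference (difference_act g u) y y' = act g (difference u (g^-1 * y) (g^-1 * y'))%g.
Proof. by []. Qed.

Lemma difference_actJ g u y y' :
  difference (difference_act g u) (g * y)%g (g * y')%g = act g (difference u y y').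
Proof. by rewrite difference_actE !mulKg. Qed.

Lemma difference_ext (u v : B) : (forall y y', difference u y y' = difference v y y') -> u = v.
Proof. by move=> uv; apply: subzmod_val_inj; apply/funext => -[y y']; exact: uv. Qed.

Lemma differenceD (u : B) y y' y'' : difference u y y' + difference u y' y'' = difference u y y''.
Proof. by have [_ uD] := subzmod_valP u; exact: uD. Qed.

Lemma difference_lc (u : B) : locally_constant (subzmod_val u).
Proof. by have [lu _] := subzmod_valP u. Qed.

Lemma difference_Mn (u : B) n y y' : difference (u *+ n) y y' = difference u y y' *+ n.
Proof. by elim: n => [|n IH]; rewrite ?mulr0n// !mulrS -IH. Qed.

Lemma difference_Mz (u : B) n y y' : difference (u *~ n) y y' = difference u y y' *~ n.
Proof.
case: n => n; first by rewrite -!pmulrn difference_Mn.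
by rewrite NegzE !mulrNz -!pmulrn -difference_Mn.
Qed.

Lemma difference_codiff q (k : ('I_q.+1 -> G) -> B) x y y' :
  difference (codiff k x) y y' = codiff (fun w => difference (k w) y y') x.
Proof.
rewrite /codiff (big_morph (fun u => difference u y y') (id1 := 0) (op1 := +%R))//.
by apply: eq_bigr => i _; rewrite difference_Mz.
Qed.

Lemma difference_smooth : smooth_module difference_act.
Proof.
split=> [u|g h u|g u v|u].
- by apply: difference_ext => y y'; rewrite difference_actE invg1 !mul1g (smod1 sA).
- apply: difference_ext => y y'.
  by rewrite !difference_actE (smodM sA) invMg !mulgA.
- by apply: difference_ext => y y'; rewrite difference_actE (smodD sA).
- apply: lc_subzmod; apply: (lc_uncurry (compact_setXT cG cG)).
  have c1 : continuous (fst : G * (G * G) -> G) by move=> x; exact: cvg_fst.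
  have c2 : continuous (snd : G * (G * G) -> G * G) by move=> x; exact: cvg_snd.
  apply: (lc_act sA) => //; apply: (lc_comp (@difference_lc u)) => x; apply: cvg_pair.
    apply: (@mul_continuous _ _ (fun x => x.1^-1)%g (fun x => x.2.1)).
      exact: inv_continuous.
    by move=> z; apply: (@continuous_comp _ _ _ snd fst); [exact: c2|exact: cvg_fst].
  apply: (@mul_continuous _ _ (fun x => x.1^-1)%g (fun x => x.2.2)).
    exact: inv_continuous.
  by move=> z; apply: (@continuous_comp _ _ _ snd snd); [exact: c2|exact: cvg_snd].
Qed.

Section Shift.
Variables (q : nat) (f : ('I_q.+3 -> G) -> A).
Hypothesis f_cocycle : cocycle act f.

Let f_lc : @locally_constant {ptws 'I_q.+3 -> G} A f.
Proof. by case: f_cocycle => /cochainP[]. Qed.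

Let fM g x : f (fun i => g * x i)%g = act g (f x).
Proof. by case: f_cocycle => /cochainP[]. Qed.

Let f0 x : codiff f x = 0. Proof. by case: f_cocycle. Qed.

Let shift_raw (x : 'I_q.+2 -> G) (y : G * G) : A := f (fcons y.1 x) - f (fcons y.2 x).

Let shift_raw_lc : locally_constant
  (fun z : {ptws 'I_q.+2 -> G} * (G * G) => shift_raw z.1 z.2).
Proof.
have c1 : continuous (fst : {ptws 'I_q.+2 -> G} * (G * G) -> {ptws 'I_q.+2 -> G}).
  by move=> x; exact: cvg_fst.
have c2 : continuous (snd : {ptws 'I_q.+2 -> G} * (G * G) -> G * G).
  by move=> x; exact: cvg_snd.
have cx (i : 'I_q.+2) : continuous (fun z : {ptws 'I_q.+2 -> G} * (G * G) => z.1 i).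
  move=> z; apply: (@continuous_comp _ _ _ fst (fun x : {ptws 'I_q.+2 -> G} => x i)).
    exact: c1.
  exact: ptws_eval_continuous.
have lf (h : G * G -> G) : continuous h -> locally_constant
    (fun z : {ptws 'I_q.+2 -> G} * (G * G) => f (fcons (h z.2) z.1)).
  move=> hc; apply: (@lc_comp _ {ptws 'I_q.+3 -> G} _ f
    (fun z : {ptws 'I_q.+2 -> G} * (G * G) => fcons (h z.2) z.1)) => //.
  apply: fcons_continuous => // z.
  by apply: (@continuous_comp _ _ _ snd h); [exact: c2|exact: hc].
by apply: (lc_post2 (fun a b => a - b)); apply: lf => y; [exact: cvg_fst|exact: cvg_snd].
Qed.

Let shift_closed x : difference_function (shift_raw x).
Proof.
split=> [|y y' y'']; last by rewrite /shift_raw /=; zmod.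
apply: (@lc_comp _ ({ptws 'I_q.+2 -> G} * (G * G))%type _ _
  (fun y : G * G => (x, y)) shift_raw_lc).
apply: (@pair_continuous _ {ptws 'I_q.+2 -> G}); first exact: cst_continuous.
by move=> y; exact: cvg_id.
Qed.

Definition shift_cocycle (x : 'I_q.+2 -> G) : B := subzmod_mk _ (shift_closed x).

Lemma shift_cocycleE x y y' :
  difference (shift_cocycle x) y y' = f (fcons y x) - f (fcons y' x).
Proof. by []. Qed.

Lemma shift_cocycleP : cocycle difference_act shift_cocycle.
Proof.
split; last first.
  move=> x; apply: difference_ext => y y'; rewrite difference_codiff.
  under [X in codiff X]eq_fun do rewrite shift_cocycleE.
  have e z : codiff (fun w => f (fcons z w)) x = f x.
    by have := f0 (fcons z x); rewrite codiff_fcons => /eqP; rewrite subr_eq0 => /eqP.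
  by rewrite codiffB !e subrr.
apply/cochainP; split.
  apply: lc_subzmod; exact: (lc_uncurry (compact_setXT cG cG) shift_raw_lc).
move=> g x; apply: difference_ext => y y'.
rewrite difference_actE !shift_cocycleE (smodB sA) -!fM.
by rewrite !fcons_map !mulVKg.
Qed.

(** If [k] bounds the shifted cocycle, then $f(y,x)$ minus the coboundary of $w\mapsto k(w)(y,w_0)$
    is independent of [y]. This makes the cochain at [y = 1] equivariant; it bounds [f], since the
    subtracted term is itself a coboundary. *)
Lemma shift_coboundary : coboundary difference_act shift_cocycle -> coboundary act f.
Proof.
move=> [k /cochainP[k_lc kM] kE].
pose a y x := f (fcons y x) - codiff (fun w => difference (k w) y (w ord0)) x.
have a_indep y y' x : a y x = a y' x.
  apply/subr0_eq; have := congr1 (fun u => difference u y y') (kE x).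
  rewrite shift_cocycleE difference_codiff => e.
  have -> : a y x - a y' x = (f (fcons y x) - f (fcons y' x)) -
      (codiff (fun w => difference (k w) y (w ord0)) x
       - codiff (fun w => difference (k w) y' (w ord0)) x) by rewrite /a; zmod.
  rewrite e -codiffB; apply/eqP; rewrite subr_eq0; apply/eqP.
  congr (codiff _ x); apply/funext => w.
  by rewrite -(differenceD _ y y' (w ord0)) addrK.
exists (a 1%g).
  apply/cochainP; split.
    have lf : @locally_constant {ptws 'I_q.+2 -> G} _ (fun x => f (fcons 1%g x)).
      apply: (@lc_comp {ptws 'I_q.+2 -> G} {ptws 'I_q.+3 -> G} _ f (fcons 1%g)) => //.
      apply: fcons_continuous; first exact: cst_continuous.
      by move=> i; exact: ptws_eval_continuous.
    have lk : @locally_constant {ptws 'I_q.+1 -> G} _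
        (fun w => difference (k w) 1%g (w ord0)).
      move=> w; have l1 := k_lc w.
      have l2 : \forall w' \near (w : {ptws 'I_q.+1 -> G}),
          difference (k w) 1%g (w' ord0) = difference (k w) 1%g (w ord0).
        have pc : continuous (fun w' : {ptws 'I_q.+1 -> G} => (1%g : G, w' ord0)).
          apply: pair_continuous; first exact: cst_continuous.
          exact: ptws_eval_continuous.
        exact: (@lc_comp {ptws 'I_q.+1 -> G} _ _ _ _ (@difference_lc (k w)) pc w).
      by apply: filterS2 l1 l2 => w' -> ->.
    have lc : @locally_constant {ptws 'I_q.+2 -> G} _
        (codiff (fun w => difference (k w) 1%g (w ord0))).
      apply: (@lc_sum {ptws 'I_q.+2 -> G} A q.+2 (fun i x =>
        difference (k (fun j => x (lift i j))) 1%g (x (lift i ord0)) *~ (-1) ^+ i)) => i.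
      apply: (@lc_post {ptws 'I_q.+2 -> G} _ _ _ (fun b => b *~ (-1) ^+ i)).
      apply: (@lc_comp {ptws 'I_q.+2 -> G} {ptws 'I_q.+1 -> G} _ _
        (fun x j => x (lift i j)) lk).
      by apply: ptws_continuous => j; exact: ptws_eval_continuous.
    exact: (@lc_post2 {ptws 'I_q.+2 -> G} _ _ _ _ _ (fun a b => a - b) lf lc).
  move=> g x; rewrite (a_indep 1%g g) /a (smodB sA) -fM fcons_map mulg1.
  congr (_ - _); rewrite /codiff (smod_sum sA); apply: eq_bigr => i _.
  by rewrite (smodMz sA) -difference_actJ mulg1 -kM.
move=> x; rewrite /a codiffB codiffK subr0.
by have := f0 (fcons 1%g x); rewrite codiff_fcons => /eqP; rewrite subr_eq0 => /eqP.
Qed.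

End Shift.
End DimensionShift.

(** A substitute for a continuous section of $F\to F/N$. Choose [W] with [t] zero on $N\cap W$ and
    let [b] pick representatives modulo $NW$; if $xb(x)^{-1}$ is [n] in [N] times an element of [W],
    then $t(n)$ depends only on [x]. *)
Lemma hom_on_extension p (F : topGroupType) (N : set F) (A : zmodType) (t : F -> A) :
  pro_p p F -> normal_set N -> hom_on N t ->
  exists h : F -> A, locally_constant h /\
    forall n x, N n -> (h (n * x)%g = t n + h x)%R.
Proof.
move=> Fp nN tN; have [W [oW nW Wt]] := pro_p_basis Fp tN.2.
have [[N1 NM NV] NJ] := nN; have [[W1 WM WV] WJ] := nW.
have cF : compact [set: F] by case: Fp.
pose M := [set x : F | exists2 n, N n & W (n^-1 * x)].
have NM' n : N n -> M n by move=> Nn; exists n; rewrite ?mulVg.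
have WM' w : W w -> M w by move=> Ww; exists 1; rewrite ?invg1 ?mul1g.
have MM x y : M x -> M y -> M (x * y).
  move=> [n Nn Wx] [n' Nn' Wy]; exists (n * n'); first exact: NM.
  have := WM _ _ (WJ n' _ Wx) Wy; congr W.
  by rewrite conjgE invMg !mulgA mulgK.
have MV x : M x -> M x^-1.
  move=> [n Nn Wx]; exists (n^-1); first exact: NV.
  have := WJ n^-1 _ (WV _ Wx); congr W.
  by rewrite conjgE !invMg !invgK !mulgA mulgK.
have M1 : M 1 by exact: NM'.
have sM : subgroup_set M by [].
have oM : open M.
  apply: subgroup_open => //; have W1n : nbhs 1 W by exact: open_nbhs_nbhs.
  by apply: filterS W1n => w; exact: WM'.
have [c [c_surj cE]] := coset_space cF sM oM.
have [s sE] := choice c_surj.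
pose b x := (s (c x^-1))^-1.
have bE x y : M (x * y^-1) -> b x = b y.
  by move=> Mxy; congr (s _)^-1; apply/cE; rewrite invgK.
have Mb x : M (x * (b x)^-1).
  by rewrite /b invgK -{1}(invgK x); apply/cE; rewrite sE.
have [n nP] := choice (fun x => let: ex_intro2 n Nn Wn := Mb x in
  ex_intro (fun n => N n /\ W (n^-1 * (x * (b x)^-1))) n (conj Nn Wn)).
have t_eq m m' y : N m -> N m' -> W (m^-1 * y) -> W (m'^-1 * y) -> t m = t m'.
  move=> Nm Nm' Wm Wm'.
  have Wmm : W (m^-1 * m').
    by have := WM _ _ Wm (WV _ Wm'); rewrite invMg invgK mulgA mulgK.
  have Nmm : N (m^-1 * m') by apply: NM => //; exact: NV.
  by rewrite -(mulVKg m m') (hom_onM tN)// (Wt _ Wmm Nmm) addr0.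
exists (fun x => t (n x)); split=> [x|m x Nm].
  have W1n : nbhs 1 W by exact: open_nbhs_nbhs.
  apply: filterS (near_mulr x W1n) => y Wyx.
  have bxy : b y = b x by apply: bE; exact: WM'.
  have [Ny Wy] := nP y; have [Nx Wx] := nP x.
  apply: (t_eq _ _ (x * (b x)^-1)) => //.
  have := WM _ _ (WJ (n y) _ (WV _ Wyx)) Wy; congr W.
  by rewrite bxy conjgE invMg invgK !mulgA mulgK mulgVK.
have [Nx Wx] := nP x; have [Nmx Wmx] := nP (m * x).
have bmx : b (m * x) = b x by apply: bE; rewrite mulgK; exact: NM'.
rewrite bmx in Wmx.
rewrite -(mulVKg m (n (m * x))) (hom_onM tN)//; last by apply: NM => //; exact: NV.
congr (_ + _)%R; apply: (t_eq _ _ (x * (b x)^-1)) => //.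
  by apply: NM => //; exact: NV.
by rewrite invMg invgK !mulgA; rewrite !mulgA in Wmx.
Qed.

Lemma hom_on_conj (F : topGroupType) (N : set F) (A : zmodType) (t : F -> A) g :
  normal_set N -> hom_on N t -> hom_on N (fun x => t (x ^ g)).
Proof.
move=> nN tN; have NJ x : N x -> N (x ^ g) by case: nN => _; apply.
split=> [y z Ny Nz|]; first by rewrite conjMg (hom_onM tN (NJ _ Ny) (NJ _ Nz)).
have cc : continuous (fun y => y ^ g).
  move=> y; apply: (@continuous_comp _ _ _ (fun y => y * g) (fun y => g^-1 * y)).
    exact: mulr_continuous.
  exact: mull_continuous.
have n1 : nbhs (1 ^ g) (fun v => N v -> t v = 0%R) by rewrite conj1g; case: tN.
have n2 : \forall y \near (1 : F), N (y ^ g) -> t (y ^ g) = 0%R by exact: (cc 1 _ n1).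
by apply: filterS n2 => y uy Ny; apply: uy; exact: NJ.
Qed.

Lemma smooth_comp (F G : topGroupType) (f : F -> G) (A : zmodType)
    (act : G -> A -> A) :
  is_hom f -> continuous f -> smooth_module act -> smooth_module (fun x => act (f x)).
Proof.
move=> fM fc sA; split=> [a|g h a|g a b|a].
- by rewrite (hom1 fM) (smod1 sA).
- by rewrite fM (smodM sA).
- exact: smodD.
- exact: (lc_comp (smod_lc sA a) fc).
Qed.

Lemma quotient_nbhs (F G : topGroupType) (f : F -> G) x (V : set F) :
  is_hom f -> (forall U : set G, open U <-> open (f @^-1` U)) ->
  nbhs x V -> nbhs (f x) (f @` V).
Proof.
move=> fM fq; rewrite nbhsE => -[O [oO Ox] OV].
have : open (f @` O).
  apply/fq; rewrite openE => y /= [z Oz fzy].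
  have Oz' : nbhs z O by exact: open_nbhs_nbhs.
  have nz : \forall u \near (1 : F), O (u * z) by exact: nbhs_mulr.
  apply: filterS (near_mulr y nz) => u Ou; exists (u * y^-1 * z) => //.
  by rewrite !fM fzy -!fM mulgVK.
move=> oO'; have : nbhs (f x) (f @` O) by apply: open_nbhs_nbhs; split=> //; exists x.
by apply: filterS; exact: image_subset.
Qed.

Lemma lc_quotient2 (F G : topGroupType) (f : F -> G) (A : Type) (a : G -> G -> A) :
  is_hom f -> (forall g, exists x, f x = g) ->
  (forall U : set G, open U <-> open (f @^-1` U)) ->
  locally_constant (fun x : F * F => a (f x.1) (f x.2)) ->
  locally_constant (fun x : G * G => a x.1 x.2).
Proof.
move=> fM fs fq la [g h]; have [x <-] := fs g; have [y <-] := fs h.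
have [[V W] /= [Vx Wy] VW] := la (x, y).
exists (f @` V, f @` W); first by split=> /=; exact: quotient_nbhs.
by move=> _ /= [[x' Vx' <-] [y' Wy' <-]]; exact: (VW (x', y')).
Qed.

Section Tuples.
Variables (G : topGroupType) (A : zmodType).

Definition tup3 (a b c : G) : 'I_3 -> G := fcons a (fcons b (fun=> c)).
Definition tup4 (a b c d : G) : 'I_4 -> G := fcons a (tup3 b c d).
Definition tup5 (a b c d e : G) : 'I_5 -> G := fcons a (tup4 b c d e).

Lemma tup4_eta (v : 'I_4 -> G) : exists a b c d, v = tup4 a b c d.
Proof.
pose w (j : 'I_3) := v (lift ord0 j); pose u (j : 'I_2) := w (lift ord0 j).
exists (v ord0), (w ord0), (u ord0), (u (lift ord0 ord0)).
rewrite [LHS](fcons_eta v); congr (fcons _ _); rewrite [LHS](fcons_eta w).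
congr (fcons _ _); rewrite [LHS](fcons_eta u); congr (fcons _ _).
by apply/funext => i; rewrite (ord1 i).
Qed.

Lemma tup3M g a b c : (fun i => g * tup3 a b c i)%g = tup3 (g * a) (g * b) (g * c).
Proof. by rewrite /tup3 !fcons_map. Qed.

Lemma tup4M g a b c d :
  (fun i => g * tup4 a b c d i)%g = tup4 (g * a) (g * b) (g * c) (g * d).
Proof. by rewrite /tup4 /tup3 !fcons_map. Qed.

Lemma codiff_tup4 (f : ('I_3 -> G) -> A) a b c d : codiff f (tup4 a b c d) =
  (f (tup3 b c d) - (f (tup3 a c d) - (f (tup3 a b d) - f (tup3 a b c))))%R.
Proof. by rewrite /tup4 codiff_fcons /tup3 codiff_fcons codiff0E. Qed.

Lemma codiff_tup5 (f : ('I_4 -> G) -> A) a b c d e : codiff f (tup5 a b c d e) =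
  (f (tup4 b c d e) - (f (tup4 a c d e) -
    (f (tup4 a b d e) - (f (tup4 a b c e) - f (tup4 a b c d)))))%R.
Proof. by rewrite /tup5 codiff_fcons /tup4 codiff_tup4. Qed.

Lemma tup3_continuous (U : topologicalType) (a b c : U -> G) : continuous a ->
  continuous b -> continuous c ->
  continuous (fun u => tup3 (a u) (b u) (c u) : {ptws 'I_3 -> G}).
Proof.
move=> ac bc cc; apply: fcons_continuous => // i.
have bcc := @fcons_continuous G U 1 b (fun u _ => c u) bc (fun=> cc).
move=> u; apply: (@continuous_comp _ _ _ (fun u => fcons (b u) (fun=> c u) : {ptws 'I_2 -> G})
  (fun x : {ptws 'I_2 -> G} => x i)); first exact: bcc.
exact: ptws_eval_continuous.
Qed.

Lemma tup4_continuous (U : topologicalType) (a b c d : U -> G) : continuous a ->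
  continuous b -> continuous c -> continuous d ->
  continuous (fun u => tup4 (a u) (b u) (c u) (d u) : {ptws 'I_4 -> G}).
Proof.
move=> ac bc cc dc; apply: fcons_continuous => // i.
move=> u; apply: (@continuous_comp _ _ _ (fun u => tup3 (b u) (c u) (d u) : {ptws 'I_3 -> G})
  (fun x : {ptws 'I_3 -> G} => x i)); first exact: tup3_continuous.
exact: ptws_eval_continuous.
Qed.

End Tuples.

(** The usual passage from inhomogeneous to homogeneous 2-cochains. *)
Definition homogenize (G : topGroupType) (A : zmodType) (act : G -> A -> A)
    (a : G -> G -> A) (v : 'I_3 -> G) : A :=
  let v0 := v ord0 in let v1 := v (lift ord0 ord0) in
  let v2 := v (lift ord0 (lift ord0 ord0)) in
  act v0 (a (v0^-1 * v1) (v1^-1 * v2)).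

Lemma homogenize_tup3 (G : topGroupType) (A : zmodType) (act : G -> A -> A)
    (a : G -> G -> A) x y z :
  homogenize act a (tup3 x y z) = act x (a (x^-1 * y) (y^-1 * z)).
Proof. by rewrite /homogenize /tup3 !fcons0 !fconsS fcons0. Qed.

Lemma homogenize_cochain (G : topGroupType) (A : zmodType) (act : G -> A -> A)
    (a : G -> G -> A) : smooth_module act ->
  locally_constant (fun x : G * G => a x.1 x.2) -> cochain act (homogenize act a).
Proof.
move=> sA la; apply/cochainP; split; last first.
  by move=> g x; rewrite /homogenize (smodM sA) !invMg !mulgA !mulgVK.
have ev i : continuous (fun v : {ptws 'I_3 -> G} => v i) by exact: ptws_eval_continuous.
apply: (@lc_act G A act sA {ptws 'I_3 -> G}); first exact: ev.
have pc : continuous (fun v : {ptws 'I_3 -> G} =>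
    ((v ord0)^-1 * v (lift ord0 ord0),
     (v (lift ord0 ord0))^-1 * v (lift ord0 (lift ord0 ord0)))).
  by apply: pair_continuous; apply: mul_continuous => //; exact: inv_continuous.
exact: (@lc_comp {ptws 'I_3 -> G} _ _ _ _ la pc).
Qed.

Lemma lc_difference (U : topologicalType) (H : topGroupType) (A : zmodType)
    (w : U -> difference_module H A) (y y' : U -> H) :
  locally_constant w -> continuous y -> continuous y' ->
  locally_constant (fun u => difference (w u) (y u) (y' u)).
Proof.
move=> lw yc y'c u.
have l2 := lc_comp (difference_lc (w u)) (pair_continuous yc y'c) u.
by apply: filterS2 (lw u) l2 => v -> e; exact: e.
Qed.

(** * Vanishing of $H^3$ for coefficients killed by $p$ *)

Section ThirdCohomology.
Variables (p : nat) (G F : topGroupType) (X : finType) (iota : X -> F)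
  (R : {fset F}) (f : F -> G).
Hypotheses (p_prime : prime p) (Gp : pro_p p G) (Ff : free_pro_p p iota)
  (fM : is_hom f) (f_surj : forall g, exists x, f x = g)
  (fq : forall U : set G, open U <-> open (f @^-1` U))
  (fK : f @^-1` [set 1] = closed_normal_closure [set` R])
  (fR : free_relators p f R).

Local Notation N := (closed_normal_closure [set` R]).
Let NE x : N x <-> f x = 1. Proof. by rewrite -fK. Qed.
Let cG : compact [set: G]. Proof. by case: Gp. Qed.
Let fc : continuous f. Proof. by apply/continuousP => U /fq. Qed.
Let cF : compact [set: F]. Proof. by case: Ff => -[]. Qed.

Variables (A : zmodType) (act : G -> A -> A).
Hypotheses (sA : smooth_module act) (pA : forall a : A, (a *+ p = 0)%R).

Local Notation B := (difference_module G A).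
Local Notation actB := (difference_act sA).

(** Over [F] the shifted cocycle is bounded by [c], which on [N] gives an equivariant homomorphism
    [th] into $C(G,A)/A$. Freeness lifts it to $C(G,A)$, and [t] is the lift evaluated at $1$. A
    cochain bounding [phi] over [F], corrected by an extension [gam] of [t], becomes invariant under
    [N] in both arguments and descends to [G]. *)
Lemma free_relators_H3 (phi : ('I_4 -> G) -> A) : cocycle act phi -> coboundary act phi.
Proof.
move=> phiP; have [cN nN RN] := closed_normal_closureP [set` R].
have [/cochainP[phi_lc phiM] phi0] := phiP.
have [[N1 NM NV] NJ] := nN.
have NJ' x n : N n -> N (n ^ x) by exact: NJ.
have fN n : N n -> f n = 1 by move/NE.
pose Phi := shift_cocycle phiP.
have [/cochainP[Phi_lc PhiM] Phi0] := shift_cocycleP cG sA phiP.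
have sB := difference_smooth cG sA.
have sBF : smooth_module (fun x => actB (f x)) by exact: smooth_comp.
pose z (x y : F) : B := Phi (tup3 1 (f x) (f (x * y))).
have cmulF : continuous (fun x : F * F => f (x.1 * x.2)).
  by move=> x; apply: (@continuous_comp _ _ _ (fun x : F * F => x.1 * x.2) f);
    [exact: mulg_continuous|exact: fc].
have cfstF : continuous (fun x : F * F => f x.1).
  by move=> x; apply: (@continuous_comp _ _ _ fst f); [exact: cvg_fst|exact: fc].
have zc : locally_constant (fun x : F * F => z x.1 x.2).
  apply: (@lc_comp _ {ptws 'I_3 -> G} _ Phi
    (fun x : F * F => tup3 1 (f x.1) (f (x.1 * x.2)))) => //.
  by apply: tup3_continuous => //; exact: cst_continuous.
have actz x y w : actB (f x) (z y w) = Phi (tup3 (f x) (f (x * y)) (f (x * y * w))).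
  by rewrite /z -PhiM tup3M mulg1 -!fM mulgA.
have zP x y w : (actB (f x) (z y w) - z (x * y)%g w + z x (y * w)%g - z x y = 0)%R.
  have := Phi0 (tup4 1 (f x) (f (x * y)) (f (x * y * w))).
  by rewrite codiff_tup4 actz /z mulgA => <-; zmod.
have pB (u : B) : (u *+ p = 0)%R.
  by apply: difference_ext => y y'; rewrite difference_Mn pA.
have [c [c_lc cM _]] := free_cochain_lift (fun=> 0%R) p_prime Ff sBF pB zc zP.
have z1 y : z 1 y = c 1.
  rewrite (cocycle1l sBF zP); have := cM 1 1; rewrite mulg1 (smod1 sBF) => e.
  apply/subr0_eq; move/eqP: e; rewrite -subr_eq0 => /eqP e; rewrite -[RHS]e; zmod.
have zf n n' x y : N n -> N n' -> z (n * x) (n' * y) = z x y.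
  by move=> Nn Nn'; rewrite /z !fM (fN n Nn) (fN n' Nn') !mul1g.
(* On [N] the cocycle [z] is constant with value [c 1], so [c] minus this constant is additive
   there. *)
pose th n : B := (c n - c 1%g)%R.
have cNl n x : N n -> c (n * x)%g = (th n + c x)%R.
  move=> Nn; rewrite cM fN// (smod1 sB).
  have -> : z n x = c 1 by have := zf n 1 1 x Nn N1; rewrite mulg1 mul1g z1.
  by rewrite /th; zmod.
have cNr n x : N n -> c (x * n)%g = (c x + actB (f x) (th n))%R.
  move=> Nn; rewrite cM.
  have -> : z x n = actB (f x) (c 1).
    have := zf 1 n x 1 N1 Nn; rewrite mul1g mulg1 => ->.
    by rewrite (cocycle1r (act := fun x => actB (f x)) zP x) z1.
  by rewrite /th (smodB sB); zmod.
have thJ n x : N n -> th (n ^ x) = actB (f x)^-1 (th n).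
  move=> Nn; have := cNr _ x (NJ' x n Nn); rewrite -conjgC cNl// addrC => /addrI ->.
  by rewrite (smodK sB).
have thM n n' : N n -> N n' -> th (n * n')%g = (th n + th n')%R.
  by move=> Nn Nn'; rewrite /th cNl// /th; zmod.
have th_near : \forall u \near (1 : F), th u = 0%R.
  have n1 : \forall u \near (1 : F), c u = c 1 by exact: c_lc.
  by apply: filterS n1 => u; rewrite /th => ->; rewrite subrr.
have dD (u v : B) y y' :
      difference (u + v)%R y y' = (difference u y y' + difference v y y')%R by [].
have dJ g (u : B) y y' :
      difference (actB g u) y y' = act g (difference u (g^-1 * y) (g^-1 * y')) by [].
have dth y r u u' : N r ->
    difference (th (r ^ y)) u u' = act (f y)^-1 (difference (th r) (f y * u) (f y * u')).
  by move=> Nr; rewrite thJ// dJ invgK.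
(* If $L(n)$ in $C(G,A)$ lifts [th n], equivariance determines $L(r^x)$ from $L(r)$; with the
   normalization $L(r)(1)=0$ these are the values of $L(r^x)(1)$. *)
have [|t [tN tR]] := @free_relators_lift p G F f R A
    (fun g r => act g^-1 (difference (th r) g 1)) p_prime Gp f_surj fR pA.
  apply: (lc_uncurry cF).
  have c1 : continuous (fst : G * F -> G) by move=> x; exact: cvg_fst.
  have c2 : continuous (snd : G * F -> F) by move=> x; exact: cvg_snd.
  apply: (lc_act sA (g := fun x : G * F => x.1^-1)); first exact: inv_continuous.
  apply: lc_difference => //; last exact: cst_continuous.
  exact: (lc_post (fun b => b - c 1%g)%R (lc_comp c_lc c2)).
(* Equivariance of the lift, read at $1$. Both sides are additive in [n], so conjugates of relators
   suffice. *)
have tJ n x : N n ->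
    (t (n ^ x)%g = act (f x)^-1%g (t n) + difference (th (n ^ x)%g) 1%g (f x)^-1%g)%R.
  move=> Nn; apply/subr0_eq; move: n Nn.
  have vN : hom_on N (fun n => t (n ^ x)%g
      - (act (f x)^-1%g (t n) + difference (th (n ^ x)%g) 1%g (f x)^-1%g))%R.
    apply: hom_onB; first exact: hom_on_conj.
    apply: hom_onD.
      split=> [n n' Nn Nn'|]; first by rewrite (hom_onM tN)// (smodD sA).
      by apply: filterS tN.2 => n tn Nn; rewrite tn// (smod0 sA).
    apply: (@hom_on_conj F N A (fun n => difference (th n) 1 (f x)^-1)) => //.
    split=> [n n' Nn Nn'|]; first by rewrite thM// dD.
    by apply: filterS th_near => n -> _.
  apply: (hom_on_closure_eq0 vN) => y r rR; have Nr := RN _ rR.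
  rewrite -conjgM !tR// dth// -(smodM sA) -invMg -fM -(smodD sA).
  have -> : f (y * x) * (f x)^-1 = f y by rewrite fM mulgK.
  by rewrite mulg1 [(difference _ (f y) _ + _)%R]addrC differenceD subrr.
have [gam [gam_lc gamM]] := hom_on_extension Ff.1 nN tN.
(* The first and last terms bound the pullback of [phi] to [F]; subtracting the coboundary of [gam]
   preserves this and removes the dependence on [N]. *)
pose a0 x y := (phi (tup4 1%g 1%g (f x) (f (x * y)%g))
  - (gam x + act (f x) (gam y) - gam (x * y)%g) - difference (actB (f x) (c y)) 1%g (f x))%R.
have a0l n x y : N n -> a0 (n * x) y = a0 x y.
  move=> Nn; by rewrite /a0 -mulgA !fM (fN n Nn) !mul1g (gamM n x Nn) (gamM n (x * y) Nn); zmod.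
have a0r n x y : N n -> a0 x (n * y) = a0 x y.
  move=> Nn; have Nn' : N (n ^ x^-1) by exact: NJ'.
  have e : x * (n * y) = n ^ x^-1 * (x * y) by rewrite !mulgA -conjgCV.
  have e2 : actB (f x) (th n) = th (n ^ x^-1) by rewrite thJ// (homV fM) invgK.
  rewrite /a0 e fM (fN _ Nn') mul1g cNl// (smodD sB) dD e2 (gamM _ _ Nn') (gamM _ _ Nn) (smodD sA).
  by rewrite (tJ n x^-1)// (homV fM) invgK; zmod.
have a0_eq x x' y y' : f x = f x' -> f y = f y' -> a0 x y = a0 x' y'.
  have NF u v : f u = f v -> N (u * v^-1) by move=> e; apply/NE; rewrite fM (homV fM) e mulgV.
  move=> /NF Nx /NF Ny.
  by rewrite -(mulgVK x' x) -(mulgVK y' y) a0l// a0r.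
have [s sE] := choice f_surj.
pose a g h := a0 (s g) (s h).
have aE x y : a (f x) (f y) = a0 x y by apply: a0_eq; exact: sE.
have a_lc : locally_constant (fun x : G * G => a x.1 x.2).
  apply: (lc_quotient2 fM f_surj fq).
  suff : locally_constant (fun x : F * F => a0 x.1 x.2).
    by move=> la x; apply: filterS (la x) => y; rewrite !aE.
  have c1 : continuous (fst : F * F -> F) by move=> x; exact: cvg_fst.
  have c2 : continuous (snd : F * F -> F) by move=> x; exact: cvg_snd.
  apply: (lc_post2 (fun u v => u - v)%R).
    apply: (lc_post2 (fun u v => u - v)%R).
      apply: (@lc_comp _ {ptws 'I_4 -> G} _ phi
        (fun x : F * F => tup4 1 1 (f x.1) (f (x.1 * x.2)))) => //.
      by apply: tup4_continuous => //; exact: cst_continuous.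
    apply: (lc_post2 (fun u v => u - v)%R).
      apply: (lc_post2 (fun u v => u + v)%R); first exact: (lc_comp gam_lc c1).
      by apply: (lc_act sA) => //; exact: (lc_comp gam_lc c2).
    exact: (lc_comp gam_lc (@mulg_continuous F)).
  apply: lc_difference => //; last exact: cst_continuous.
  by apply: (lc_act sB) => //; exact: (lc_comp c_lc c2).
exists (homogenize act a); first exact: homogenize_cochain.
(* [T1] comes from equivariance and [T3] from the equation for [c]; what remains is the cocycle
   identity of [phi] at a tuple with its first entry repeated. *)
have key x y w : phi (tup4 1 (f x) (f (x * y)) (f (x * y * w))) =
    (act (f x) (a0 y w) - a0 (x * y)%g w + a0 x (y * w)%g - a0 x y)%R.
  have D := differenceD (actB (f (x * y)) (c w)) 1 (f x) (f (x * y)).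
  have P0 := phi0 (tup5 1 1 (f x) (f (x * y)) (f (x * y * w))).
  rewrite codiff_tup5 in P0.
  have T1 : act (f x) (a0 y w) = (phi (tup4 (f x) (f x) (f (x * y)%g) (f (x * y * w)%g))
      - (act (f x) (gam y) + act (f (x * y)%g) (gam w) - act (f x) (gam (y * w)%g))
      - difference (actB (f (x * y)%g) (c w)) (f x) (f (x * y)%g))%R.
    rewrite /a0 !(smodB sA) (smodD sA) -phiM tup4M mulg1 -!fM mulgA -(smodM sA) -fM.
    by rewrite -difference_actJ mulg1 -(smodM sB) -!fM.
  have T3 : difference (actB (f x) (c (y * w)%g)) 1%g (f x) =
      (difference (actB (f x) (c y)) 1%g (f x)
       + difference (actB (f (x * y)%g) (c w)) 1%g (f x)
       - (phi (tup4 1%g (f x) (f (x * y)%g) (f (x * y * w)%g))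
          - phi (tup4 (f x) (f x) (f (x * y)%g) (f (x * y * w)%g))))%R.
    by rewrite cM (smodB sB) (smodD sB) actz -(smodM sB) -fM.
  rewrite T1 /a0 T3 !mulgA -D.
  by apply/subr0_eq; rewrite -[RHS]P0; zmod.
move=> v; have [v0 [v1 [v2 [v3 ->]]]] := tup4_eta v.
rewrite codiff_tup4 !homogenize_tup3.
have [x fx] := f_surj (v0^-1 * v1); have [y fy] := f_surj (v1^-1 * v2).
have [w fw] := f_surj (v2^-1 * v3).
have e1 : v1 = v0 * f x by rewrite fx mulVKg.
have e2 : v2 = v0 * f (x * y) by rewrite fM mulgA -e1 fy mulVKg.
have e3 : v3 = v0 * f (x * y * w) by rewrite fM mulgA -e2 fw mulVKg.
have inv g h : (v0 * g)^-1 * (v0 * h) = g^-1 * h by rewrite invMg -mulgA mulKg.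
have -> : v0^-1 * v2 = f (x * y) by rewrite e2 mulKg.
have -> : v1^-1 * v3 = f (y * w) by rewrite e1 e3 inv -mulgA [in LHS]fM mulKg.
rewrite -fx -fy -fw !aE e1 e2 e3.
have -> : tup4 v0 (v0 * f x) (v0 * f (x * y)) (v0 * f (x * y * w)) =
    (fun i => v0 * tup4 1 (f x) (f (x * y)) (f (x * y * w)) i).
  by rewrite tup4M mulg1.
rewrite phiM key (smodM sA).
move: (a0 y w) (a0 (x * y) w) (a0 x (y * w)) (a0 x y) => a1 a2 a3 a4.
by rewrite (smodB sA) (smodD sA) (smodB sA); zmod.
Qed.

End ThirdCohomology.

(** * Devissage of torsion coefficients *)

Section CochainOperations.
Local Open Scope ring_scope.
Variables (G : topGroupType) (A : zmodType) (act : G -> A -> A).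
Hypothesis sA : smooth_module act.

Lemma codiffD q (f g : ('I_q.+1 -> G) -> A) x :
  codiff (fun w => f w + g w) x = codiff f x + codiff g x.
Proof. by rewrite /codiff -big_split; apply: eq_bigr => i _; rewrite mulrzDl. Qed.

Lemma cochainB q (f g : ('I_q.+1 -> G) -> A) :
  cochain act f -> cochain act g -> cochain act (fun x => f x - g x).
Proof.
move=> /cochainP[fl fM] /cochainP[gl gM]; apply/cochainP; split.
  exact: (@lc_post2 {ptws 'I_q.+1 -> G} _ _ _ _ _ (fun a b => a - b) fl gl).
by move=> h x; rewrite fM gM (smodB sA).
Qed.

Lemma cochainD q (f g : ('I_q.+1 -> G) -> A) :
  cochain act f -> cochain act g -> cochain act (fun x => f x + g x).
Proof.
move=> /cochainP[fl fM] /cochainP[gl gM]; apply/cochainP; split.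
  exact: (@lc_post2 {ptws 'I_q.+1 -> G} _ _ _ _ _ (fun a b => a + b) fl gl).
by move=> h x; rewrite fM gM (smodD sA).
Qed.

Lemma cochainMn q (f : ('I_q.+1 -> G) -> A) n :
  cochain act f -> cochain act (fun x => f x *+ n).
Proof.
move=> /cochainP[fl fM]; apply/cochainP; split.
  exact: (@lc_post {ptws 'I_q.+1 -> G} _ _ _ (fun a => a *+ n) fl).
by move=> h x; rewrite fM (smodMn sA).
Qed.

Lemma cocycleMn q (f : ('I_q.+1 -> G) -> A) n :
  cocycle act f -> cocycle act (fun x => f x *+ n).
Proof.
move=> [fc f0]; split; first exact: cochainMn.
by move=> x; rewrite codiffMn f0 mul0rn.
Qed.

Lemma codiff_cochain q (f : ('I_q.+1 -> G) -> A) :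
  cochain act f -> cochain act (codiff f).
Proof.
move=> /cochainP[fl fM]; apply/cochainP; split; last first.
  move=> g x; rewrite /codiff (smod_sum sA); apply: eq_bigr => i _.
  by rewrite (smodMz sA) -fM.
apply: (@lc_sum {ptws 'I_q.+2 -> G} A q.+2 (fun i x =>
  f (fun j => x (lift i j)) *~ (-1) ^+ i)) => i.
apply: (@lc_post {ptws 'I_q.+2 -> G} _ _ _ (fun b => b *~ (-1) ^+ i)).
apply: (@lc_comp {ptws 'I_q.+2 -> G} {ptws 'I_q.+1 -> G} _ _
  (fun x j => x (lift i j)) fl).
by apply: ptws_continuous => j; exact: ptws_eval_continuous.
Qed.

Section Sub.
Variables (S : set A) (hS : zmod_set S) (actS : forall g a, S a -> S (act g a)).
Local Notation actT := (subzmod_act (hS := hS) actS).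

Lemma subzmod_codiff q (k : ('I_q.+1 -> G) -> subzmod hS) x :
  subzmod_val (codiff k x) = codiff (fun w => subzmod_val (k w)) x.
Proof.
by rewrite /codiff subzmod_val_sum; apply: eq_bigr => i _; rewrite subzmod_valMz.
Qed.

Lemma subzmod_cochain q (k : ('I_q.+1 -> G) -> subzmod hS) :
  cochain actT k -> cochain act (fun w => subzmod_val (k w)).
Proof.
move=> /cochainP[kl kM]; apply/cochainP; split.
  exact: (@lc_post {ptws 'I_q.+1 -> G} _ _ _ (fun a => subzmod_val a) kl).
by move=> g x; rewrite kM subzmod_actE.
Qed.

Lemma subzmod_cocycle q (k : ('I_q.+1 -> G) -> subzmod hS) :
  cocycle act (fun w => subzmod_val (k w)) -> cocycle actT k.
Proof.
move=> [/cochainP[kl kM] k0]; split.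
  apply/cochainP; split; first exact: (@lc_subzmod _ _ _ {ptws 'I_q.+1 -> G}).
  by move=> g x; apply: subzmod_val_inj; rewrite kM.
by move=> x; apply: subzmod_val_inj; rewrite subzmod_codiff k0.
Qed.

End Sub.
End CochainOperations.

Section Torsion.
Local Open Scope ring_scope.
Variables (p : nat) (G : topGroupType) (q : nat).
Hypotheses (p_prime : prime p) (cG : compact [set: G]).
Hypothesis elementary : forall (A : zmodType) (act : G -> A -> A) f,
  smooth_module act -> (forall a : A, a *+ p = 0) ->
  cocycle (q := q.+1) act f -> coboundary act f.

(** Induction on the exponent of the cocycle: $pf$ has values in $pA$ and is killed by a smaller
    power, so it is the coboundary of some [h] with values in $pA$. Dividing [h] by $p$ and
    subtracting leaves a cocycle in the $p$-torsion, covered by the elementary case. *)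
Lemma p_power_coboundary k (A : zmodType) (act : G -> A -> A) f :
  smooth_module act -> cocycle (q := q.+1) act f -> (forall x, f x *+ (p ^ k)%N = 0) ->
  coboundary act f.
Proof.
elim: k A act f => [|k IH] A act f sA fP fk.
  exists (fun=> 0); last first.
    move=> x; have := fk x; rewrite expn0 mulr1n => ->.
    by rewrite /codiff big1// => i _; rewrite mul0rz.
  apply/cochainP; split=> [|g x]; first exact: (@lc_cst {ptws 'I_q.+1 -> G}).
  by rewrite (smod0 sA).
pose S : set A := [set a | exists b, a = b *+ p].
have zS : zmod_set S.
  split; first by exists 0; rewrite mul0rn.
  by move=> a b [a' ->] [b' ->]; exists (a' - b'); rewrite mulrnBl.
have aS g a : S a -> S (act g a).
  by move=> [b ->]; exists (act g b); rewrite (smodMn sA).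
have Sf x : S (f x *+ p) by exists (f x).
pose pf x : subzmod zS := subzmod_mk zS (Sf x).
have [h hP hE] : coboundary (subzmod_act aS) pf.
  apply: IH.
  - exact: subzmod_smooth.
  - by apply: subzmod_cocycle => //; exact: cocycleMn.
  - move=> x; apply: subzmod_val_inj; rewrite subzmod_valMn subzmod_mkK.
    by rewrite -mulrnA -expnS fk.
have r_ex a : exists b, S a -> b *+ p = a.
  by have [[b ->]|nS] := pselect (S a); [exists b|exists 0].
have [r rE] := choice r_ex.
have /cochainP[hl hM] := subzmod_cochain hP.
(* Roots are chosen after translating the first argument to $1$, and the result is translated back,
   so that the arbitrary choice [r] respects equivariance. *)
pose h' (x : 'I_q.+1 -> G) := act (x ord0)
  (r (subzmod_val (h (fun i => (x ord0)^-1 * x i)%g))).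
have h'p x : h' x *+ p = subzmod_val (h x).
  rewrite /h' -(smodMn sA) rE; last exact: subzmod_valP.
  by rewrite hM -(smodM sA) mulgV (smod1 sA).
have h'P : cochain act h'.
  apply/cochainP; split; last first.
    move=> g x; rewrite /h' (smodM sA); congr (act g (act _ (r (subzmod_val (h _))))).
    by apply/funext => i; rewrite invMg mulgA mulgKV.
  have ev i : continuous (fun v : {ptws 'I_q.+1 -> G} => v i) by exact: ptws_eval_continuous.
  apply: (@lc_act G A act sA {ptws 'I_q.+1 -> G}); first exact: ev.
  apply: (@lc_post {ptws 'I_q.+1 -> G} _ _ _ r).
  apply: (@lc_comp {ptws 'I_q.+1 -> G} {ptws 'I_q.+1 -> G} _ _
    (fun x i => (x ord0)^-1 * x i)%g hl).
  apply: ptws_continuous => i.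
  exact: (mul_continuous (inv_continuous (ev ord0)) (ev i)).
pose S1 : set A := [set a | a *+ p = 0].
have zS1 : zmod_set S1.
  by split=> [|a b Sa Sb]; rewrite /S1 /= ?mul0rn// mulrnBl Sa Sb subrr.
have aS1 g a : S1 a -> S1 (act g a).
  by rewrite /S1 /= => Sa; rewrite -(smodMn sA) Sa (smod0 sA).
have Sg x : S1 (f x - codiff h' x).
  rewrite /S1 /= mulrnBl -codiffMn.
  have -> : (fun x => h' x *+ p) = (fun x => subzmod_val (h x)).
    by apply/funext => v; exact: h'p.
  by rewrite -subzmod_codiff -hE subzmod_mkK subrr.
pose g x : subzmod zS1 := subzmod_mk zS1 (Sg x).
have [k' k'P k'E] : coboundary (subzmod_act aS1) g.
  apply: elementary.
  - exact: subzmod_smooth.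
  - move=> a; apply: subzmod_val_inj; rewrite subzmod_valMn.
      by have Sa := subzmod_valP a; exact: Sa.
  - apply: subzmod_cocycle; split.
      by apply: (cochainB sA); [case: fP|exact: (codiff_cochain sA h'P)].
    by move=> x; rewrite codiffB codiffK subr0; case: fP.
exists (fun x => subzmod_val (k' x) + h' x).
  by apply: cochainD => //; exact: subzmod_cochain k'P.
move=> x; rewrite codiffD -subzmod_codiff -k'E subzmod_mkK; zmod.
Qed.

(** A cochain has finite range, so some $M=p^em'$ with $m'$ prime to $p$ kills [f]. Then $m'f$ is a
    coboundary by devissage and $p^kf$ by hypothesis; a Bezout relation gives [f]. *)
Lemma torsion_coboundary (A : zmodType) (act : G -> A -> A) f :
  smooth_module act -> (forall a : A, exists2 m, (0 < m)%N & a *+ m = 0) ->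
  cocycle (q := q.+1) act f -> (exists k, coboundary act (fun x => f x *+ (p ^ k)%N)) ->
  coboundary act f.
Proof.
move=> sA tA fP [k [h hP hE]].
have [m mE] := choice (fun a => let: ex_intro2 m m0 am := tA a in
  ex_intro (fun m => (0 < m)%N /\ a *+ m = 0) m (conj m0 am)).
have [/cochainP[fl _] _] := fP.
have fin : finite_set (range f).
  by apply: (@lc_finite {ptws 'I_q.+2 -> G}) => //; exact: ptws_compact.
pose M := (\prod_(a <- fset_set (range f)) m a)%N.
have M0 : (0 < M)%N by rewrite prodn_gt0// => a; have [] := mE a.
have fM x : f x *+ M = 0.
  have fx : f x \in fset_set (range f) by rewrite in_fset_set// inE; exists x.
  rewrite /M (big_rem (f x))//= mulrnA; have [_ ->] := mE (f x).
  by rewrite mul0rn.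
have [m' pm' ME] := pfactor_coprime p_prime M0.
have [h1 h1P h1E] : coboundary act (fun x => f x *+ m').
  apply: (@p_power_coboundary (logn p M)) => //; first exact: cocycleMn.
  by move=> x; rewrite -mulrnA -ME fM.
have m'0 : (0 < m')%N by move: M0; rewrite ME muln_gt0 => /andP[].
have co : coprime m' (p ^ k) by rewrite coprime_sym coprimeXl.
have [[u v] /= uv] := coprimeP _ m'0 co.
exists (fun x => h1 x *+ u - h x *+ v).
  by apply: cochainB => //; exact: cochainMn.
move=> x; rewrite codiffB !codiffMn -h1E -hE -!mulrnA.
have -> : (m' * u = p ^ k * v + 1)%N.
  by rewrite mulnC [(p ^ k * v)%N]mulnC -uv subnKC// ltnW// -subn_gt0 uv.
by rewrite mulrnDr mulr1n; zmod.
Qed.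
End Torsion.

(** Dimension shifting lowers the degree to $3$ and keeps the coefficients killed by $p$, so
    freeness enters only there. *)
Lemma free_relators_cdp (p : nat) (G F : topGroupType) (X : finType) (iota : X -> F)
    (R : {fset F}) (f : F -> G) :
  prime p -> pro_p p G -> free_pro_p p iota -> is_hom f ->
  (forall g, exists x, f x = g) ->
  (forall U : set G, open U <-> open (f @^-1` U)) ->
  f @^-1` [set 1] = closed_normal_closure [set` R] ->
  free_relators p f R -> cdp_le p G 2.
Proof.
move=> p_prime Gp Ff fM fs fq fK fR A act /discrete_moduleP sA tA q q2.
have cG : compact [set: G] by case: Gp.
have elementary n (B : zmodType) (actB : G -> B -> B) (phi : ('I_n.+4 -> G) -> B) :
    smooth_module actB -> (forall b : B, b *+ p = 0)%R ->
    cocycle actB phi -> coboundary actB phi.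
  elim: n B actB phi => [|n IH] B actB phi sB pB phiP.
    exact: (free_relators_H3 p_prime Gp Ff fM fs fq fK fR sB pB phiP).
  apply: (@shift_coboundary _ _ _ sB _ phi phiP); apply: IH.
  - exact: difference_smooth.
  - by move=> u; apply: difference_ext => y y'; rewrite difference_Mn pB.
  - exact: shift_cocycleP.
case: q q2 => [|[|[|n]]]// _ phi phiP [k phik].
apply: (torsion_coboundary p_prime cG _ sA tA phiP); last by exists k.
by move=> B actB psi; exact: elementary.
Qed.

(** * From vanishing of $H^3$ to free relators *)

Lemma lc_quotient3 (F G : topGroupType) (f : F -> G) (A : Type) (a : G -> G -> G -> A) :
  is_hom f -> (forall g, exists x, f x = g) ->
  (forall U : set G, open U <-> open (f @^-1` U)) ->
  locally_constant (fun x : F * (F * F) => a (f x.1) (f x.2.1) (f x.2.2)) ->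
  locally_constant (fun x : G * (G * G) => a x.1 x.2.1 x.2.2).
Proof.
move=> fM fs fq la [g [h k]].
have [x <-] := fs g; have [y <-] := fs h; have [z <-] := fs k.
have [[V W] /= [Vx [[W1 W2] /= [W1y W2z] WW]] VW] := la (x, (y, z)).
exists (f @` V, (f @` W1) `*` (f @` W2)).
  split=> /=; first exact: quotient_nbhs.
  by exists (f @` W1, f @` W2) => //; split; exact: quotient_nbhs.
move=> [g' [h' k']] /= [[x' Vx' <-] [[y' Wy' <-] [z' Wz' <-]]].
by apply: (VW (x', (y', z'))); split=> //=; apply: WW.
Qed.

Section Converse.
Variables (p : nat) (G F : topGroupType) (X : finType) (iota : X -> F)
  (R : {fset F}) (f : F -> G).
Hypotheses (p_prime : prime p) (Gp : pro_p p G) (Ff : free_pro_p p iota)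
  (fM : is_hom f) (f_surj : forall g, exists x, f x = g)
  (fq : forall U : set G, open U <-> open (f @^-1` U))
  (fK : f @^-1` [set 1] = closed_normal_closure [set` R])
  (indR : independent_relators p R).
Hypothesis H3 : forall phi : ('I_4 -> G) -> 'F_p,
  cocycle (fun _ a => a) phi -> coboundary (fun _ a => a) phi.

Local Notation N := (closed_normal_closure [set` R]).
Let NE x : N x <-> f x = 1. Proof. by rewrite -fK. Qed.
Let cG : compact [set: G]. Proof. by case: Gp. Qed.
Let fc : continuous f. Proof. by apply/continuousP => U /fq. Qed.

Section Splitting.
Variables (U : set G) (oU : open U) (nU : normal_set U).
Variable (m : nat) (c : G -> 'I_m).
Hypothesis cE : forall x y, c x = c y <-> U (x^-1 * y).
(* [a] is a 1-cocycle of [G] modulo [U] with values in the homomorphisms [N -> 'F_p]. *)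
Variable a : 'I_m -> F -> 'F_p.
Hypotheses (aN : forall i, hom_on N (a i))
  (aM : forall x y n, N n ->
     (a (c (f (x * y)%g)) n = a (c (f x)) n + a (c (f y)) (n ^ x)%g)%R).

(** Extending [a] from [N] to [F] gives a 2-cochain [g] whose coboundary depends only on images in
    [G]: the transgression. Once this 3-cocycle is bounded on [G] by [h], the difference of [g] and
    the pullback of [h] is a 2-cocycle on [F], bounded by some [k]; [l] is [k] on [N], normalized at
    $1$. *)
Lemma cocycle_splits : exists l : F -> 'F_p, hom_on N l /\
  forall x n, N n -> (l (n ^ x)%g = l n + a (c (f x)) n)%R.
Proof.
have [cN nN RN] := closed_normal_closureP [set` R].
have [[N1 NM NV] NJ] := nN.
have NJ' x n : N n -> N (n ^ x) by exact: NJ.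
have fN n : N n -> f n = 1 by move/NE.
have lc_c : locally_constant c.
  move=> x; apply: filterS (near_mull x (open_subgroup_nbhs nU.1 oU)) => y xy.
  by apply/esym/cE.
have sT := @trivial_smooth F 'F_p.
have tN : hom_on N (fun n => (fun i => a i n) : 'I_m -> 'F_p).
  split=> [x y Nx Ny|].
    by apply/funext => i; rewrite (hom_onM (aN i)).
  have n1 : \forall u \near (1 : F), forall i, N u -> a i u = 0%R.
    by apply: filter_forall => i; have [] := aN i.
  by apply: filterS n1 => u ua Nu; apply/funext => i; exact: ua.
(* All the [a i] are extended together, as one homomorphism into functions on the cosets. *)
have [gam [gam_lc gamM]] := hom_on_extension Ff.1 nN tN.
(* The inverse converts the right conjugation action in [aM] into a left one, as the formula for
   [f3] requires. *)
pose b x n := (- a (c (f x)^-1%g) n)%R.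
have bJ x y n : N n -> b x (n ^ y^-1) = (b (x * y)%g n - b y n)%R.
  move=> Nn; rewrite /b fM invMg -!(homV fM) -fM aM//; zmod.
pose g x y := (- gam y (c (f x)^-1%g))%R.
have gr n x y : N n -> g x (n * y) = (b x n + g x y)%R.
  by move=> Nn; rewrite /g gamM// /b; change (- (a (c (f x)^-1%g) n + gam y (c (f x)^-1%g)) =
    - a (c (f x)^-1%g) n + - gam y (c (f x)^-1%g))%R; zmod.
have g_eq x x' y : f x = f x' -> g x y = g x' y by move=> e; rewrite /g e.
pose f3 x y z := (g y z - g (x * y)%g z + g x (y * z)%g - g x y)%R.
have swap (x n : F) : x * n = n ^ x^-1 * x by exact: conjgCV.
have f3_eq x x' y y' z z' : f x = f x' -> f y = f y' -> f z = f z' ->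
    f3 x y z = f3 x' y' z'.
  have NF u v : f u = f v -> exists2 n, N n & u = n * v.
    by move=> e; exists (u * v^-1); [apply/NE; rewrite fM (homV fM) e mulgV|rewrite mulgVK].
  move=> ex ey ez.
  have -> : f3 x y z = f3 x' y z.
    rewrite /f3 (@g_eq (x * y) (x' * y)) ?fM ?ex//.
    by rewrite (@g_eq x x' (y * z))// (@g_eq x x' y).
  have -> : f3 x' y z = f3 x' y' z.
    have [n Ny ->] := NF _ _ ey.
    rewrite /f3 -(mulgA n) (gr n x' (y' * z))// (gr n x' y')//.
    rewrite (@g_eq (n * y') y') ?fM ?(fN n) ?mul1g//.
    rewrite (@g_eq (x' * (n * y')) (x' * y')); last by rewrite (fM x') (fM n y') (fN n)// mul1g fM.
    by zmod.
  have [n Nz ->] := NF _ _ ez.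
  rewrite /f3 (_ : y' * (n * z') = n ^ y'^-1 * (y' * z')); last by rewrite !mulgA -swap.
  rewrite (gr n y' z')// (gr n (x' * y') z')// (gr (n ^ y'^-1) x')// ?bJ//; last exact: NJ'.
  zmod.
have [s sE] := choice f_surj.
pose F3 x y z := f3 (s x) (s y) (s z).
have F3E x y z : F3 (f x) (f y) (f z) = f3 x y z by apply: f3_eq; exact: sE.
have g_lc : locally_constant (fun x : F * F => g x.1 x.2).
  have c1 : continuous (fun x : F * F => (f x.1)^-1).
    apply: inv_continuous => x; apply: (@continuous_comp _ _ _ fst f).
      exact: cvg_fst.
    exact: fc.
  have c2 : continuous (snd : F * F -> F) by move=> x; exact: cvg_snd.
  exact: (lc_post2 (fun (h : 'I_m -> 'F_p) i => - h i)%R (lc_comp gam_lc c2) (lc_comp lc_c c1)).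
have F3_lc : locally_constant (fun x : G * (G * G) => F3 x.1 x.2.1 x.2.2).
  apply: (lc_quotient3 fM f_surj fq).
  suff : locally_constant (fun x : F * (F * F) => f3 x.1 x.2.1 x.2.2).
    by move=> l3 x; apply: filterS (l3 x) => y; rewrite !F3E.
  have c1 : continuous (fun x : F * (F * F) => x.1) by move=> x; exact: cvg_fst.
  have c2 : continuous (fun x : F * (F * F) => x.2.1).
    move=> x; apply: (@continuous_comp _ _ _ snd fst); first exact: cvg_snd.
    exact: cvg_fst.
  have c3 : continuous (fun x : F * (F * F) => x.2.2).
    move=> x; apply: (@continuous_comp _ _ _ snd snd); first exact: cvg_snd.
    exact: cvg_snd.
  have gl (y y' : F * (F * F) -> F) : continuous y -> continuous y' ->
      locally_constant (fun x => g (y x) (y' x)).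
    by move=> yc y'c; exact: (lc_comp g_lc (pair_continuous yc y'c)).
  apply: (lc_post2 (fun u v => u - v)%R); last exact: gl.
  apply: (lc_post2 (fun u v => u + v)%R); last by apply: gl => //; exact: mul_continuous.
  by apply: (lc_post2 (fun u v => u - v)%R); apply: gl => //; exact: mul_continuous.
pose phi (v : 'I_4 -> G) : 'F_p :=
  F3 ((v ord0)^-1 * v (lift ord0 ord0))
     ((v (lift ord0 ord0))^-1 * v (lift ord0 (lift ord0 ord0)))
     ((v (lift ord0 (lift ord0 ord0)))^-1 * v (lift ord0 (lift ord0 (lift ord0 ord0)))).
have phiE x y z w : phi (tup4 x y z w) = F3 (x^-1 * y) (y^-1 * z) (z^-1 * w).
  by rewrite /phi /tup4 /tup3 !(fcons0, fconsS).
pose gh (w : 'I_3 -> F) := g ((w ord0)^-1 * w (lift ord0 ord0))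
  ((w (lift ord0 ord0))^-1 * w (lift ord0 (lift ord0 ord0))).
have ghE x y z : gh (tup3 x y z) = g (x^-1 * y) (y^-1 * z).
  by rewrite /gh /tup3 !(fcons0, fconsS).
have phif w : phi (fun i => f (w i)) = codiff gh w.
  have [x [y [z [t ->]]]] := tup4_eta w.
  rewrite codiff_tup4 !ghE (_ : (fun i => _) = tup4 (f x) (f y) (f z) (f t)).
    rewrite phiE -!(homV fM) -!fM F3E /f3 !mulgA !mulgK; zmod.
  by rewrite /tup4 /tup3 !fcons_map.
have phi_cocycle : cocycle (fun _ a => a) phi.
  split; last first.
    move=> v; have -> : v = (fun i => f (s (v i))) by apply/funext => i; rewrite sE.
    have phif' : codiff gh = (fun w => phi (fun i => f (w i))) by apply/funext => w; rewrite phif.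
    by rewrite -[RHS](codiffK gh (fun i => s (v i))) phif'.
  apply/cochainP; split; last first.
    by move=> h v; rewrite /phi !invMg !mulgA !mulgVK.
  have ev i : continuous (fun v : {ptws 'I_4 -> G} => v i) by exact: ptws_eval_continuous.
  have dc i j : continuous (fun v : {ptws 'I_4 -> G} => (v i)^-1 * v j).
    exact: (mul_continuous (inv_continuous (ev i)) (ev j)).
  exact: (@lc_comp {ptws 'I_4 -> G} _ _ _ _ F3_lc
    (pair_continuous (dc _ _) (pair_continuous (dc _ _) (dc _ _)))).
have [h /cochainP[h_lc hM] hE] := H3 phi_cocycle.
pose Hh x y := h (tup3 1 (f x) (f (x * y))).
pose w x y := (g x y - Hh x y)%R.
have f3H x y z : f3 x y z = (Hh y z - Hh (x * y)%g z + Hh x (y * z)%g - Hh x y)%R.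
  have := hE (tup4 1 (f x) (f (x * y)) (f (x * y * z))).
  rewrite phiE codiff_tup4 invg1 mul1g !(fM (x * y)) (fM x) !mulKg F3E => ->.
  have -> : h (tup3 (f x) (f x * f y) (f x * f y * f z)) = Hh y z.
    by rewrite /Hh -[RHS](hM (f x)) tup3M mulg1 fM mulgA.
  by rewrite /Hh !mulgA !fM; zmod.
have wP x y z : (w y z - w (x * y)%g z + w x (y * z)%g - w x y = 0)%R.
  by have /eqP := f3H x y z; rewrite -subr_eq0 => /eqP <-; rewrite /w /f3; zmod.
have w_lc : locally_constant (fun x : F * F => w x.1 x.2).
  apply: (lc_post2 (fun u v => u - v)%R g_lc).
  apply: (@lc_comp _ {ptws 'I_3 -> G} _ h
    (fun x : F * F => tup3 1 (f x.1) (f (x.1 * x.2)))) => //.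
  apply: tup3_continuous; first exact: cst_continuous.
    by move=> x; apply: (@continuous_comp _ _ _ fst f); [exact: cvg_fst|exact: fc].
  by move=> x; apply: (@continuous_comp _ _ _ (fun x : F * F => x.1 * x.2) f);
    [exact: mulg_continuous|exact: fc].
have [k [k_lc kM _]] := free_cochain_lift (fun=> 0%R) p_prime Ff sT
  (fun a => Fp_mulrn a p_prime) w_lc wP.
have w11 : w 1 1 = k 1.
  have /eqP := kM 1 1; rewrite mulg1 -subr_eq0 => /eqP e.
  by apply/subr0_eq; rewrite -[RHS]e; zmod.
have w_eq n x y : N n -> w (n * x) y = w x y.
  by move=> Nn; rewrite /w /Hh -mulgA !(fM n) (fN n)// !mul1g (@g_eq (n * x) x) ?fM ?(fN n) ?mul1g.
pose l n := (k n - k 1%g)%R.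
have kl n x : N n -> k (n * x)%g = (l n + k x)%R.
  move=> Nn; rewrite kM -[X in w X _]mulg1 w_eq// (cocycle1l sT wP) w11 /l; zmod.
have kr n x : N n -> k (x * n)%g = (k x + l n - b x n)%R.
  move=> Nn; rewrite kM.
  have -> : w x n = (b x n + w x 1%g)%R.
    rewrite /w -[in g x n](mulg1 n) gr// /Hh !fM (fN n)// (fN 1)//; zmod.
  by rewrite (cocycle1r (act := fun _ a => a) wP x) w11 /l; zmod.
exists l; split.
  split=> [n n' Nn Nn'|]; first by rewrite /l kl// /l; zmod.
  have n1 : \forall u \near (1 : F), k u = k 1 by exact: k_lc.
  by apply: filterS n1 => u e _; rewrite /l e subrr.
move=> x n Nn; have := kr n x^-1 Nn.
rewrite (swap x^-1) invgK kl; last exact: NJ'.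
rewrite /b (homV fM) invgK => /eqP; rewrite -subr_eq0 => /eqP e.
by apply/subr0_eq; rewrite -[RHS]e; zmod.
Qed.

End Splitting.

Lemma H3_free_relators : free_relators p f R.
Proof.
move=> U r0 x0 oU nU r0R.
have [cN nN RN] := closed_normal_closureP [set` R].
have NJ x n : N n -> N (n ^ x) by case: nN => _; apply.
have [c [c_surj cE]] := coset_space cG nU.1 oU.
have cM x y z : c x = c y -> c (z * x) = c (z * y).
  by move=> /cE xy; apply/cE; rewrite invMg -mulgA mulKg.
have cMr x y z : c x = c y -> c (x * z) = c (y * z).
  move=> /cE xy; apply/cE; have := nU.2 z _ xy; congr U.
  by rewrite conjgE invMg !mulgA.
pose Q := ('I_(group_index U) * R)%type.
pose S := [set u : Q -> 'F_p | exists t : F -> 'F_p, hom_on N t /\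
  forall x (r : R), t (val r ^ x) = u (c (f x), r)].
suff Sall u : S u.
  have [t [tN tR]] := Sall (fun q => if (val q.2 == r0) && (q.1 == c (f x0)) then 1%R else 0%R).
  exists t; split=> // x r rR; rewrite (tR x [` rR]%fset) /=; congr (if _ && _ then _ else _).
  by apply/eqP/asboolP => /cE.
apply: contrapT => Su.
have [s sE] := choice c_surj.
pose r1 g (q : Q) : Q := (c (s q.1 * g), q.2).
have r1E g x r : r1 g (c x, r) = (c (x * g), r).
  by congr (_, _); apply: cMr; exact: sE.
have r1_inj g : injective (r1 g).
  move=> [i r] [j r'] [e1 e2]; congr (_, _) => //.
  by have := cMr _ _ g^-1 e1; rewrite !mulgK !sE.
pose rho g : {perm Q} := perm (@r1_inj g).
have rhoE g x r : rho g (c x, r) = (c (x * g), r) by rewrite permE r1E.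
pose P : {set {perm Q}} := [set a | `[< exists g, rho g = a >]]%SET.
have gP : group_set P.
  apply/group_setP; split.
    rewrite inE; apply/asboolP; exists (1 : G); apply/permP => -[i r].
    by have [x <-] := c_surj i; rewrite rhoE perm1 mulg1.
  move=> a b; rewrite !inE => -[g <-] [h <-]; exists (g * h).
  by apply/permP => -[i r]; have [x <-] := c_surj i; rewrite permM !rhoE mulgA.
have pP : p.-group (Group gP).
  apply: pgroup_of_p_elements => // a; rewrite !inE => -[g <-].
  have rX n : rho g ^+ n = rho (g ^+ n).
    elim: n => [|n IH].
      apply/permP => -[i r]; have [x <-] := c_surj i.
      by rewrite !expg0 rhoE perm1 mulg1.
    rewrite expgS IH; apply/permP => -[i r]; have [x <-] := c_surj i.
    by rewrite permM !rhoE expgS mulgA.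
  have U1 : nbhs 1 U by exact: open_subgroup_nbhs nU.1 oU.
  have [k Uk] := pro_p_expg_nbhs g p_prime Gp U1.
  exists k; rewrite rX; apply/permP => -[i r]; have [x <-] := c_surj i.
  rewrite perm1 rhoE; congr (_, _); apply/esym/cE; by rewrite mulKg.
have [|||u' [Su' uP]] := @fixed_mod_subspace p Q (Group gP) S u p_prime pP _ _ _ Su.
- by exists (fun=> 0%R); split=> //; split=> *; [rewrite addr0|exact: nearW].
- move=> v w [t [tN tv]] [t' [t'N t'w]]; exists (fun x => t x - t' x)%R.
  by split=> [|x r]; [exact: hom_onB|rewrite tv t'w].
- move=> a v; rewrite !inE => -[g <-] [t [tN tv]]; have [y <-] := f_surj g.
  exists (fun n => t (n ^ y)); split=> [|x r]; first exact: hom_on_conj.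
  by rewrite -conjgM tv fM rhoE.
(* The defect of [u'] under translation by [s i] lies in [S], so a homomorphism on [N] realizes it.
   Since its values on conjugates of relators determine it, these choices satisfy the cocycle rule
   [aM]. *)
have a_ex i : exists t : F -> 'F_p, hom_on N t /\
    forall x (r : R), (t (val r ^ x)%g = u' (c (f x * s i)%g, r) - u' (c (f x), r))%R.
  have aP : rho (s i) \in Group gP by rewrite !inE; exists (s i).
  have [t [tN tR]] := uP _ aP; exists t; split=> // x r.
  by rewrite tR rhoE.
have [a aP] := choice a_ex.
have aR y x (r : R) : (a (c (f y)) (val r ^ x)%g = u' (c (f (x * y)%g), r) - u' (c (f x), r))%R.
  by have [_ ->] := aP (c (f y)); rewrite (cM _ _ (f x) (sE (c (f y)))) fM.
have aN i : hom_on N (a i) by have [] := aP i.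
have aM x y n : N n ->
    (a (c (f (x * y)%g)) n = a (c (f x)) n + a (c (f y)) (n ^ x)%g)%R.
  move=> Nn; apply/subr0_eq; move: n Nn.
  have vN : hom_on N (fun n => a (c (f (x * y)%g)) n -
      (a (c (f x)) n + a (c (f y)) (n ^ x)%g))%R.
    by apply: hom_onB => //; apply: hom_onD => //; exact: hom_on_conj.
  apply: (hom_on_closure_eq0 vN) => z r rR.
  rewrite -conjgM (aR _ _ [` rR]%fset) (aR _ _ [` rR]%fset) (aR _ _ [` rR]%fset) mulgA; zmod.
have [l [lN lJ]] := cocycle_splits oU nU cE aN aM.
have NR (r : R) : N (val r) by apply: RN; exact: fsvalP.
(* After subtracting [l], the function [u'] depends only on the relator and not on the coset;
   independence realizes it by an invariant [t], so [u'] lies in [S]. *)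
have [t [tN tJ tR]] := indR (fun r => if insub r is Some r' then u' (c 1%g, r') - l r else 0)%R.
apply: Su'; exists (fun n => l n + t n)%R; split=> [|x r]; first exact: hom_onD.
rewrite lJ// tJ// tR ?valK; last exact: fsvalP.
have := aR x 1 r; rewrite conjg1 mul1g (hom1 fM) => ->; zmod.
Qed.

End Converse.

Theorem theorem11 (p : nat) (G : topGroupType) (p_prime : prime p)
    (G_pro_p : pro_p p G) (G_fp : finitely_presented_pro_p p G) :
  (forall (H : set G) (sH : subgroup_set H), open H ->
     (deficiency p (subgroup_type sH) - 1 =
        (group_index H)%:Z * (deficiency p G - 1))%R)
  <-> cdp_le p G 2.
Proof.
have [F [X [iota [R0 [Ff [f [fM fs fq fK0]]]]]]] := G_fp.
have [R [_ RR0 indR]] := independent_subset R0 p_prime Ff.1.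
have fK : f @^-1` [set 1%g] = closed_normal_closure [set` R] by rewrite fK0 RR0.
split=> [euler|cd2].
  apply: (free_relators_cdp p_prime G_pro_p Ff fM fs fq fK).
  apply: (deficiency_free_relators p_prime G_pro_p Ff fM fs fq fK indR).
  by move=> H sH oH _; exact: euler.
move=> H sH oH.
apply: (free_relators_deficiency p_prime G_pro_p Ff fM fs fq fK indR) => //.
apply: (H3_free_relators p_prime G_pro_p Ff fM fs fq fK indR) => phi phiP.
apply: (cd2 'F_p (fun _ a => a) _ _ 3) => //.
- exact/discrete_moduleP/trivial_smooth.
- by move=> a; exists p; [exact: prime_gt0|exact: Fp_mulrn].
(* One factor $p$ annihilates every cochain with values in ['F_p], so each class is $p$-primary. *)
exists 1%N; exists (fun=> 0%R) => [|x].
  by apply/cochainP; split=> //; exact: (@lc_cst {ptws 'I_3 -> G}).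
by rewrite Fp_mulrn// /codiff big1// => i _; rewrite mul0rz.
Qed.
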